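(* Let $M$ be a simply connected Delaunay triangulation of $\mathcal D_1$. Suppose that Assumptions (A3) and (A5) given in the context hold. Then the iterative bijection correction algorithm (described in the context) converges in $n_c$ steps, i.e. it terminates with an orientation-preserving map $\phi^k_M$ for some $k\le n_c$, where $$n_c:=\min\Big\{n\ :\ \big(\mathcal O(M)\cup\mathcal L(M)\big)\setminus\Big(\bigcup_{k=1}^n\mathcal N^k\Big)=\varnothing\Big\}+1<n_v,$$ and $n_v$ is the number of vertices of $M$.
   Context: Let $a,b,w>0$, $\mathcal D_1=[0,a]\times[0,b]$, $\mathcal D_2=[0,wa]\times[0,b]$. Let $\mathcal O_1,\dots,\mathcal O_K,\mathcal L_1,\dots,\mathcal L_J\subseteq\mathcal D_1$ be such that $\mathcal O_1,\dots,\mathcal O_K,\mathcal L_1,\dots,\mathcal L_J,\partial\mathcal D_1$ are pairwise disjoint. Given data: $r_{\mathcal O}>0$; $2\times2$ diagonal matrices $R_{\mathcal L_j}$ with positive diagonal entries; vectors $\mathbf t_{\mathcal O_i},\mathbf t_{\mathcal L_j}\in\mathbb R^2$; and a bijective continuous map $g:\partial\mathcal D_1\to\partial\mathcal D_2$ with $g(0,0)=(0,0)$, $g(a,0)=(wa,0)$, $g(0,b)=(0,b)$, $g(a,b)=(wa,b)$. $M$ is a finite triangulation whose triangles cover exactly $\mathcal D_1$, with vertices $\mathcal V(M)$, edges $\mathcal E(M)$ and (closed) triangles $\mathcal F(M)$. Set: - $\mathcal O_i(M)$ = the set of vertices of triangles $\tau$ with $\operatorname{int}(\tau)\cap\mathcal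 O_i\ne\varnothing$, and $\mathcal O(M)=\bigcup_i\mathcal O_i(M)$; - $\mathcal L_j(M)$ = the set of vertices of triangles $\tau$ with $\operatorname{int}(\tau)\cap\mathcal L_j\neq\varnothing$ together with endpoints of edges whose relative interior meets $\mathcal L_j$, and $\mathcal L(M)=\bigcup_j\mathcal L_j(M)$; - $\mathcal B(M)=\mathcal V(M)\cap\partial\mathcal D_1$. The sets $\mathcal O_1(M),\dots,\mathcal O_K(M),\mathcal L_1(M),\dots,\mathcal L_J(M),\mathcal B(M)$ are pairwise disjoint. A simplicial map on $M$ is a continuous map $f:\mathcal D_1\to\mathbb R^2$ affine on each triangle of $M$; its discrete conformal energy is $E^C_M(f)=-\operatorname{Area}(\mathcal D_2)+\frac12\sum_{\tau\in\mathcal F(M)}\|\nabla f|_\tau\|^2\operatorname{Area}(\tau)$ (Frobenius norm), viewed as a function of the vertex values $f(\mathbf v)$. A simplicial map is orientation-preserving if $\det(\nabla f|_\tau)>0$ for every triangle $\tau$. Let $f^*_M$ be the unique minimizer of $E^C_M$ among simplicial maps with $f(\mathbf v)=r_{\mathcal O}\mathbf v+\mathbf t_{\mathcal O_i}$ on $\mathcal O_i(M)$, $f(\mathbf v)=R_{\mathcal L_j}\mathbf v+\mathbf t_{\mathcal L_j}$ on $\mathcal L_j(M)$, and $f(\mathbf v)=g(\mathbf v)$ on $\mathcal B(M)$. It is taken to be nondegenerate, i.e. $\det(\nabla f^*_M|_\tau)\neq0$ for all $\tau$. Bijection correction algorithm. It is started when $f^*_M$ is not orientation-preserving. Put $$\mathcal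 N^0=\{\mathbf v\in\mathcal V(M)\ :\ \mathbf v\in\tau\text{ for some }\tau\in\mathcal F(M)\text{ with }\det(\nabla f^*_M|_\tau)<0\},$$ $$\mathcal N^{k+1}=\{\mathbf v\in\mathcal V(M)\ :\ [\mathbf v,\mathbf w]\in\mathcal E(M)\text{ for some }\mathbf w\in\mathcal N^k\}.$$ For $k=0,1,2,\dots$ let $\phi^k_M$ be the simplicial map determined by: $\phi^k_M(\mathbf v)=r_{\mathcal O}\mathbf v+\mathbf t_{\mathcal O_i}$ for $\mathbf v\in\mathcal O_i(M)\setminus\mathcal N^k$; $\phi^k_M(\mathbf v)=R_{\mathcal L_j}\mathbf v+\mathbf t_{\mathcal L_j}$ for $\mathbf v\in\mathcal L_j(M)\setminus\mathcal N^k$; $\phi^k_M(\mathbf v)=g(\mathbf v)$ for $\mathbf v\in\mathcal B(M)$; and $\partial E^C_M/\partial\phi^k_M(\mathbf v)=\mathbf 0$ for all other vertices $\mathbf v$. The algorithm computes $\phi^0_M,\phi^1_M,\dots$ successively and stops at the first $k$ for which $\phi^k_M$ is orientation-preserving. Assumptions: (A3) Each $\mathcal O_i$ is the union of all triangles of $M$ whose three vertices lie in $\mathcal O_i(M)$; each $\mathcal L_j$ is the union of all edges of $M$ whose two endpoints lie in $\mathcal L_j(M)$; and $g(\alpha_1\mathbf v+\alpha_2\mathbf v')=\alpha_1g(\mathbf v)+\alpha_2g(\mathbf v')$ for every edge $[\mathbf v,\mathbf v']$ of $M$ contained in $\partial\mathcal D_1$ and all $\alpha_1,\alpha_2\ge0$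 with $\alpha_1+\alpha_2=1$. (A5) No quadrilateral of $M$ has cocircular vertices (a quadrilateral of $M$ is the union of two triangles sharing an edge; equivalently, for any two triangles sharing an edge, the sum of the angles opposite to it is not $\pi$). *)

(* Defs.v *)
(* MathComp / MathComp-Analysis. *)
From HB Require Import structures.
From mathcomp Require Import all_boot all_order all_algebra.
From mathcomp Require Import all_classical all_reals all_analysis.

Set Implicit Arguments.
Unset Strict Implicit.
Unset Printing Implicit Defensive.

Import Order.TTheory GRing.Theory Num.Theory.
Import numFieldNormedType.Exports.

Local Open Scope classical_set_scope.
Local Open Scope ring_scope.

(* Points of R^2 are column vectors.  The library norm on matrices is the sup
   norm: it has the right topology, but Euclidean lengths and Frobenius norms
   must go through [frob2]. *)
Notation plane R := ('cV[R]_2).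

(* Squared Frobenius norm; on a column, the squared Euclidean norm. *)
Definition frob2 (R : realType) m n (A : 'M[R]_(m, n)) : R :=
  \sum_i \sum_j A i j ^+ 2.

Definition pt (R : realType) (x y : R) : plane R :=
  \col_c (if c == ord0 then x else y).

Definition rect (R : realType) (x y : R) : set (plane R) :=
  [set p | 0 <= p ord0 ord0 <= x /\ 0 <= p ord_max ord0 <= y].

Definition frontier (T : topologicalType) (A : set T) : set T :=
  closure A `\` interior A.

Definition circle (R : realType) (c : plane R) (r : R) : set (plane R) :=
  [set x | frob2 (x - c) = r ^+ 2].

(* Pairwise disjointness of the sets [A_1, .., A_K, C_1, .., C_J, B]. *)
Definition pairwise_disjoint (T : Type) K J (A : 'I_K -> set T)
    (C : 'I_J -> set T) (B : set T) : Prop :=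
  trivIset [set: option ('I_K + 'I_J)]
    (fun k => match k with
              | None => B
              | Some (inl i) => A i
              | Some (inr j) => C j
              end).

Definition path_connected_set (R : realType) (T : topologicalType)
    (A : set T) : Prop :=
  forall x y, A x -> A y -> exists p : R -> T,
    [/\ {within `[0, 1], continuous p}, p @` `[0, 1] `<=` A,
        p 0 = x & p 1 = y].

Definition simply_connected (R : realType) (T : topologicalType)
    (A : set T) : Prop :=
  [/\ A !=set0, path_connected_set R A &
    forall p : R -> T, {within `[0, 1], continuous p} ->
      p @` `[0, 1] `<=` A -> p 0 = p 1 ->
      exists H : R * R -> T,
        [/\ {within `[0, 1] `*` `[0, 1], continuous H},
            H @` (`[0, 1] `*` `[0, 1]) `<=` A,
            forall t, `[0, 1]%classic t -> H (0, t) = p t,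
            forall t, `[0, 1]%classic t -> H (1, t) = p 0 &
            forall s, `[0, 1]%classic s -> H (s, 0) = p 0 /\ H (s, 1) = p 0]].

(* The matrix whose columns are the two edge vectors issued from the first
   vertex of a triangle. *)
Definition edge_mx (R : realType) (p : 'I_3 -> plane R) : 'M[R]_2 :=
  \matrix_(c, k) (p (lift ord0 k) c ord0 - p ord0 c ord0).

Definition hull (R : realType) n (v : 'I_n -> plane R) (S : {set 'I_n}) :
    set (plane R) :=
  [set x | exists al : 'I_n -> R,
     [/\ forall i, 0 <= al i, forall i, i \notin S -> al i = 0,
         \sum_i al i = 1 & x = \sum_i al i *: v i]].

Definition tri_verts n m (tri : 'I_m -> 'I_3 -> 'I_n) (t : 'I_m) :
    {set 'I_n} := [set tri t p | p : 'I_3].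

(* The order in which [tri t] lists the vertices of a triangle is arbitrary
   (triangles are unoriented); it influences none of the notions below. *)
Record triangulation (R : realType) := Triangulation {
  nv : nat;
  nf : nat;
  vert : 'I_nv -> plane R;
  tri : 'I_nf -> 'I_3 -> 'I_nv;
  _ : injective vert;
  _ : forall t, \det (edge_mx (fun p => vert (tri t p))) != 0;
  _ : injective (tri_verts tri);
  _ : forall i, exists t, i \in tri_verts tri t;
  _ : forall t s,
        hull vert (tri_verts tri t) `&` hull vert (tri_verts tri s) =
        hull vert (tri_verts tri t :&: tri_verts tri s)
}.

Arguments vert {R} _ _.
Arguments tri {R} _ _ _.

Section Mesh.
Context {R : realType} (M : triangulation R).
Implicit Types (t s : 'I_(nf M)) (i j : 'I_(nv M)).
Implicit Types (f : plane R -> plane R) (u : 'I_(nv M) -> plane R).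

Definition tverts t : {set 'I_(nv M)} := tri_verts (tri M) t.

Definition triangle t : set (plane R) := hull (vert M) (tverts t).

Definition carrier : set (plane R) := \bigcup_t triangle t.

Definition edge i j : Prop :=
  i != j /\ exists t, i \in tverts t /\ j \in tverts t.

Definition segment i j : set (plane R) := hull (vert M) [set i; j].

Definition open_segment i j : set (plane R) :=
  [set x | exists al : R,
     0 < al < 1 /\ x = (1 - al) *: vert M i + al *: vert M j].

(* Empty circumcircle property. *)
Definition delaunay : Prop :=
  forall t (c : plane R) (r : R),
    (forall p : 'I_3, circle c r (vert M (tri M t p))) ->
    forall i, r ^+ 2 <= frob2 (vert M i - c).

Definition no_cocircular_quadrilateral : Prop :=
  forall t s, t != s -> #|tverts t :&: tverts s| = 2%N ->
    ~ exists (c : plane R) (r : R),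
        forall i, i \in tverts t :|: tverts s -> circle c r (vert M i).

Definition simplicial f : Prop :=
  {within carrier, continuous f} /\
  forall t, exists (A : 'M[R]_2) (b : plane R),
    forall x, triangle t x -> f x = A *m x + b.

Definition vval f : 'I_(nv M) -> plane R := fun i => f (vert M i).

(* Gradient on [t] of the piecewise affine map with vertex values [u], i.e.,
   the linear part of its affine restriction to [t]; see [grad_affine]. *)
Definition grad u t : 'M[R]_2 :=
  edge_mx (fun p => u (tri M t p)) *m
  invmx (edge_mx (fun p => vert M (tri M t p))).

Definition area t : R :=
  `|\det (edge_mx (fun p => vert M (tri M t p)))| / 2%:R.

Definition orientation_preserving f : Prop :=
  forall t, 0 < \det (grad (vval f) t).

Definition nondegenerate_map f : Prop :=
  forall t, \det (grad (vval f) t) != 0.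

Definition set_vval u i (y : plane R) : 'I_(nv M) -> plane R :=
  fun j => if j == i then y else u j.

Definition region_verts (A : set (plane R)) : set 'I_(nv M) :=
  [set i | exists t, i \in tverts t /\ interior (triangle t) `&` A !=set0].

Definition curve_verts (A : set (plane R)) : set 'I_(nv M) :=
  region_verts A `|`
  [set i | exists j, edge i j /\ open_segment i j `&` A !=set0].

End Mesh.

Lemma grad_affine (R : realType) (M : triangulation R)
    (f : plane R -> plane R) (t : 'I_(nf M)) (A : 'M[R]_2) (b : plane R) :
  (forall x, triangle t x -> f x = A *m x + b) -> grad (vval f) t = A.
Proof.
have dM : \det (edge_mx (fun p => vert M (tri M t p))) != 0 by case: M t.
move=> fA.
have fv p : vval f (tri M t p) = A *m vert M (tri M t p) + b.
  apply: fA; exists (fun i => (i == tri M t p)%:R); split.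
  - by move=> i; rewrite ler0n.
  - by move=> i; case: eqP => [->|//]; rewrite imset_f.
  - by rewrite (bigD1 (tri M t p)) //= eqxx big1 ?addr0 // => i /negPf ->.
  - rewrite (bigD1 (tri M t p)) //= eqxx scale1r big1 ?addr0 // => i /negPf ->.
    by rewrite scale0r.
rewrite /grad.
have -> : edge_mx (fun p => vval f (tri M t p)) =
          A *m edge_mx (fun p => vert M (tri M t p)).
  apply/matrixP => c k; rewrite !mxE !fv !mxE opprD addrACA subrr addr0.
  by rewrite -sumrB; apply: eq_bigr => j _; rewrite mxE mulrBr.
by rewrite mulmxK // unitmxE unitfE.
Qed.

Record mapping_data (R : realType) := MappingData {
  da : R;
  db : R;
  dw : R;
  nO : nat;
  nL : nat;
  regO : 'I_nO -> set (plane R);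
  regL : 'I_nL -> set (plane R);
  rO : R;
  RL : 'I_nL -> 'M[R]_2;
  tO : 'I_nO -> plane R;
  tL : 'I_nL -> plane R;
  bdmap : plane R -> plane R
}.

Arguments regO {R} _ _ _.
Arguments regL {R} _ _ _.
Arguments RL {R} _ _.
Arguments tO {R} _ _.
Arguments tL {R} _ _.
Arguments bdmap {R} _ _.

Section Problem.
Context {R : realType} (d : mapping_data R).

Definition dom1 : set (plane R) := rect (da d) (db d).
Definition dom2 : set (plane R) := rect (dw d * da d) (db d).

Definition admissible_data : Prop :=
  [/\ [/\ 0 < da d, 0 < db d & 0 < dw d],
      [/\ forall i, regO d i `<=` dom1,
          forall j, regL d j `<=` dom1 &
          pairwise_disjoint (regO d) (regL d) (frontier dom1)],
      0 < rO d,
      forall j, is_diag_mx (RL d j) /\ forall c, 0 < RL d j c c &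
      [/\ set_bij (frontier dom1) (frontier dom2) (bdmap d),
          {within frontier dom1, continuous (bdmap d)} &
          [/\ bdmap d (pt 0 0) = pt 0 0,
              bdmap d (pt (da d) 0) = pt (dw d * da d) 0,
              bdmap d (pt 0 (db d)) = pt 0 (db d) &
              bdmap d (pt (da d) (db d)) = pt (dw d * da d) (db d)]]].

Context (M : triangulation R).

Definition vO i : set 'I_(nv M) := region_verts (regO d i).
Definition vL j : set 'I_(nv M) := curve_verts (regL d j).
Definition vOU : set 'I_(nv M) := \bigcup_i vO i.
Definition vLU : set 'I_(nv M) := \bigcup_j vL j.
Definition vB : set 'I_(nv M) := [set v | frontier dom1 (vert M v)].

(* Area(D_2) is the constant [(w a) b]. *)
Definition energy (u : 'I_(nv M) -> plane R) : R :=
  - (dw d * da d * db d) +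
  2%:R^-1 * \sum_t frob2 (grad u t) * area t.

(* Vanishing of the partial derivatives of the energy with respect to the
   two coordinates of the value at [v]. *)
Definition energy_stationary (u : 'I_(nv M) -> plane R) (v : 'I_(nv M)) :
    Prop :=
  forall c : 'I_2,
    is_derive (u v) (delta_mx c ord0 : plane R)
      (fun y : plane R => energy (set_vval u v y)) (0 : R).

(* The three families of constraints, with the vertices of [S] released from
   the first two. *)
Definition constrained (S : set 'I_(nv M)) (f : plane R -> plane R) : Prop :=
  [/\ forall i v, (vO i `\` S) v ->
        f (vert M v) = rO d *: vert M v + tO d i,
      forall j v, (vL j `\` S) v ->
        f (vert M v) = RL d j *m vert M v + tL d j &
      forall v, vB v -> f (vert M v) = bdmap d (vert M v)].

Definition energy_minimizer (f : plane R -> plane R) : Prop :=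
  [/\ simplicial M f, constrained set0 f &
      forall h, simplicial M h -> constrained set0 h ->
        energy (vval (M:=M) f) <= energy (vval (M:=M) h)].

Definition assumption_A3 : Prop :=
  [/\ forall i, regO d i =
        \bigcup_(t in [set t | forall v, v \in tverts t -> vO i v]) triangle t,
      forall j, regL d j =
        \bigcup_(e in [set e | [/\ edge e.1 e.2, vL j e.1 & vL j e.2]])
          segment e.1 e.2 &
      forall v v' : 'I_(nv M), edge v v' -> segment v v' `<=` frontier dom1 ->
        forall al1 al2 : R, 0 <= al1 -> 0 <= al2 -> al1 + al2 = 1 ->
          bdmap d (al1 *: vert M v + al2 *: vert M v') =
          al1 *: bdmap d (vert M v) + al2 *: bdmap d (vert M v')].

Fixpoint relaxed (fstar : plane R -> plane R) (k : nat) : set 'I_(nv M) :=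
  match k with
  | 0%N => [set v | exists t,
             v \in tverts t /\ \det (grad (vval fstar) t) < 0]
  | k'.+1 => [set v | exists v', edge v v' /\ relaxed fstar k' v']
  end.

(* [phi] is the map computed at step [k] of the correction algorithm. *)
Definition correction_step (fstar : plane R -> plane R) (k : nat)
    (phi : plane R -> plane R) : Prop :=
  [/\ simplicial M phi,
      constrained (relaxed fstar k) phi &
      forall v, ~ ((vOU `|` vLU) `\` relaxed fstar k `|` vB) v ->
        energy_stationary (vval phi) v].

Definition stops_at (phi : nat -> plane R -> plane R) (k : nat) : Prop :=
  orientation_preserving M (phi k) /\
  forall l, (l < k)%N -> ~ orientation_preserving M (phi l).

Definition freed (fstar : plane R -> plane R) (n : nat) : Prop :=
  (vOU `|` vLU) `\` \bigcup_(k in [set k | (1 <= k <= n)%N]) relaxed fstar k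
  = set0.

(* [nc] is [min {n | freed fstar n} + 1]; the minimum is required to exist. *)
Definition is_nc (fstar : plane R -> plane R) (nc : nat) : Prop :=
  exists n, [/\ freed fstar n, forall m, freed fstar m -> (n <= m)%N &
                nc = n.+1].

End Problem.

Arguments vO {R} d M i.
Arguments vL {R} d M j.
Arguments vB {R} d M.

(* Main.v *)
(* Once every vertex of the regions has been released, the vertex values of
   [phi k] are discrete harmonic for the cotangent weights, which are positive
   by the Delaunay condition and [hA5], and they are monotone along the sides of
   the rectangle.  Such a map has positive orientation everywhere:

   - For a function [h] without ties, every triangle has exactly one vertex of
     middle height.  An inner vertex is the middle one of an even, positive number
     of triangles if it has lower and higher neighbours, and a boundary vertex
     other than two corners is the middle one of some triangle.  For a linear
     function on the rectangle these numbers are at most 2, 1 and 0; comparing the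
     two counts of the triangles, they are at most 2 and 1 for [h] harmonic.
   - If two adjacent triangles were folded along their common edge, then a
     functional almost constant on the image of that edge would have one of its
     endpoints as middle vertex of both, which the counts and harmonicity exclude.
     Hence all triangles have the same orientation if none degenerates.
   - The orientation of a triangle is an affine function of the first coordinates
     and of the second coordinates.  It is nonnegative on all monotone boundary
     data by density, and an interior zero would propagate to the linear map. *)

Require Import Defs.
From mathcomp Require Import all_boot all_order all_algebra.
From mathcomp Require Import all_classical all_reals all_analysis.
From mathcomp Require Import ring lra zify.
Import Order.TTheory GRing.Theory Num.Theory.
Import numFieldNormedType.Exports.
Local Open Scope classical_set_scope.
Local Open Scope ring_scope.

Set Implicit Arguments.
Unset Strict Implicit.
Unset Printing Implicit Defensive.

(** * One-sided neighbourhoods of 0 *)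

(** That every region is released in time is a count: [relaxed] increases with the step, it contains
    a whole triangle at step 0, and connectedness of the edge graph adds a vertex at each step until
    none is left. Hence step [nv M - 3] reaches all vertices, which yields [nc < nv M].

    The linear height on the undistorted rectangle stands in for Euler's formula: its count adds up
    to [nf M] as well, and so calibrates the count for every other height function.

    Positivity of the weights is available only for edges at an inner vertex, so harmonicity is used
    at inner vertices alone; on the boundary, monotonicity takes its place. This monotonicity is
    extracted from continuity, injectivity and the corner values of [bdmap].

    The counting argument needs functionals that separate neighbours, and collapsed triangles cannot
    be ruled out beforehand. This forces the detour through nearby nondegenerate maps: the
    admissible maps form a convex family that contains a linear scaling, and moving towards it
    removes degeneracy. *)

Section NearZero.
Context {R : realType}.
Implicit Types c e : R.

Lemma near_right0_gt0 : \forall e \near (0 : R)^'+, 0 < e.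
Proof. exact: nbhs_right_gt. Qed.

Lemma near_right0_ex (P : R -> Prop) :
  (\forall e \near 0^'+, P e) -> exists2 e : R, 0 < e & P e.
Proof.
move=> nP; have [e []] := filter_ex (filterI near_right0_gt0 nP).
by exists e.
Qed.

Lemma near_right0_affine_gt0 c0 c1 :
  0 < c0 -> \forall e \near (0 : R)^'+, 0 < c0 + e * c1.
Proof.
move=> c0_gt0.
have d_gt0 : 0 < c0 / (`|c1| + 1) by rewrite divr_gt0// ltr_wpDl.
near=> e.
have e_gt0 : 0 < e by near: e; exact: near_right0_gt0.
have : e < c0 / (`|c1| + 1) by near: e; exact: nbhs_right_lt.
rewrite ltr_pdivlMr; last by rewrite ltr_wpDl.
  rewrite mulrDr mulr1 => lt_e.
have : - (e * c1) <= e * `|c1|.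
  by rewrite -mulrN (ler_wpM2l (ltW e_gt0))// ler_normr lexx orbT.
by lra.
Unshelve. all: by end_near. Qed.

Lemma near_right0_affine_neq0 c0 c1 :
  (c0 != 0) || (c1 != 0) -> \forall e \near (0 : R)^'+, c0 + e * c1 != 0.
Proof.
case: (ltgtP c0 0) => [c_lt0|c_gt0|->] /= => [_|_|c1_neq0].
- have := @near_right0_affine_gt0 (- c0) (- c1); rewrite oppr_gt0 => /(_ c_lt0).
  by apply: filterS => e; rewrite mulrN -opprD oppr_gt0 => /lt_eqF ->.
- by apply: filterS (near_right0_affine_gt0 c1 c_gt0) => e /gt_eqF ->.
- apply: filterS near_right0_gt0 => e e_gt0.
  by rewrite add0r mulf_neq0// gt_eqF.
Qed.

(** The first nonzero coefficient decides the sign on a short interval to the right of 0. Membership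
    in a triangle amounts to three affine inequalities, so it is settled along every short ray. *)
Lemma near_right0_affine_sign c0 c1 :
  (\forall e \near (0 : R)^'+, 0 <= c0 + e * c1) \/
  (\forall e \near (0 : R)^'+, c0 + e * c1 < 0).
Proof.
case: (ltgtP c0 0) => [c_lt0|c_gt0|->].
- right; have := @near_right0_affine_gt0 (- c0) (- c1).
  rewrite oppr_gt0 => /(_ c_lt0).
  by apply: filterS => e; rewrite mulrN -opprD oppr_gt0.
- by left; apply: filterS (near_right0_affine_gt0 c1 c_gt0) => e /ltW.
- case: (lerP 0 c1) => c1_ge0; [left|right];
    apply: filterS near_right0_gt0 => e e_gt0; rewrite add0r.
  + by rewrite mulr_ge0// ltW.
  + by rewrite pmulr_rlt0.
Qed.

Lemma near_right0_affine_ge0 c0 c1 :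
  (\forall e \near (0 : R)^'+, 0 <= c0 + e * c1) ->
  0 <= c0 /\ (c0 = 0 -> 0 <= c1).
Proof.
move=> nc; split.
  rewrite leNgt; apply/negP => c0_lt0.
  have := @near_right0_affine_gt0 (- c0) (- c1); rewrite oppr_gt0.
  move=> /(_ c0_lt0) /(filterI nc) /near_right0_ex[e e_gt0 []] le0.
  by rewrite mulrN -opprD oppr_gt0 ltNge le0.
move=> c00; have [e e_gt0] := near_right0_ex nc.
by rewrite c00 add0r pmulr_rge0.
Qed.

(** One half of [c0] absorbs the linear term, the other half, multiplied by [e], the quadratic
    one. *)
Lemma near_right0_quadratic_gt0 c0 c1 c2 :
  0 < c0 -> \forall e \near (0 : R)^'+, 0 < c0 + e * c1 + e ^+ 2 * c2.
Proof.
move=> c0_gt0; have hc0 : 0 < c0 / 2%:R by rewrite divr_gt0.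
near=> e.
have e_gt0 : 0 < e by near: e; exact: near_right0_gt0.
have e_lt1 : e < 1 by near: e; exact: nbhs_right_lt.
have h1 : 0 < c0 / 2%:R + e * c1 by near: e; exact: near_right0_affine_gt0.
have h2 : 0 < c0 / 2%:R + e * c2 by near: e; exact: near_right0_affine_gt0.
have : 0 < e * (c0 / 2%:R + e * c2) by rewrite mulr_gt0.
have : 0 <= (1 - e) * (c0 / 2%:R) by rewrite mulr_ge0 ?ltW// subr_gt0.
by move: h1; lra.
Unshelve. all: by end_near. Qed.

Lemma near_right0_quadratic_lt0 c0 c1 c2 :
  c0 < 0 -> \forall e \near (0 : R)^'+, c0 + e * c1 + e ^+ 2 * c2 < 0.
Proof.
rewrite -oppr_gt0 => /(near_right0_quadratic_gt0 (- c1) (- c2)).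
by apply: filterS => e; rewrite !mulrN -!opprD oppr_gt0.
Qed.

Lemma near_right0_quadratic_ge0 c0 c1 c2 :
  (\forall e \near (0 : R)^'+, 0 <= c0 + e * c1 + e ^+ 2 * c2) -> 0 <= c0.
Proof.
move=> h; rewrite leNgt; apply/negP => /(near_right0_quadratic_lt0 c1 c2) h'.
have [e _ []] := near_right0_ex (filterI h h').
by rewrite leNgt => /negP.
Qed.

Lemma near_right0_quadratic_neq0 c0 c1 c2 :
  [|| c0 != 0, c1 != 0 | c2 != 0] ->
  \forall e \near (0 : R)^'+, c0 + e * c1 + e ^+ 2 * c2 != 0.
Proof.
case: (ltgtP c0 0) => [c0_lt0|c0_gt0|->] /= c_neq0.
- by apply: filterS (near_right0_quadratic_lt0 c1 c2 c0_lt0) => e /lt_eqF ->.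
- by apply: filterS (near_right0_quadratic_gt0 c1 c2 c0_gt0) => e /gt_eqF ->.
- have h := near_right0_affine_neq0 c_neq0.
  apply: filterS (filterI near_right0_gt0 h) => e [e_gt0 ne0].
  rewrite add0r (_ : _ + _ = e * (c1 + e * c2)); last by ring.
  by rewrite mulf_neq0// gt_eqF.
Qed.

End NearZero.

(** * Connectedness of an interval covered by finitely many closed sets *)

Section CoveredSegment.
Context {R : realType} (I : finType).

(** The union of the sets of one class is closed, and so is its complement in the interval, the
    union of the other class; connectedness leaves a single class. *)
Lemma segment_cover_class (C : I -> set R) (b : I -> bool) (i j : I) :
  (forall k, closed (C k)) ->
  (forall x, 0 <= x <= 1 -> exists k, C k x) ->
  (forall x k l, C k x -> C l x -> b k = b l) ->
  C i 0 -> C j 1 -> b i = b j.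
Proof.
move=> clC covC disC Ci0 Cj1.
pose D c := \bigcup_(k in [set k | b k = c]) C k.
have clD c : closed (D c) by apply: closed_bigcup => //; exact: finite_finset.
have z01 : `[0, 1]%classic (0 : R) by rewrite /= in_itv /= lexx ler01.
have o01 : `[0, 1]%classic (1 : R) by rewrite /= in_itv /= lexx ler01.
have eqI : `[0, 1] `&` D (b i) = `[0, 1]%classic.
  apply: (@segment_connected R 0 1).
  - by exists 0; split=> //; exists i.
  - exists (~` D (~~ b i)); first by rewrite openC.
    apply/seteqP; split=> x [x01 Dx]; split=> //.
      case: Dx => k /= bk Ckx [l /= bl Clx].
      by have := disC _ _ _ Ckx Clx; rewrite bk bl; case: (b i).
    move: x01; rewrite /= in_itv /= => /covC[k Ckx]; exists k => //=.
    apply/eqP; apply: contra_notT Dx => bk; exists k => //=.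
    by case: (b i) (b k) bk => [] [].
  - by exists (D (b i)).
move: o01; rewrite -eqI => -[_ [k /= <- Ck1]]; exact: disC Ck1 Cj1.
Qed.

Lemma closed_affine_ge0 (c0 c1 : R) : closed [set x | 0 <= c0 + x * c1].
Proof.
change (closed ((fun x => c0 + x * c1) @^-1` [set y | 0 <= y])).
apply: preimage_closed.
  move=> x _; apply: cvgD; first exact: cvg_cst.
  by apply: cvgM; [exact: cvg_id|exact: cvg_cst].
exact: closed_ge.
Qed.

End CoveredSegment.

(** * Barycentric coordinates *)

Lemma det_mx22 (R : comRingType) (A : 'M[R]_2) :
  \det A = A ord0 ord0 * A ord_max ord_max - A ord0 ord_max * A ord_max ord0.
Proof.
rewrite (expand_det_row _ ord0) big_ord_recl big_ord1 /cofactor !det_mx11 !mxE.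
rewrite /= expr0 expr1 mul1r mulN1r mulrN.
by congr (_ * A _ _ - A _ _ * A _ _); apply/val_inj.
Qed.

Lemma ord2P (k : 'I_2) : k = ord0 \/ k = ord_max.
Proof. by case: k => [[|[|//]]] ?; [left|right]; apply: val_inj. Qed.

Local Notation o1 := (lift ord0 ord0 : 'I_3).
Local Notation o2 := (lift ord0 ord_max : 'I_3).

Lemma ord3P (p : 'I_3) : [\/ p = ord0, p = o1 | p = o2].
Proof.
case: (unliftP ord0 p) => [k ->|->]; last by constructor 1.
by case: (ord2P k) => ->; [constructor 2|constructor 3].
Qed.

Lemma plane_eqP (R : realType) (p q : plane R) :
  p ord0 ord0 = q ord0 ord0 -> p ord_max ord0 = q ord_max ord0 -> p = q.
Proof.
move=> e0 e1; apply/matrixP => i j; rewrite (ord1 j).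
by case: (ord2P i) => ->.
Qed.

Section Cross.
Context {R : realType} (V : Type).
Implicit Types U W : V -> R.

(** Twice the signed area of the image of a triangle under [(U, W)]. It is bilinear in [U] and [W],
    so orientations become polynomials in a perturbation. *)
Definition cross U W (i j k : V) : R :=
  (U j - U i) * (W k - W i) - (W j - W i) * (U k - U i).

Lemma cross_rot U W i j k : cross U W j k i = cross U W i j k.
Proof. by rewrite /cross; ring. Qed.

Lemma cross_swap U W i j k : cross U W i k j = - cross U W i j k.
Proof. by rewrite /cross; ring. Qed.

End Cross.

Section Triangles.
Context {R : realType} (M : triangulation R).
Local Notation V := 'I_(nv M).
Local Notation T := 'I_(nf M).
Implicit Types (i j k v w : V) (t s : T) (x y : R).

Definition px v : R := vert M v ord0 ord0.
Definition py v : R := vert M v ord_max ord0.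

Lemma px_py_inj v w : px v = px w -> py v = py w -> v = w.
Proof.
have inj : injective (vert M) by case: M.
by move=> ex ey; apply: inj; exact: plane_eqP.
Qed.

Lemma det_edge_mx (u : V -> plane R) t :
  \det (edge_mx (fun p => u (tri M t p))) =
  cross (fun v => u v ord0 ord0) (fun v => u v ord_max ord0)
    (tri M t ord0) (tri M t o1) (tri M t o2).
Proof. by rewrite det_mx22 !mxE /cross; ring. Qed.

Lemma cross_tri_neq0 t :
  cross px py (tri M t ord0) (tri M t o1) (tri M t o2) != 0.
Proof. by rewrite -det_edge_mx; case: M t. Qed.

(** A labelling of the vertices of [t] in any order, which allows the vertex of interest to be named
    first whatever order [tri] stores. *)
Definition tri3 t i j k :=
  [&& i \in tverts t, j \in tverts t, k \in tverts t,
      i != j, j != k & i != k].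

Lemma tri3_rot t i j k : tri3 t i j k -> tri3 t j k i.
Proof.
case/and5P=> ? ? ? ? /andP[? ?]; apply/and5P; split=> //.
by rewrite ![_ == i]eq_sym; apply/andP.
Qed.

Lemma tri3_swap t i j k : tri3 t i j k -> tri3 t i k j.
Proof.
case/and5P=> ? ? ? ? /andP[? ?]; apply/and5P; split=> //.
by rewrite eq_sym; apply/andP.
Qed.

Lemma tri3_tri t : tri3 t (tri M t ord0) (tri M t o1) (tri M t o2).
Proof.
have := cross_tri_neq0 t; rewrite /tri3 !imset_f //=.
by move=> h; apply/and3P; split; apply: contraNneq h => e;
  rewrite /cross e; apply/eqP; ring.
Qed.

Lemma tverts_tri t :
  tverts t = [set tri M t ord0; tri M t o1; tri M t o2]%SET.
Proof.
apply/setP => v; apply/imsetP/idP => [[p _ ->]|].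
  by case: (ord3P p) => ->; rewrite !inE eqxx ?orbT.
by rewrite !inE => /orP[/orP[]|] /eqP ->; eexists.
Qed.

Lemma card_tverts t : #|tverts t| = 3%N.
Proof.
have /and5P[_ _ _ ij /andP[jk ik]] := tri3_tri t.
by rewrite tverts_tri -finset.setUA cardsU1 cards2 !inE negb_or ij ik jk.
Qed.

Lemma tri3E t i j k : tri3 t i j k -> tverts t = [set i; j; k]%SET.
Proof.
move=> /and5P[ti tj tk ij /andP[jk ik]]; apply/esym/eqP.
rewrite eqEcard; apply/andP; split.
  by apply/fintype.subsetP => v; rewrite !inE => /orP[/orP[]|] /eqP ->.
by rewrite card_tverts -finset.setUA cardsU1 cards2 !inE negb_or ij ik jk.
Qed.

Lemma tri3_mem t i j k :
  tri3 t i j k -> [/\ i \in tverts t, j \in tverts t & k \in tverts t].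
Proof. by case/and5P. Qed.

Lemma tri3_ex2 t v w : v \in tverts t -> w \in tverts t -> v != w ->
  exists k, tri3 t v w k.
Proof.
move=> tv tw vw.
have : (0 < #|tverts t :\: [set v; w]|)%N.
  rewrite cardsD (finset.setIidPr _) ?card_tverts ?cards2 ?vw //.
  by apply/fintype.subsetP => u; rewrite !inE => /orP[] /eqP ->.
case/card_gt0P => k; rewrite !inE negb_or => /andP[/andP[kv kw] tk].
by exists k; apply/and5P; split=> //; rewrite eq_sym kw eq_sym.
Qed.

Lemma tri3_ex1 t v : v \in tverts t -> exists j k, tri3 t v j k.
Proof.
move=> tv; have : (0 < #|tverts t :\ v|)%N.
  by have := card_tverts t; rewrite (cardsD1 v) tv add1n => -[->].
case/card_gt0P => j; rewrite !inE => /andP[jv tj].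
by have [|k] := tri3_ex2 tv tj; [rewrite eq_sym|exists j, k].
Qed.

Lemma tri3_ex t : exists i j k, tri3 t i j k.
Proof. by do 3!eexists; exact: tri3_tri. Qed.

(** A relabelling multiplies both factors by the same sign, so the product depends on the triangle
    only. *)
Lemma cross2_tri3 (U W U' W' : V -> R) t i j k i' j' k' :
  tri3 t i j k -> tri3 t i' j' k' ->
  cross U W i j k * cross U' W' i j k = cross U W i' j' k' * cross U' W' i' j' k'.
Proof.
move=> h /and5P[]; rewrite (tri3E h) !inE /cross.
case/orP=> [/orP[]|] /eqP ->; case/orP=> [/orP[]|] /eqP ->;
case/orP=> [/orP[]|] /eqP ->; rewrite ?eqxx ?andbF //= => *; by ring.
Qed.

Lemma cross_tri3_neq0 t i j k : tri3 t i j k -> cross px py i j k != 0.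
Proof.
move=> h; have := cross2_tri3 px py px py h (tri3_tri t).
move=> e; apply: contraTneq (cross_tri_neq0 t) => z.
by move: e; rewrite z mul0r => /esym/eqP; rewrite mulf_eq0 orbb negbK.
Qed.

Lemma tverts_inj : injective (@tverts R M).
Proof. by rewrite /tverts; case: M. Qed.

Lemma tverts_sub_eq t s : tverts t \subset tverts s -> t = s.
Proof.
by move=> sub; apply: tverts_inj; apply/eqP; rewrite eqEcard sub !card_tverts.
Qed.

Lemma vertex_in_triangle v : exists t, v \in tverts t.
Proof. by rewrite /tverts; case: M v. Qed.

Lemma sum_tri3 (F : V -> R) t i j k : tri3 t i j k ->
  (forall v, v \notin tverts t -> F v = 0) ->
  \sum_v F v = F i + F j + F k.
Proof.
move=> h F0; rewrite (bigID (mem (tverts t))) /= [X in _ + X]big1 // addr0.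
have /and5P[_ _ _ ij /andP[jk ik]] := h.
rewrite (tri3E h) (eq_bigl [in i |: (j |: [set k])])%SET; last first.
  by move=> v; rewrite !inE orbA.
by rewrite !big_setU1 ?inE ?negb_or ?ij ?jk ?ik //= big_set1 addrA.
Qed.

Definition in_tri t x y : Prop := triangle t (pt x y).

Lemma in_tri_weights t x y : in_tri t x y <-> exists al : V -> R,
  [/\ forall v, 0 <= al v, forall v, v \notin tverts t -> al v = 0,
      \sum_v al v = 1, \sum_v al v * px v = x & \sum_v al v * py v = y].
Proof.
have coord (al : V -> R) c :
    (\sum_i al i *: vert M i) c ord0 = \sum_v al v * vert M v c ord0.
  by rewrite summxE; apply: eq_bigr => v _; rewrite mxE.
split=> [[al [h0 h1 h2 e]]|[al [h0 h1 h2 ex ey]]]; exists al; split=> //.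
- by rewrite -[x]/(if ord0 == ord0 :> 'I_2 then x else y) /px -coord -e !mxE.
- by rewrite /py -coord -e !mxE.
- by apply: plane_eqP; rewrite !mxE coord.
Qed.

(** The barycentric coordinate at [i], as a quotient of signed areas. *)
Definition bary i j k x y : R :=
  ((px j - x) * (py k - y) - (py j - y) * (px k - x)) / cross px py i j k.

(** The linear part of [bary], that is, its derivative along the direction [(x, y)]. *)
Definition dbary i j k x y : R :=
  (x * (py j - py k) - y * (px j - px k)) / cross px py i j k.

Lemma bary_affine i j k x y dx dy e :
  bary i j k (x + e * dx) (y + e * dy) = bary i j k x y + e * dbary i j k dx dy.
Proof. by rewrite /bary /dbary mulrA -mulrDl; congr (_ / _); ring. Qed.

Lemma baryE t i j k a b c x y : tri3 t i j k -> a + b + c = 1 ->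
  x = a * px i + b * px j + c * px k -> y = a * py i + b * py j + c * py k ->
  bary i j k x y = a.
Proof.
move=> /cross_tri3_neq0 D0 abc -> ->.
rewrite /bary; apply/eqP; rewrite -subr_eq0.
have -> : a = 1 - b - c by rewrite -abc; ring.
apply/eqP; move: D0; rewrite /cross => D0; field.
exact: D0.
Qed.

Lemma bary_sum t i j k x y : tri3 t i j k ->
  bary i j k x y + bary j k i x y + bary k i j x y = 1.
Proof.
move=> /cross_tri3_neq0 D0; rewrite /bary.
rewrite (cross_rot px py j k i) !(cross_rot px py i j k).
by rewrite -!mulrDl; apply: (mulIf D0); rewrite divfK// mul1r /cross; ring.
Qed.

Lemma bary_px t i j k x y : tri3 t i j k ->
  bary i j k x y * px i + bary j k i x y * px j + bary k i j x y * px k = x.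
Proof.
move=> /cross_tri3_neq0 D0; rewrite /bary.
rewrite (cross_rot px py j k i) !(cross_rot px py i j k).
rewrite ![_ / _ * _]mulrAC -!mulrDl; apply: (mulIf D0).
by rewrite divfK// /cross; ring.
Qed.

Lemma bary_py t i j k x y : tri3 t i j k ->
  bary i j k x y * py i + bary j k i x y * py j + bary k i j x y * py k = y.
Proof.
move=> /cross_tri3_neq0 D0; rewrite /bary.
rewrite (cross_rot px py j k i) !(cross_rot px py i j k).
rewrite ![_ / _ * _]mulrAC -!mulrDl; apply: (mulIf D0).
by rewrite divfK// /cross; ring.
Qed.

Lemma weights_bary (al : V -> R) t i j k x y : tri3 t i j k ->
  (forall v, v \notin tverts t -> al v = 0) ->
  \sum_v al v = 1 -> \sum_v al v * px v = x -> \sum_v al v * py v = y ->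
  al i = bary i j k x y.
Proof.
move=> h s0; rewrite !(sum_tri3 h) //; try by move=> v /s0 ->; rewrite mul0r.
by move=> a1 ex ey; apply/esym/(baryE h a1).
Qed.

Lemma in_triP t i j k x y : tri3 t i j k ->
  in_tri t x y <->
  [/\ 0 <= bary i j k x y, 0 <= bary j k i x y & 0 <= bary k i j x y].
Proof.
move=> h; rewrite in_tri_weights; split=> [[al [h0 h1 h2 h3 h4]]|[hi hj hk]].
  by rewrite -(weights_bary h h1 h2 h3 h4)
    -(weights_bary (tri3_rot h) h1 h2 h3 h4)
    -(weights_bary (tri3_rot (tri3_rot h)) h1 h2 h3 h4).
pose al v := if v == i then bary i j k x y else if v == j then bary j k i x y
  else if v == k then bary k i j x y else 0.
have /and5P[_ _ _ ij /andP[jk ik]] := h.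
have ali : al i = bary i j k x y by rewrite /al eqxx.
have alj : al j = bary j k i x y by rewrite /al eqxx eq_sym (negPf ij).
have alk : al k = bary k i j x y.
  by rewrite /al eqxx eq_sym (negPf ik) eq_sym (negPf jk).
have al0 v : v \notin tverts t -> al v = 0.
  rewrite (tri3E h) !inE !negb_or /al => /andP[/andP[/negPf -> /negPf ->]].
  by move=> /negPf ->.
exists al; split=> //.
- by move=> v; rewrite /al; do 3!case: ifP => // _.
- by rewrite (sum_tri3 h) // ali alj alk (bary_sum _ _ h).
- rewrite (sum_tri3 h) ?ali ?alj ?alk ?(bary_px _ _ h) // => v /al0 ->.
  by rewrite mul0r.
- rewrite (sum_tri3 h) ?ali ?alj ?alk ?(bary_py _ _ h) // => v /al0 ->.
  by rewrite mul0r.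
Qed.

Lemma triangle_cap t s :
  triangle t `&` triangle s = hull (vert M) (tverts t :&: tverts s).
Proof. by rewrite /triangle /tverts; case: M t s. Qed.

(** The point lies in the hull of the common vertices, and barycentric weights in [s] are unique, so
    the weight at a vertex outside [t] vanishes. *)
Lemma in_tri_face t s i j k x y : in_tri t x y -> in_tri s x y -> tri3 s i j k ->
  bary i j k x y != 0 -> i \in tverts t.
Proof.
move=> xt xs h; apply: contraNT => it.
have : (hull (vert M) (tverts t :&: tverts s)) (pt x y) by rewrite -triangle_cap.
case=> al [h0 h1 h2 e].
have s0 v : v \notin tverts s -> al v = 0.
  by move=> vs; apply: h1; rewrite inE negb_and vs orbT.
have coord c : \sum_v al v * vert M v c ord0 = pt x y c ord0.
  by rewrite e summxE; apply: eq_bigr => v _; rewrite mxE.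
rewrite -(weights_bary h s0 h2 (x := x) (y := y)).
- by rewrite h1 // inE (negPf it).
- by have := coord ord0; rewrite !mxE.
- by have := coord ord_max; rewrite !mxE.
Qed.

Lemma bary_vertex t i j k : tri3 t i j k ->
  [/\ bary i j k (px i) (py i) = 1, bary j k i (px i) (py i) = 0
    & bary k i j (px i) (py i) = 0].
Proof.
move=> h; split.
- by apply: (@baryE t _ _ _ _ 0 0) => //; ring.
- by apply: (@baryE t _ _ _ _ 0 1); rewrite ?(tri3_rot h)//; ring.
- by apply: (@baryE t _ _ _ _ 1 0); rewrite ?(tri3_rot (tri3_rot h))//; ring.
Qed.

Lemma in_tri_vertex_mem t v : in_tri t (px v) (py v) <-> v \in tverts t.
Proof.
have [s /tri3_ex1[j [k h]]] := vertex_in_triangle v.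
have [l1 l2 l3] := bary_vertex h.
split=> [vt|/tri3_ex1[j' [k' h']]]; last first.
  have [m1 m2 m3] := bary_vertex h'.
  by apply/(in_triP _ _ h'); rewrite m1 m2 m3 ler01.
apply: (in_tri_face vt _ h); last by rewrite l1 oner_neq0.
by apply/(in_triP _ _ h); rewrite l1 l2 l3 ler01.
Qed.

Lemma in_tri_interior_eq t s i j k x y : tri3 t i j k -> in_tri s x y ->
  0 < bary i j k x y -> 0 < bary j k i x y -> 0 < bary k i j x y -> t = s.
Proof.
move=> h xs hi hj hk.
have xt : in_tri t x y by apply/(in_triP _ _ h); split; exact: ltW.
apply: tverts_sub_eq; rewrite (tri3E h); apply/fintype.subsetP => v.
rewrite !inE => /orP[/orP[]|] /eqP ->.
- by apply: (in_tri_face xs xt h); rewrite gt_eqF.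
- by apply: (in_tri_face xs xt (tri3_rot h)); rewrite gt_eqF.
- by apply: (in_tri_face xs xt (tri3_rot (tri3_rot h))); rewrite gt_eqF.
Qed.

Lemma in_tri_near_or t x y dx dy :
  (\forall e \near (0 : R)^'+, in_tri t (x + e * dx) (y + e * dy)) \/
  (\forall e \near (0 : R)^'+, ~ in_tri t (x + e * dx) (y + e * dy)).
Proof.
have [i [j [k h]]] := tri3_ex t.
have [hi|hi] := near_right0_affine_sign (bary i j k x y) (dbary i j k dx dy);
  last first.
  right; apply: filterS hi => e; rewrite -bary_affine => hi /(in_triP _ _ h)[].
  by rewrite leNgt hi.
have [hj|hj] := near_right0_affine_sign (bary j k i x y) (dbary j k i dx dy);
  last first.
  right; apply: filterS hj => e; rewrite -bary_affine => hj /(in_triP _ _ h)[_].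
  by rewrite leNgt hj.
have [hk|hk] := near_right0_affine_sign (bary k i j x y) (dbary k i j dx dy);
  last first.
  right; apply: filterS hk => e; rewrite -bary_affine => hk /(in_triP _ _ h)[_ _].
  by rewrite leNgt hk.
left; apply: filterS (filterI hi (filterI hj hk)) => e [? [? ?]].
by apply/(in_triP _ _ h); rewrite !bary_affine.
Qed.

Lemma bary_near_ge0 t i j k x y dx dy : tri3 t i j k ->
  (\forall e \near (0 : R)^'+, in_tri t (x + e * dx) (y + e * dy)) ->
  0 <= bary i j k x y /\ (bary i j k x y = 0 -> 0 <= dbary i j k dx dy).
Proof.
move=> h nt; apply: near_right0_affine_ge0; apply: filterS nt => e.
by rewrite -bary_affine => /(in_triP _ _ h)[].
Qed.

Lemma in_tri_of_near t x y dx dy :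
  (\forall e \near (0 : R)^'+, in_tri t (x + e * dx) (y + e * dy)) -> in_tri t x y.
Proof.
move=> nt; have [i [j [k h]]] := tri3_ex t.
apply/(in_triP _ _ h); split.
- by have [] := bary_near_ge0 h nt.
- by have [] := bary_near_ge0 (tri3_rot h) nt.
- by have [] := bary_near_ge0 (tri3_rot (tri3_rot h)) nt.
Qed.

End Triangles.

Arguments px {R M} v.
Arguments py {R M} v.

(** * Local structure and connectivity of a triangulated rectangle *)

Definition in_box (R : realType) (A B x y : R) := (0 <= x <= A) && (0 <= y <= B).

Lemma convex_itv (R : realType) (a b x z e : R) :
  a <= x <= b -> a <= z <= b -> 0 <= e <= 1 -> a <= x + e * (z - x) <= b.
Proof.
move=> /andP[ax xb] /andP[az zb] /andP[e0 e1].
have e1' : 0 <= 1 - e by rewrite subr_ge0.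
have h1 : 0 <= (1 - e) * (x - a) by rewrite mulr_ge0// subr_ge0.
have h2 : 0 <= e * (z - a) by rewrite mulr_ge0// subr_ge0.
have h3 : 0 <= (1 - e) * (b - x) by rewrite mulr_ge0// subr_ge0.
have h4 : 0 <= e * (b - z) by rewrite mulr_ge0// subr_ge0.
by apply/andP; split; lra.
Qed.

Lemma in_box_convex (R : realType) (A B x y x' y' e : R) :
  in_box A B x y -> in_box A B x' y' -> 0 <= e <= 1 ->
  in_box A B (x + e * (x' - x)) (y + e * (y' - y)).
Proof.
by move=> /andP[hx hy] /andP[hx' hy'] he; rewrite /in_box !convex_itv.
Qed.

Lemma sqr_dist_gt0 (R : realType) (x y : R) :
  (x != 0) || (y != 0) -> 0 < x ^+ 2 + y ^+ 2.
Proof.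
move=> h; rewrite lt0r paddr_eq0 ?sqr_ge0// !sqrf_eq0 addr_ge0 ?sqr_ge0// andbT.
by rewrite negb_and.
Qed.

Section Adjacency.
Context {R : realType} (M : triangulation R).
Implicit Types (i j k v w : 'I_(nv M)) (t s : 'I_(nf M)).

Definition adj v w :=
  (v != w) && [exists t, (v \in tverts t) && (w \in tverts t)].

Lemma adjP v w : reflect (edge v w) (adj v w).
Proof.
apply: (iffP andP) => -[vw ht]; split=> //.
  by case/existsP: ht => t /andP[tv tw]; exists t.
by case: ht => t [tv tw]; apply/existsP; exists t; rewrite tv.
Qed.

Lemma adjC v w : adj v w = adj w v.
Proof.
rewrite /adj eq_sym; congr (_ && _).
by apply: eq_existsb => t; rewrite andbC.
Qed.

Lemma mem_adj t v w : v \in tverts t -> w \in tverts t -> v != w -> adj v w.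
Proof. by move=> tv tw vw; apply/adjP; split=> //; exists t. Qed.

Lemma adj_tri3 v w : adj v w -> exists t k, tri3 t v w k.
Proof.
case/andP=> vw /existsP[t /andP[tv tw]].
by have [k h] := tri3_ex2 tv tw vw; exists t, k.
Qed.

Lemma tri3_adj t v w k : tri3 t v w k -> adj v w.
Proof. by case/and5P=> tv tw _ vw _; exact: mem_adj tv tw vw. Qed.

Lemma dist_gt0 v w : v != w ->
  0 < (px w - px v) ^+ 2 + (py w - py v) ^+ 2.
Proof.
move=> vw; apply: sqr_dist_gt0; rewrite !subr_eq0.
apply: contraNT vw; rewrite negb_or !negbK => /andP[/eqP ex /eqP ey].
by apply/eqP; exact: px_py_inj.
Qed.

Lemma bary_mid t v w k : tri3 t v w k ->
  [/\ bary v w k ((px v + px w) / 2%:R) ((py v + py w) / 2%:R) = 2%:R^-1,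
      bary w k v ((px v + px w) / 2%:R) ((py v + py w) / 2%:R) = 2%:R^-1
    & bary k v w ((px v + px w) / 2%:R) ((py v + py w) / 2%:R) = 0].
Proof.
move=> h; split.
- by apply: (@baryE _ _ t _ _ _ _ 2%:R^-1 0) => //; by field.
- by apply: (@baryE _ _ t _ _ _ _ 0 2%:R^-1); rewrite ?(tri3_rot h)//; by field.
- by apply: (@baryE _ _ t _ _ _ _ 2%:R^-1 2%:R^-1);
    rewrite ?(tri3_rot (tri3_rot h))//; by field.
Qed.

Lemma dbary_normal v w k sg :
  dbary k v w (- (sg * (py w - py v))) (sg * (px w - px v)) =
  sg * ((px w - px v) ^+ 2 + (py w - py v) ^+ 2) / cross px py v w k.
Proof.
rewrite /dbary -(cross_rot px py k v w); congr (_ / _); ring.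
Qed.

Lemma edge_sign_gt0 (a c q : R) : 0 < q -> c != 0 ->
  (0 < a * q / c) = (0 < a * c).
Proof.
move=> q0 c0; have c20 : 0 < c ^+ 2 by rewrite exprn_even_gt0.
have -> : a * q / c = a * c * (q / c ^+ 2) by field.
by rewrite pmulr_lgt0// divr_gt0.
Qed.

(** A small displacement from the midpoint of the edge, along the normal to the common side, enters
    the interior of both triangles. *)
Lemma edge_same_side t s v w k l : tri3 t v w k -> tri3 s v w l ->
  0 < cross px py v w k * cross px py v w l -> t = s.
Proof.
move=> ht hs kl_gt0; set sg := cross px py v w k in kl_gt0.
have [vw _] : v != w /\ True by case/and5P: ht.
pose mx := (px v + px w) / 2%:R; pose my := (py v + py w) / 2%:R.
pose dx := - (sg * (py w - py v)); pose dy := sg * (px w - px v).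
have inside r m : tri3 r v w m -> 0 < sg * cross px py v w m ->
    \forall e \near (0 : R)^'+, [/\ 0 < bary v w m (mx + e * dx) (my + e * dy),
      0 < bary w m v (mx + e * dx) (my + e * dy)
    & 0 < bary m v w (mx + e * dx) (my + e * dy)].
  move=> hr side; have [l1 l2 l3] := bary_mid hr.
  have half : 0 < (2%:R^-1 : R) by rewrite invr_gt0.
  have d3 : 0 < dbary m v w dx dy.
    by rewrite dbary_normal edge_sign_gt0 ?dist_gt0 ?(cross_tri3_neq0 hr).
  near=> e; rewrite !bary_affine l1 l2 l3; split.
  - by near: e; exact: near_right0_affine_gt0.
  - by near: e; exact: near_right0_affine_gt0.
  - by rewrite add0r mulr_gt0//; near: e; exact: near_right0_gt0.
have kk_gt0 : 0 < sg * cross px py v w k.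
  by rewrite -expr2 exprn_even_gt0//= (cross_tri3_neq0 ht).
have [e _ [[a1 a2 a3] [b1 b2 b3]]] :=
  near_right0_ex (filterI (inside t k ht kk_gt0) (inside s l hs kl_gt0)).
by apply: (in_tri_interior_eq ht _ a1 a2 a3); apply/(in_triP _ _ hs); split; exact: ltW.
Unshelve. all: by end_near. Qed.

Lemma edge_opposite_sides t s v w k l : tri3 t v w k -> tri3 s v w l ->
  t != s -> cross px py v w k * cross px py v w l < 0.
Proof.
move=> ht hs; apply: contraNT; rewrite -leNgt le_eqVlt => /orP[|h].
  by rewrite eq_sym mulf_eq0 (negPf (cross_tri3_neq0 ht)) (negPf (cross_tri3_neq0 hs)).
by rewrite (edge_same_side ht hs h).
Qed.

Lemma bary_swap i j k x y : bary i j k x y = bary i k j x y.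
Proof.
rewrite /bary (cross_swap _ _ i j k) invrN mulrN -mulNr; congr (_ * _); ring.
Qed.

Lemma dbary_swap i j k x y : dbary i j k x y = dbary i k j x y.
Proof.
rewrite /dbary (cross_swap _ _ i j k) invrN mulrN -mulNr; congr (_ * _); ring.
Qed.

(** The coordinate at [v] equals 1 there and stays positive nearby; only the two vanishing
    coordinates restrict the direction. *)
Lemma cone_near t v j k dx dy : tri3 t v j k ->
  (\forall e \near (0 : R)^'+, in_tri t (px v + e * dx) (py v + e * dy)) <->
  0 <= dbary j k v dx dy /\ 0 <= dbary k v j dx dy.
Proof.
move=> h; have [l1 l2 l3] := bary_vertex h.
split=> [nt|[d2 d3]].
  split; first by have [_ ->] := bary_near_ge0 (tri3_rot h) nt.
  by have [_ ->] := bary_near_ge0 (tri3_rot (tri3_rot h)) nt.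
near=> e; have e_gt0 : 0 < e by near: e; exact: near_right0_gt0.
apply/(in_triP _ _ h); rewrite !bary_affine l1 l2 l3 !add0r; split.
- by rewrite ltW//; near: e; exact: near_right0_affine_gt0.
- by rewrite mulr_ge0// ltW.
- by rewrite mulr_ge0// ltW.
Unshelve. all: by end_near. Qed.

Lemma dbary_bary t v j k x y : tri3 t v j k ->
  dbary j k v (x - px v) (y - py v) = bary j k v x y.
Proof.
move=> h; have [_ l2 _] := bary_vertex h.
have := bary_affine j k v (px v) (py v) (x - px v) (y - py v) 1.
rewrite l2 add0r !mul1r => <-; by congr bary; ring.
Qed.

End Adjacency.

(** * Local structure and connectedness from the covering of the rectangle *)

Section Domain.
Context {R : realType} (M : triangulation R) (A B : R).
Hypothesis cover : forall x y, in_box A B x y <-> exists t : 'I_(nf M), in_tri t x y.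
Implicit Types (i j k v w : 'I_(nv M)) (t s : 'I_(nf M)).

Definition inner v := (0 < px v < A) && (0 < py v < B).

Lemma vertex_in_box v : in_box A B (px v) (py v).
Proof.
apply/cover; have [t tv] := vertex_in_triangle v; exists t.
exact/in_tri_vertex_mem.
Qed.

(** Along a ray each of the finitely many triangles is eventually present or eventually absent, and
    if all were absent, nearby points of the rectangle would be uncovered. *)
Lemma local_cover x y dx dy :
  (\forall e \near (0 : R)^'+, in_box A B (x + e * dx) (y + e * dy)) ->
  exists t : 'I_(nf M),
    \forall e \near (0 : R)^'+, in_tri t (x + e * dx) (y + e * dy).
Proof.
move=> nD; apply: contrapT => noT.
have : \forall e \near (0 : R)^'+,
    forall t : 'I_(nf M), ~ in_tri t (x + e * dx) (y + e * dy).
  apply: filter_forall => t; have [ht|//] := in_tri_near_or t x y dx dy.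
  by case: noT; exists t.
move=> h; have [e _ [/cover[t et] /(_ t)]] := near_right0_ex (filterI nD h).
exact.
Qed.

Lemma near_in_box_convex x y x' y' : in_box A B x y -> in_box A B x' y' ->
  \forall e \near (0 : R)^'+, in_box A B (x + e * (x' - x)) (y + e * (y' - y)).
Proof.
move=> h h'; near=> e; apply: in_box_convex => //; apply/andP; split.
  by rewrite ltW//; near: e; exact: near_right0_gt0.
by rewrite ltW//; near: e; exact: nbhs_right_lt.
Unshelve. all: by end_near. Qed.

(** The midpoint of an edge at an inner vertex is strictly inside the rectangle, so small
    displacements to either side are covered. The covering triangle is closed, hence contains the
    midpoint and with it both endpoints. *)
Lemma edge_side v w sg : sg != 0 -> inner v -> adj v w ->
  exists t k, tri3 t v w k /\ 0 < sg * cross px py v w k.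
Proof.
move=> sg0 /andP[/andP[x0 xA] /andP[y0 yB]] vw.
have /andP[/andP[wx0 wxA] /andP[wy0 wyB]] := vertex_in_box w.
pose mx := (px v + px w) / 2%:R; pose my := (py v + py w) / 2%:R.
pose dx := - (sg * (py w - py v)); pose dy := sg * (px w - px v).
have nD : \forall e \near (0 : R)^'+, in_box A B (mx + e * dx) (my + e * dy).
  have m1 : 0 < mx by rewrite /mx; lra.
  have m2 : 0 < A - mx by rewrite /mx; lra.
  have m3 : 0 < my by rewrite /my; lra.
  have m4 : 0 < B - my by rewrite /my; lra.
  near=> e.
  have h1 : 0 < mx + e * dx by near: e; exact: near_right0_affine_gt0.
  have h2 : 0 < A - mx + e * - dx by near: e; exact: near_right0_affine_gt0.
  have h3 : 0 < my + e * dy by near: e; exact: near_right0_affine_gt0.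
  have h4 : 0 < B - my + e * - dy by near: e; exact: near_right0_affine_gt0.
  by apply/andP; split; apply/andP; split; lra.
have [t nt] := local_cover nD; have tm := in_tri_of_near nt.
have [s [l hs]] := adj_tri3 vw; have [l1 l2 l3] := bary_mid hs.
have half : 0 < (2%:R^-1 : R) by rewrite invr_gt0.
have sm : in_tri s mx my.
  by apply/(in_triP _ _ hs); rewrite l1 l2 l3 lexx ltW.
have tv : v \in tverts t by apply: (in_tri_face tm sm hs); rewrite l1 gt_eqF.
have tw : w \in tverts t.
  by apply: (in_tri_face tm sm (tri3_rot hs)); rewrite l2 gt_eqF.
have v_w : v != w by case/andP: vw.
have [k h] := tri3_ex2 tv tw v_w; exists t, k; split=> //.
have [_ _ m3] := bary_mid h.
have [_ /(_ m3)] := bary_near_ge0 (tri3_rot (tri3_rot h)) nt.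
have c0 := cross_tri3_neq0 h.
rewrite dbary_normal le_eqVlt => /orP[|]; last first.
  by rewrite edge_sign_gt0 ?dist_gt0.
rewrite eq_sym !mulf_eq0 invr_eq0 (negPf c0) (negPf sg0) /=.
by rewrite gt_eqF ?dist_gt0.
Unshelve. all: by end_near. Qed.

Lemma inner_edge_triangles v w : inner v -> adj v w ->
  exists t s k l, [/\ tri3 t v w k, tri3 s v w l,
    0 < cross px py v w k, cross px py v w l < 0
  & forall r, v \in tverts r -> w \in tverts r -> r = t \/ r = s].
Proof.
move=> v_in vw; have v_w : v != w by case/andP: vw.
have [t [k [ht]]] := edge_side (oner_neq0 R) v_in vw; rewrite mul1r => kt.
have n1 : (-1 : R) != 0 by rewrite oppr_eq0 oner_neq0.
have [s [l [hs]]] := edge_side n1 v_in vw; rewrite mulN1r oppr_gt0 => ls.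
exists t, s, k, l; split=> // r rv rw; have [m hr] := tri3_ex2 rv rw v_w.
have := cross_tri3_neq0 hr; rewrite neq_lt => /orP[m_lt0|m_gt0].
  by right; apply: (edge_same_side hr hs); rewrite nmulr_lgt0.
by left; apply: (edge_same_side hr ht); rewrite pmulr_lgt0.
Qed.

(* A segment from a vertex of [t] to one of [s] that avoids [v] is covered by the
   cones at [v] of its triangles, which are closed and, for distinct classes,
   disjoint. *)
Lemma star_class v (b : 'I_(nf M) -> bool) :
  (forall t s w, v \in tverts t -> v \in tverts s -> w \in tverts t ->
     w \in tverts s -> w != v -> b t = b s) ->
  forall t s, v \in tverts t -> v \in tverts s -> b t = b s.
Proof.
move=> bS t s tv sv.
have [w [w' ht]] := tri3_ex1 tv.
(* The segment issued from [w] must miss [v], so its other end is a vertex of [s] not aligned with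
   [v] and [w]. Of the two candidates one qualifies, since their directions from [v] are
   independent. *)
have [n [sn vwn]] : exists n, n \in tverts s /\ cross px py v w n != 0.
  have [n [n' hs]] := tri3_ex1 sv.
  have [_ sn sn'] := tri3_mem hs.
  have [c0|] := eqVneq (cross px py v w n) 0; last by exists n.
  exists n'; split=> //; apply: contra_neq (cross_tri3_neq0 hs) => c0'.
  have v_w : v != w by case/and5P: ht.
  have := dist_gt0 v_w; rewrite lt0r paddr_eq0 ?sqr_ge0// !sqrf_eq0.
  rewrite negb_and => /andP[/orP[] a0 _]; apply: (mulfI a0); rewrite mulr0.
    have -> : (px w - px v) * cross px py v n n' =
      (px n - px v) * cross px py v w n' - (px n' - px v) * cross px py v w n.
      by rewrite /cross; ring.
    by rewrite c0 c0' !mulr0 subrr.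
  have -> : (py w - py v) * cross px py v n n' =
    (py n - py v) * cross px py v w n' - (py n' - py v) * cross px py v w n.
    by rewrite /cross; ring.
  by rewrite c0 c0' !mulr0 subrr.
pose dx z := px w + z * (px n - px w) - px v.
pose dy z := py w + z * (py n - py w) - py v.
pose C r := [set z | v \in tverts r /\
  \forall e \near (0 : R)^'+, in_tri r (px v + e * dx z) (py v + e * dy z)].
have toward r x y : v \in tverts r -> in_tri r x y -> \forall e \near (0 : R)^'+,
    in_tri r (px v + e * (x - px v)) (py v + e * (y - py v)).
  move=> /tri3_ex1[j [k hr]] /(in_triP _ _ hr)[_ rj rk].
  apply/(cone_near _ _ hr); rewrite (dbary_bary _ _ hr) rj.
  by rewrite dbary_swap (dbary_bary _ _ (tri3_swap hr)) -bary_swap rk.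
apply: (segment_cover_class (C := C)).
- move=> r; have [rv|rv] := boolP (v \in tverts r); last first.
    rewrite (_ : C r = set0); first exact: closed0.
    by apply/seteqP; split=> z //= []; rewrite (negPf rv).
  have [j [k hr]] := tri3_ex1 rv.
  have dbaryE i i' m z : dbary i i' m (dx z) (dy z) =
    dbary i i' m (dx 0) (dy 0) + z * dbary i i' m (px n - px w) (py n - py w).
    by rewrite /dbary mulrA -mulrDl; congr (_ / _); rewrite /dx /dy; ring.
  rewrite (_ : C r = [set z | 0 <= dbary j k v (dx 0) (dy 0) +
        z * dbary j k v (px n - px w) (py n - py w)] `&`
      [set z | 0 <= dbary k v j (dx 0) (dy 0) +
        z * dbary k v j (px n - px w) (py n - py w)]).
    by apply: closedI; exact: closed_affine_ge0.
  apply/seteqP; split=> z /=; rewrite -!dbaryE.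
    by move=> [_ /(cone_near _ _ hr)].
  by move=> [d1 d2]; split=> //; apply/(cone_near _ _ hr).
- move=> z z01.
  have zD : in_box A B (px w + z * (px n - px w)) (py w + z * (py n - py w)).
    by apply: in_box_convex => //; exact: vertex_in_box.
  have [r nr] := local_cover (near_in_box_convex (vertex_in_box v) zD).
  exists r; split=> //; apply/in_tri_vertex_mem; exact: in_tri_of_near nr.
- move=> z r r' [rv nr] [rv' nr'].
  have [e e_gt0 [er er']] := near_right0_ex (filterI nr nr').
  apply: contra_neq_eq vwn => bN; have [j [k hr]] := tri3_ex1 rv.
  have [_ rj rk] := tri3_mem hr.
  have [vj kv] : v != j /\ v != k.
    by have /and5P[_ _ _ -> /andP[_ ->]] := hr.
  (* Triangles of different classes share no vertex but [v], so a common point carries its whole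
     weight at [v]. It then equals [v] and the direction is zero, although the segment misses
     [v]. *)
  have lj0 : bary j k v (px v + e * dx z) (py v + e * dy z) = 0.
    apply: contra_neq_eq bN => lj; apply: (bS _ _ j) => //.
      exact: (in_tri_face er' er (tri3_rot hr)).
    by rewrite eq_sym.
  have lk0 : bary k v j (px v + e * dx z) (py v + e * dy z) = 0.
    apply: contra_neq_eq bN => lk; apply: (bS _ _ k) => //.
      exact: (in_tri_face er' er (tri3_rot (tri3_rot hr))).
    by rewrite eq_sym.
  have := bary_sum (px v + e * dx z) (py v + e * dy z) hr.
  have := bary_px (px v + e * dx z) (py v + e * dy z) hr.
  have := bary_py (px v + e * dx z) (py v + e * dy z) hr.
  rewrite lj0 lk0 !addr0 !mul0r !addr0 => ey ex l1.
  move: ey ex; rewrite l1 !mul1r => /eqP; rewrite -subr_eq0 opprD addrA subrr sub0r.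
  rewrite oppr_eq0 mulf_eq0 gt_eqF//= => /eqP dy0 /eqP.
  rewrite -subr_eq0 opprD addrA subrr sub0r oppr_eq0 mulf_eq0 gt_eqF//= => /eqP dx0.
  have z0 : z * cross px py v w n = 0.
    transitivity ((px w - px v) * dy z - (py w - py v) * dx z).
      by rewrite /dx /dy /cross; ring.
    by rewrite dx0 dy0 !mulr0 subrr.
  have z1 : (1 - z) * cross px py v w n = 0.
    transitivity ((py n - py v) * dx z - (px n - px v) * dy z).
      by rewrite /dx /dy /cross; ring.
    by rewrite dx0 dy0 !mulr0 subrr.
  by move: z1; rewrite mulrBl z0 subr0 mul1r.
- split=> //; rewrite /dx /dy !mul0r !addr0; apply: toward => //.
  by apply/in_tri_vertex_mem; have [] := tri3_mem ht.
- split=> //; rewrite /dx /dy !mul1r; have sn' : in_tri s (px n) (py n).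
    exact/in_tri_vertex_mem.
  have := toward s _ _ sv sn'; apply: filterS => e.
  by congr (in_tri _ _ _); ring.
Qed.

(** On the straight segment from [v0] to [w], triangles that meet share a vertex, and the vertices
    of one triangle are adjacent; so [P] is carried from one end to the other. *)
Lemma edge_closed_full (P : pred 'I_(nv M)) v0 : P v0 ->
  (forall v w, adj v w -> P v -> P w) -> forall w, P w.
Proof.
move=> Pv0 clP w.
have clT t i j : i \in tverts t -> j \in tverts t -> P i = P j.
  move=> ti tj; have [->//|ij] := eqVneq i j.
  have a := mem_adj ti tj ij; apply/idP/idP; first exact: clP.
  by apply: clP; rewrite adjC.
have [t tv] := vertex_in_triangle v0; have [s sw] := vertex_in_triangle w.
pose b t := [exists i in tverts t, P i].
have bE r i : i \in tverts r -> b r = P i.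
  move=> ri; apply/existsP/idP => [[j /andP[rj Pj]]|Pi].
    by rewrite (clT _ _ _ ri rj).
  by exists i; rewrite ri.
rewrite -(bE s)// -(_ : b t = b s); first by rewrite (bE _ _ tv).
pose x z := px v0 + z * (px w - px v0).
pose y z := py v0 + z * (py w - py v0).
apply: (segment_cover_class (C := fun r => [set z | in_tri r (x z) (y z)])).
- move=> r; have [i [j [k h]]] := tri3_ex r.
  rewrite (_ : [set z | _] =
    [set z | 0 <= bary i j k (px v0) (py v0) +
        z * dbary i j k (px w - px v0) (py w - py v0)] `&`
    [set z | 0 <= bary j k i (px v0) (py v0) +
        z * dbary j k i (px w - px v0) (py w - py v0)] `&`
    [set z | 0 <= bary k i j (px v0) (py v0) +
        z * dbary k i j (px w - px v0) (py w - py v0)]).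
    by apply: closedI; [apply: closedI|]; exact: closed_affine_ge0.
  apply/seteqP; split=> z /=; rewrite -!bary_affine.
    by move=> /(in_triP _ _ h)[].
  by move=> [[? ?] ?]; apply/(in_triP _ _ h).
- by move=> z z01; apply/cover; apply: in_box_convex => //; exact: vertex_in_box.
- move=> z r r' hr hr'; have [i [j [k h]]] := tri3_ex r.
  have [ri rj rk] := tri3_mem h.
  have : [|| bary i j k (x z) (y z) != 0, bary j k i (x z) (y z) != 0
    | bary k i j (x z) (y z) != 0].
    have := oner_neq0 R; rewrite -(bary_sum (x z) (y z) h).
    apply: contraNT; rewrite !negb_or !negbK => /and3P[/eqP -> /eqP -> /eqP ->].
    by rewrite !addr0.
  case/or3P => ne.
  - by rewrite (bE _ _ ri) (bE _ _ (in_tri_face hr' hr h ne)).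
  - by rewrite (bE _ _ rj) (bE _ _ (in_tri_face hr' hr (tri3_rot h) ne)).
  - by rewrite (bE _ _ rk) (bE _ _ (in_tri_face hr' hr (tri3_rot (tri3_rot h)) ne)).
- by rewrite /= /x /y !mul0r !addr0; apply/in_tri_vertex_mem.
- rewrite /= /x /y !mul1r.
  have -> : px v0 + (px w - px v0) = px w by ring.
  have -> : py v0 + (py w - py v0) = py w by ring.
  exact/in_tri_vertex_mem.
Qed.

End Domain.

(** * The cotangent Laplacian *)

Section Laplacian.
Context {R : realType} (M : triangulation R).
Implicit Types (i j k v w : 'I_(nv M)) (t s : 'I_(nf M)) (U : 'I_(nv M) -> R).

Definition apex_dot k v w : R :=
  (px v - px k) * (px w - px k) + (py v - py k) * (py w - py k).

(* The cotangent of the angle at [k] of the triangle [k v w]. *)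
Definition cot_weight k v w : R := apex_dot k v w / `|cross px py v w k|.

(** The inner sum has one term, the apex facing the edge, or none. The total is the sum of the
    cotangents of the facing angles, without the customary factor one half. *)
Definition weight v w : R := \sum_t \sum_(k | tri3 t v w k) cot_weight k v w.

Definition lap U v : R := \sum_w weight v w * (U w - U v).

Lemma tri3_unique t v w k l : tri3 t v w k -> tri3 t v w l = (l == k).
Proof.
move=> h; apply/idP/eqP => [h'|-> //].
have [_ _] := tri3_mem h'; rewrite (tri3E h) !inE.
have /and5P[_ _ _ _ /andP[wl vl]] := h'.
by rewrite ![l == _]eq_sym (negPf wl) (negPf vl) /= => /eqP.
Qed.

Lemma sum_apex (F : 'I_(nv M) -> R) t v w k : tri3 t v w k ->
  \sum_(l | tri3 t v w l) F l = F k.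
Proof.
by move=> h; rewrite (eq_bigl (pred1 k)) ?big_pred1_eq// => l; exact: tri3_unique.
Qed.

Lemma sum_edge_nadj (F : 'I_(nv M) -> R) v w : ~~ adj v w ->
  \sum_t \sum_(l | tri3 t v w l) F l = 0.
Proof.
move=> vw; apply: big1 => t _; apply: big1 => l /tri3_adj.
by rewrite (negPf vw).
Qed.

Lemma sum_star (F : 'I_(nv M) -> 'I_(nv M) -> R) t v i j : tri3 t v i j ->
  \sum_w \sum_(k | tri3 t v w k) F w k = F i j + F j i.
Proof.
move=> h; have [_ _ _ _ /andP[ij vj]] := and5P h.
have vi : v != i by case/and5P: h.
rewrite (bigD1 i)//= (sum_apex _ h) (bigD1 j) /=; last by rewrite eq_sym.
rewrite (sum_apex _ (tri3_swap h)) big1 ?addr0// => w.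
move=> /andP[wi wj]; apply: big1 => k h'; have [_ tw _] := tri3_mem h'.
have vw : v != w by case/and5P: h'.
move: tw; rewrite (tri3E h) !inE (negPf wi) (negPf wj) !orbF eq_sym.
by rewrite (negPf vw).
Qed.

Lemma sum_star_out (F : 'I_(nv M) -> 'I_(nv M) -> R) t v : v \notin tverts t ->
  \sum_w \sum_(k | tri3 t v w k) F w k = 0.
Proof.
move=> tv; apply: big1 => w _; apply: big1 => k /tri3_mem[tv' _ _].
by rewrite tv' in tv.
Qed.

Lemma lapE U v : lap U v =
  \sum_t \sum_w \sum_(k | tri3 t v w k) cot_weight k v w * (U w - U v).
Proof.
rewrite exchange_big; apply: eq_bigr => w _.
by rewrite mulr_suml; apply: eq_bigr => t _; rewrite mulr_suml.
Qed.

Lemma lap_linear a b U W v :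
  lap (fun w => a * U w + b * W w) v = a * lap U v + b * lap W v.
Proof.
rewrite /lap !mulr_sumr -big_split; apply: eq_bigr => w _ /=; ring.
Qed.

Lemma frob2_plane (p : plane R) :
  frob2 p = p ord0 ord0 ^+ 2 + p ord_max ord0 ^+ 2.
Proof.
rewrite /frob2 big_ord_recl !big_ord1; congr (_ + p _ _ ^+ 2).
exact: val_inj.
Qed.

Variables A B : R.
Hypothesis cover : forall x y, in_box A B x y <-> exists t : 'I_(nf M), in_tri t x y.

Lemma sum_inner_edge (F : 'I_(nv M) -> R) v w : inner A B v -> adj v w ->
  exists t s k l, [/\ tri3 t v w k, tri3 s v w l,
    0 < cross px py v w k, cross px py v w l < 0
  & \sum_t \sum_(m | tri3 t v w m) F m = F k + F l].
Proof.
move=> v_in vw.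
have [t [s [k [l [ht hs kt ls ts]]]]] := inner_edge_triangles cover v_in vw.
exists t, s, k, l; split=> //.
have st : s != t.
  apply: contraTneq kt => e; move: hs; rewrite e (tri3_unique _ ht) => /eqP lk.
  by rewrite -lk -leNgt ltW.
rewrite (bigD1 t)//= (sum_apex _ ht) (bigD1 s)//= (sum_apex _ hs).
rewrite big1 ?addr0// => r /andP[rt rs]; apply: big1 => m /tri3_mem[rv rw _].
by have [e|e] := ts r rv rw; [rewrite e eqxx in rt|rewrite e eqxx in rs].
Qed.

Lemma card_inner_edge v w : inner A B v -> adj v w ->
  #|[set t | (v \in tverts t) && (w \in tverts t)]%SET| = 2%N.
Proof.
move=> v_in vw.
have [t [s [k [l [ht hs kt ls ts]]]]] := inner_edge_triangles cover v_in vw.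
have st : t != s.
  apply: contraTneq kt => e; move: ht; rewrite e (tri3_unique _ hs) => /eqP lk.
  by rewrite lk -leNgt ltW.
rewrite (_ : [set _ | _]%SET = [set t; s]%SET) ?cards2 ?st//.
apply/setP => r; rewrite !inE; apply/andP/orP => [[rv rw]|].
  by have [->|->] := ts r rv rw; [left|right].
have [tv tw _] := tri3_mem ht; have [sv sw _] := tri3_mem hs.
by case=> /eqP ->.
Qed.

Section Linear.
Variables (p q : 'I_(nv M) -> R).
Hypothesis pqE : forall v i j,
  apex_dot j v i * (p i - p v) + apex_dot i v j * (p j - p v) =
  cross px py v i j * (q j - q i).

(** Here [q] is [p] turned by a right angle: by [pqE] a triangle contributes, up to its orientation,
    the increment of [q] along the side facing [v], and these increments cancel around an inner
    vertex. *)
Lemma lap_coord v : inner A B v -> lap p v = 0.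
Proof.
move=> v_in; rewrite lapE.
(* The increment is split between the two edges at [v]: each receives [q] at its far end, with
   opposite signs from the triangles on its two sides. *)
pose G w k := - q w * (cross px py v w k / `|cross px py v w k|).
rewrite (eq_bigr (fun t => \sum_w \sum_(k | tri3 t v w k) G w k)); last first.
  move=> t _; have [tv|tv] := boolP (v \in tverts t); last first.
    by rewrite !sum_star_out.
  have [i [j h]] := tri3_ex1 tv; rewrite !(sum_star _ h) /cot_weight /G.
  rewrite (cross_swap _ _ v i j) normrN.
  rewrite ![_ / _ * _]mulrAC -mulrDl (pqE v i j) mulNr mulrBr.
  by rewrite mulrBl; ring.
rewrite exchange_big; apply: big1 => w _.
have [vw|vw] := boolP (adj v w); last by rewrite sum_edge_nadj.
have [t [s [k [l [ht hs kt ls ->]]]]] := sum_inner_edge (G w) v_in vw.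
rewrite /G gtr0_norm// ltr0_norm// invrN mulrN.
rewrite (divff (cross_tri3_neq0 ht)) (divff (cross_tri3_neq0 hs)).
by rewrite mulrN subrr.
Qed.

End Linear.

Lemma lap_px v : inner A B v -> lap px v = 0.
Proof.
by apply: (@lap_coord px py) => u i j; rewrite /apex_dot /cross; ring.
Qed.

Lemma lap_py v : inner A B v -> lap py v = 0.
Proof.
by apply: (@lap_coord py (fun v => - px v)) => u i j; rewrite /apex_dot /cross; ring.
Qed.

Hypotheses (hdel : delaunay M) (hA5 : no_cocircular_quadrilateral M).

Lemma weight_gt0 v w : inner A B v -> adj v w -> 0 < weight v w.
Proof.
move=> v_in vw; rewrite /weight.
have [t [s [k [l [ht hs kt ls ->]]]]] :=
  sum_inner_edge (fun k => cot_weight k v w) v_in vw.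
(* In the pencil of circles through [v] and [w], the circumcircle of [t] is
   [apex_dot i v w - K * cross px py v w i = 0]; the left-hand side is the power of
   [i], and it has the sign of the weight at the opposite apex [i = l]. *)
pose K := apex_dot k v w / cross px py v w k.
pose ex := px w - px v; pose ey := py w - py v.
(* The centre is the midpoint of the edge, moved along the normal by the multiple that puts [k] on
   the circle. *)
pose cx := (ex - K * ey) / 2%:R; pose cy := (ey + K * ex) / 2%:R.
pose c : plane R := pt (px v + cx) (py v + cy).
pose r := Num.sqrt (cx ^+ 2 + cy ^+ 2).
have r2 : r ^+ 2 = cx ^+ 2 + cy ^+ 2 by rewrite sqr_sqrtr// addr_ge0 ?sqr_ge0.
have power i : frob2 (vert M i - c) =
    r ^+ 2 + (apex_dot i v w - K * cross px py v w i).
  rewrite frob2_plane !mxE /= -/(px i) -/(py i) r2 /cx /cy /ex /ey /apex_dot /cross.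
  by field.
have onE i : apex_dot i v w - K * cross px py v w i = 0 -> circle c r (vert M i).
  by move=> e; rewrite /circle /= power e addr0.
have onv : circle c r (vert M v) by apply: onE; rewrite /apex_dot /cross; ring.
have onw : circle c r (vert M w) by apply: onE; rewrite /apex_dot /cross; ring.
have onk : circle c r (vert M k).
  by apply: onE; rewrite /K divfK ?subrr// gt_eqF.
have ont i : i \in tverts t -> circle c r (vert M i).
  by rewrite (tri3E ht) !inE => /orP[/orP[]|] /eqP ->.
have st : t != s.
  apply: contraTneq kt => e; move: ht; rewrite e (tri3_unique _ hs) => /eqP lk.
  by rewrite lk -leNgt ltW.
have : r ^+ 2 <= frob2 (vert M l - c).
  by apply: (hdel (t := t)) => p; apply: ont; exact: imset_f.
rewrite power lerDl le_eqVlt => /orP[/eqP e|pos].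
  (* Equality would put [l] on the circumcircle of [t], and the four vertices would be
     cocircular. *)
  case: (hA5 st).
    rewrite (_ : _ :&: _ = [set v; w])%SET ?cards2; first by case/andP: vw => ->.
    have [tv tw tk] := tri3_mem ht; have [sv sw _] := tri3_mem hs.
    apply/setP => u; rewrite !inE; apply/andP/orP => [[]|].
      rewrite (tri3E ht) !inE => /orP[/orP[]|]; [by left|by right|].
      move=> /eqP -> sk; case/negP: st; apply/eqP; apply: tverts_sub_eq.
      by rewrite (tri3E ht); apply/fintype.subsetP => z;
        rewrite !inE => /orP[/orP[]|] /eqP ->.
    by case=> /eqP ->.
  exists c, r => i; rewrite inE => /orP[|]; first exact: ont.
  by rewrite (tri3E hs) !inE => /orP[/orP[]|] /eqP -> //; apply: onE.
rewrite /cot_weight gtr0_norm// ltr0_norm// -/K invrN mulrN.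
rewrite (_ : _ - _ = (apex_dot l v w - K * cross px py v w l) / - cross px py v w l).
  by rewrite divr_gt0// oppr_gt0.
by field; rewrite lt_eqF.
Qed.

Lemma weight_ge0 v w : inner A B v -> 0 <= weight v w.
Proof.
move=> v_in; have [vw|vw] := boolP (adj v w); first by rewrite ltW ?weight_gt0.
by rewrite /weight sum_edge_nadj.
Qed.

Lemma lap0_min U v : inner A B v -> lap U v = 0 ->
  (forall w, adj v w -> U v <= U w) -> forall w, adj v w -> U w = U v.
Proof.
move=> v_in lap0 vU w vw.
have : weight v w * (U w - U v) = 0.
  apply: (psumr_eq0P _ lap0) => // u _.
  have [vu|vu] := boolP (adj v u); last by rewrite /weight sum_edge_nadj// mul0r.
  by rewrite mulr_ge0 ?weight_ge0// subr_ge0 vU.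
move/eqP; rewrite mulf_eq0 gt_eqF ?weight_gt0//= subr_eq0.
by move/eqP.
Qed.

Lemma lapN U v : lap (fun w => - U w) v = - lap U v.
Proof. by rewrite /lap -sumrN; apply: eq_bigr => w _; ring. Qed.

Lemma lap0_ex_lt U v : inner A B v -> lap U v = 0 ->
  (exists2 w, adj v w & U w != U v) ->
  exists2 w, adj v w & U w < U v.
Proof.
move=> v_in lap0 [w vw wv]; apply: contrapT => no.
move/negP: wv; apply; apply/eqP; apply: lap0_min vw => // u vu.
by rewrite leNgt; apply/negP => uv; case: no; exists u.
Qed.

Lemma lap0_ex_gt U v : inner A B v -> lap U v = 0 ->
  (exists2 w, adj v w & U w != U v) ->
  exists2 w, adj v w & U v < U w.
Proof.
move=> v_in lap0 [w vw wv].
have lapN0 : lap (fun w => - U w) v = 0 by rewrite lapN lap0 oppr0.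
have [|u vu] := lap0_ex_lt v_in lapN0; last by rewrite ltrN2; exists u.
by exists w; rewrite // eqr_opp.
Qed.

(** A corner is an extreme point of the rectangle: in a convex combination of vertices equal to it,
    each vertex of nonzero weight sits at the corner. *)
Lemma corner_vertex (x0 y0 : R) : 0 < A -> 0 < B ->
  (x0 == 0) || (x0 == A) -> (y0 == 0) || (y0 == B) ->
  exists v : 'I_(nv M), px v = x0 /\ py v = y0.
Proof.
move=> A0 B0 hx hy.
have [t] : exists t : 'I_(nf M), in_tri t x0 y0.
  apply/cover; case/orP: hx => /eqP ->; case/orP: hy => /eqP ->;
    by rewrite /in_box !lexx !ltW.
move=> /in_tri_weights[al [al0 _ al1 ex ey]].
have extremal (p : 'I_(nv M) -> R) (z L : R) : (z == 0) || (z == L) ->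
    (forall v, 0 <= p v <= L) -> \sum_v al v * p v = z ->
    forall v, al v * (p v - z) = 0.
  move=> hz p0 ep.
  have e0 : \sum_v al v * (p v - z) = 0.
    rewrite (eq_bigr (fun v => al v * p v - al v * z)); last first.
      by move=> v _; rewrite mulrBr.
    by rewrite sumrB ep -mulr_suml al1 mul1r subrr.
  case/orP: hz => /eqP z0 v.
    apply: (psumr_eq0P _ e0) => // u _.
    by rewrite mulr_ge0// z0 subr0; case/andP: (p0 u).
  apply/eqP; rewrite -oppr_eq0; apply/eqP.
  apply: (@psumr_eq0P _ _ predT (fun v => - (al v * (p v - z)))) => //.
    by move=> u _; rewrite -mulrN mulr_ge0// opprB z0 subr_ge0; case/andP: (p0 u).
  by rewrite sumrN e0 oppr0.
have [v alv] : exists v, al v != 0.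
  apply/not_existsP => al00; have := oner_neq0 R; rewrite -al1 big1 ?eqxx// => v _.
  by have := al00 v => /negP; rewrite negbK => /eqP.
have VD (u : 'I_(nv M)) : (0 <= px u <= A) /\ (0 <= py u <= B).
  by have /andP := vertex_in_box cover u.
exists v; split; apply/eqP; rewrite -subr_eq0.
  have /eqP := extremal px x0 A hx (fun u => (VD u).1) ex v.
  by rewrite mulf_eq0 (negPf alv).
have /eqP := extremal py y0 B hy (fun u => (VD u).2) ey v.
by rewrite mulf_eq0 (negPf alv).
Qed.

Lemma max_principle U : 0 < A -> 0 < B ->
  (forall v, inner A B v -> lap U v = 0) ->
  exists2 v, ~~ inner A B v & forall w, U w <= U v.
Proof.
move=> A0 B0 harm.
have [c [cx cy]] : exists v : 'I_(nv M), px v = 0 /\ py v = 0.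
  by apply: corner_vertex; rewrite ?eqxx.
pose m := [arg max_(v > c) U v]%O.
have mmax w : U w <= U m by rewrite /m; case: arg_maxP => // v _; exact.
have [[v /eqP vm vb]|no] := pselect (exists2 v, U v == U m & ~~ inner A B v).
  by exists v => // w; rewrite vm.
have c_in : ~~ inner A B c by rewrite /inner cx ltxx.
case: (no); exists c => //.
(* If only inner vertices attained the maximum, harmonicity would spread it along edges as far as
   the corner [c]. *)
apply: (edge_closed_full cover (P := fun v => U v == U m) (v0 := m)) => //.
move=> v w vw /eqP vm.
have [v_in|v_bd] := boolP (inner A B v); last first.
  by case: no; exists v; rewrite ?vm.
have lapN0 : lap (fun w => - U w) v = 0 by rewrite lapN harm// oppr0.
have := lap0_min v_in lapN0 _ vw.
rewrite -vm => h; apply/eqP/oppr_inj/h => u _; rewrite lerN2 vm; exact: mmax.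
Qed.

End Laplacian.

(** * Middle vertices of triangles *)

Section MiddleCount.
Context {R : realType} (M : triangulation R).
Implicit Types (i j k v w : 'I_(nv M)) (t s : 'I_(nf M)) (h : 'I_(nv M) -> R).

Definition mid h t v := [&& v \in tverts t, [exists i in tverts t, h i < h v]
  & [exists i in tverts t, h v < h i]].

Definition mid_count h v := #|[set t | mid h t v]%SET|.

(** Only neighbours are separated, since no triangle compares other vertices. *)
Definition tie_free h := forall v w, adj v w -> h v != h w.

Lemma midP h t v : reflect
  (exists i j, [/\ tri3 t v i j, h i < h v & h v < h j]) (mid h t v).
Proof.
apply: (iffP and3P) => [[tv /existsP[i /andP[ti iv]] /existsP[j /andP[tj vj]]]|].
  exists i, j; split=> //; apply/and5P; split=> //.
  - by apply: contraTneq iv => ->; rewrite ltxx.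
  - apply/andP; split.
      by apply: contraTneq (lt_trans iv vj) => ->; rewrite ltxx.
    by apply: contraTneq vj => ->; rewrite ltxx.
move=> [i [j [/tri3_mem[tv ti tj] iv vj]]]; split=> //; apply/existsP.
  by exists i; rewrite ti.
by exists j; rewrite tj.
Qed.

Lemma tie_free_tri3 h t : tie_free h ->
  exists i j k, [/\ tri3 t j i k, h i < h j & h j < h k].
Proof.
move=> hf; have [i [j [k r0]]] := tri3_ex t.
have r1 := tri3_rot r0; have r2 := tri3_rot r1.
have s0 := tri3_swap r0; have s1 := tri3_swap r1; have s2 := tri3_swap r2.
have := hf _ _ (tri3_adj r0); have := hf _ _ (tri3_adj r1).
have := hf _ _ (tri3_adj r2).
case: (ltgtP (h k) (h i)) => // ki _; case: (ltgtP (h j) (h k)) => // jk _;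
  case: (ltgtP (h i) (h j)) => // ij _.
- by have := lt_trans ki (lt_trans ij jk); rewrite ltxx.
- by exists j, k, i.
- by exists k, i, j.
- by exists k, j, i.
- by exists i, j, k => //; rewrite ?(lt_trans ij).
- by exists j, i, k.
- by exists i, k, j.
- by have := lt_trans ki (lt_trans jk ij); rewrite ltxx.
Qed.

Lemma sum_mid_count h : tie_free h -> (\sum_v mid_count h v)%N = nf M.
Proof.
move=> hf; rewrite (eq_bigr (fun v => \sum_t (mid h t v : nat))%N); last first.
  move=> v _; rewrite /mid_count -sum1_card big_mkcond.
  by apply: eq_bigr => t _; rewrite inE; case: (mid h t v).
rewrite exchange_big /= (eq_bigr (fun=> 1%N)) ?sum1_card ?card_ord// => t _.
have [i [j [k [ht ij jk]]]] := tie_free_tri3 t hf.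
rewrite (bigD1 j)//= (_ : mid h t j); last by apply/midP; exists i, k.
rewrite big1 // => v vj; apply/eqP; rewrite eqb0; apply/negP => /midP.
move=> [a [b [hv av vb]]]; have [tv ta tb] := tri3_mem hv.
move: tv ta tb; rewrite (tri3E ht) !inE (negPf vj) /=.
by case/orP=> /eqP ev; case/orP=> [/orP[]|] /eqP ea; case/orP=> [/orP[]|] /eqP eb;
  move: av vb; rewrite ev ea eb ?ltxx // => *; lra.
Qed.

Variables A B : R.
Hypothesis cover : forall x y, in_box A B x y <-> exists t : 'I_(nf M), in_tri t x y.

(** If [v] were the middle of no triangle, the other two vertices of each triangle at [v] would be
    both above or both below it. This alternative agrees across shared edges, hence over the whole
    star. *)
Lemma mid_count_gt0 h v w1 w2 : tie_free h -> adj v w1 -> adj v w2 ->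
  h w1 < h v -> h v < h w2 -> (0 < mid_count h v)%N.
Proof.
move=> hf vw1 vw2 lo hi; rewrite lt0n; apply/negP => /eqP sc0.
have nomid t : ~~ mid h t v.
  apply/negP => mt; move: sc0; rewrite /mid_count => /eqP; rewrite cards_eq0.
  by move/eqP/setP/(_ t); rewrite !inE mt.
have [t1 [k1 ht1]] := adj_tri3 vw1; have [t2 [k2 ht2]] := adj_tri3 vw2.
have [tv1 tw1 _] := tri3_mem ht1; have [tv2 tw2 _] := tri3_mem ht2.
pose b t := [exists i in tverts t, h v < h i].
have bE t w : v \in tverts t -> w \in tverts t -> w != v -> b t = (h v < h w).
  move=> tv tw wv; apply/idP/idP => [bt|vw]; last first.
    by apply/existsP; exists w; rewrite tw.
  have := nomid t; rewrite /mid tv /= -/(b t) bt andbT => /existsPn/(_ w).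
  rewrite tw /= -leNgt le_eqVlt => /orP[/eqP e|//].
  have := hf v w; rewrite (mem_adj tv tw) 1?eq_sym// => /(_ isT).
  by rewrite e eqxx.
have n1 : w1 != v by rewrite eq_sym; case/andP: vw1.
have n2 : w2 != v by rewrite eq_sym; case/andP: vw2.
have : b t1 = b t2.
  apply: (star_class cover (v := v)) => // t s w tv sv tw sw wv.
  by rewrite (bE _ w)// (bE _ w).
by rewrite (bE _ w1)// (bE _ w2)// hi ltNge ltW.
Qed.

Lemma mid_count_even h v : tie_free h -> inner A B v -> ~~ odd (mid_count h v).
Proof.
(* Count the pairs of a triangle at [v] and a higher neighbour of [v] in it: every
   neighbour lies in two triangles, and a triangle contributes an odd number if
   and only if [v] is its middle vertex. *)
move=> hf v_in.
pose c t w : nat := [&& v \in tverts t, w \in tverts t, v != w & h v < h w].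
pose x t := (\sum_w c t w)%N.
have ev : ~~ odd (\sum_t x t).
  rewrite /x exchange_big /=; elim/big_rec: _ => // w n _ even_n.
  rewrite oddD (negPf even_n) addbF.
  have [/andP[vw hvw]|no] := boolP (adj v w && (h v < h w)).
    rewrite -(_ : 2 = \sum_t c t w)%N// -(card_inner_edge cover v_in vw).
    rewrite -sum1_card big_mkcond; apply: eq_bigr => t _.
    rewrite inE /c hvw; case/andP: vw => -> _; rewrite !andbT.
    by case: (_ && _).
  rewrite big1// => t _; apply/eqP; rewrite eqb0; apply: contra no.
  by move=> /and4P[tv tw vw ->]; rewrite (mem_adj tv tw vw).
have -> : odd (mid_count h v) = odd (\sum_t x t).
  rewrite /mid_count -sum1_card big_mkcond /=.
  elim/big_rec2: _ => // t n1 n2 _ e; rewrite !oddD e; congr (_ (+) _).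
  rewrite (_ : (t \in [set t | mid h t v]%SET) = mid h t v); last by rewrite inE.
  have [tv|tv] := boolP (v \in tverts t); last first.
    by rewrite /mid (negPf tv) /= /x big1// => w _; rewrite /c (negPf tv).
  have [i [j ht]] := tri3_ex1 tv; have ht' := tri3_swap ht.
  have [_ ti tj] := tri3_mem ht.
  have vi : v != i by case/andP: (tri3_adj ht).
  have vj : v != j by case/andP: (tri3_adj ht').
  have ij : i != j by case/and5P: ht => _ _ _ _ /andP[].
  have -> : x t = ((h v < h i)%R + (h v < h j)%R)%N.
    rewrite /x (bigD1 i)//= (bigD1 j)//=; last by rewrite eq_sym.
    rewrite /c tv ti tj vi vj /= big1 ?addn0// => w /andP[wi wj].
    apply/eqP; rewrite eqb0; apply/negP => /and3P[tw vw _].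
    move: tw; rewrite (tri3E ht) !inE (negPf wi) (negPf wj) !orbF eq_sym.
    by rewrite (negPf vw).
  have -> : mid h t v = (h v < h i) (+) (h v < h j).
    apply/idP/idP => [/midP[a [b [hab av vb]]]|].
      have [_ ta tb] := tri3_mem hab.
      have [va vb'] : v != a /\ v != b by case/and5P: hab => _ _ _ -> /andP[_ ->].
      have : h a < h b := lt_trans av vb.
      move: ta tb; rewrite (tri3E ht) !inE ![_ == v]eq_sym (negPf va) (negPf vb') /=.
      case/orP=> /eqP ea; case/orP => /eqP eb; move: av vb; rewrite ea eb ?ltxx //.
        by move=> /ltW; rewrite leNgt => /negPf -> ->.
      by move=> /ltW; rewrite leNgt => /negPf -> ->.
    have := hf _ _ (tri3_adj ht); have := hf _ _ (tri3_adj ht').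
    case: (ltgtP (h v) (h i)) => // hi; case: (ltgtP (h v) (h j)) => // hj _ _ _.
      by apply/midP; exists j, i.
    by apply/midP; exists i, j.
  by rewrite oddD !oddb; case: (_ (+) _).
by [].
Qed.

(** The functional with coefficients [al] and [be] is least at [v]. A direction that keeps it
    constant is a nonnegative combination of two edges at [v]; only edges along the side can
    contribute, and one of them points forward. *)
Lemma vertex_side_nbr v al be dx dy :
  (forall w, al * px v + be * py v <= al * px w + be * py w) ->
  al * dx + be * dy = 0 ->
  (dx != 0) || (dy != 0) ->
  (\forall e \near (0 : R)^'+, in_box A B (px v + e * dx) (py v + e * dy)) ->
  exists w, [/\ adj v w, al * px w + be * py w = al * px v + be * py v
    & 0 < dx * (px w - px v) + dy * (py w - py v)].
Proof.
move=> sup ker d0 nD; have [t nt] := local_cover cover nD.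
have tv : v \in tverts t by apply/in_tri_vertex_mem; exact: in_tri_of_near nt.
have [j [k ht]] := tri3_ex1 tv.
have [e e_gt0 et] := near_right0_ex nt.
have [_ l2 l3] := (iffLR (in_triP _ _ ht)) et.
have eX := bary_px (px v + e * dx) (py v + e * dy) ht.
have eY := bary_py (px v + e * dx) (py v + e * dy) ht.
have e1 := bary_sum (px v + e * dx) (py v + e * dy) ht.
move: l2 l3 eX eY e1; set a := bary v j k _ _; set b := bary j k v _ _.
set c := bary k v j _ _ => b0 c0 eX eY e1.
have DX : e * dx = b * (px j - px v) + c * (px k - px v).
  have a1 : a = 1 - b - c by rewrite -e1; ring.
  by move: eX; rewrite a1 => eX; lra.
have DY : e * dy = b * (py j - py v) + c * (py k - py v).
  have a1 : a = 1 - b - c by rewrite -e1; ring.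
  by move: eY; rewrite a1 => eY; lra.
pose q w := al * px w + be * py w - (al * px v + be * py v).
pose p w := dx * (px w - px v) + dy * (py w - py v).
have q0 w : 0 <= q w by rewrite subr_ge0 sup.
have qs : b * q j + c * q k = 0.
  transitivity (e * (al * dx + be * dy)); last by rewrite ker mulr0.
  have -> : e * (al * dx + be * dy) = al * (e * dx) + be * (e * dy) by ring.
  by rewrite DX DY /q; ring.
have ps : 0 < b * p j + c * p k.
  have -> : b * p j + c * p k = e * (dx ^+ 2 + dy ^+ 2).
    transitivity (dx * (e * dx) + dy * (e * dy)); last by ring.
    by rewrite DX DY /p; ring.
  by rewrite mulr_gt0// sqr_dist_gt0.
have [bq cq] : b * q j = 0 /\ c * q k = 0.
  have h1 := mulr_ge0 b0 (q0 j); have h2 := mulr_ge0 c0 (q0 k).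
  by split; lra.
have side w d : 0 <= d -> d * q w = 0 -> 0 < d * p w ->
    al * px w + be * py w = al * px v + be * py v /\ 0 < p w.
  move=> d_ge0 dq dp; have d_gt0 : 0 < d.
    by rewrite lt0r d_ge0 andbT; apply: contraTneq dp => ->; rewrite mul0r ltxx.
  split; last by rewrite -(pmulr_rgt0 _ d_gt0).
  by apply/eqP; rewrite -subr_eq0 -/(q w); move/eqP: dq; rewrite mulf_eq0 gt_eqF.
have [bp|bp] := ltrP 0 (b * p j).
  by have [? ?] := side j b b0 bq bp; exists j; split=> //; exact: tri3_adj ht.
have cp : 0 < c * p k by lra.
have [? ?] := side k c c0 cq cp; exists k; split=> //.
exact: tri3_adj (tri3_swap ht).
Qed.

End MiddleCount.

(** * Bounds for the number of triangles with a given middle vertex *)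

Section MiddleBounds.
Context {R : realType} (M : triangulation R) (A B : R).
Implicit Types (i j k v w : 'I_(nv M)) (t s : 'I_(nf M)) (h : 'I_(nv M) -> R).
Hypothesis cover : forall x y, in_box A B x y <-> exists t : 'I_(nf M), in_tri t x y.
Hypotheses (A_gt0 : 0 < A) (B_gt0 : 0 < B).

Definition mid_bound v := if inner A B v then 2%N else 1%N.

(* One of the two rays at [v] along the level line of [px + kap * py], selected by
   [b], enters the interior of the triangle [t]. *)
Definition ray_in (kap : R) v t (b : bool) := exists i j,
  [/\ tri3 t v i j, 0 < dbary i j v (- ((-1) ^+ b * kap)) ((-1) ^+ b)
    & 0 < dbary j v i (- ((-1) ^+ b * kap)) ((-1) ^+ b)].

Lemma dbary_basis t v i j a b : tri3 t v i j ->
  dbary i j v (a * (px i - px v) + b * (px j - px v))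
    (a * (py i - py v) + b * (py j - py v)) = a /\
  dbary j v i (a * (px i - px v) + b * (px j - px v))
    (a * (py i - py v) + b * (py j - py v)) = b.
Proof.
move=> /cross_tri3_neq0 c0; rewrite /dbary.
rewrite (cross_rot _ _ i j v) (cross_rot _ _ v i j).
by split; apply: (mulIf c0); rewrite divfK// /cross; ring.
Qed.

Lemma mid_ray kap v t : mid (fun w => px w + kap * py w) t v ->
  exists b, ray_in kap v t b.
Proof.
pose h w := px w + kap * py w.
move=> /midP[i [j [ht]]]; rewrite -/(h i) -/(h j) -/(h v) => iv vj.
(* Weighted by these height differences, the two edge vectors at [v] add up to a direction of
   constant height that enters [t]. *)
pose a := h j - h v; pose b := h v - h i.
have a0 : 0 < a by rewrite subr_gt0.
have b0 : 0 < b by rewrite subr_gt0.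
pose dx := a * (px i - px v) + b * (px j - px v).
pose dy := a * (py i - py v) + b * (py j - py v).
have [d1 d2] := dbary_basis a b ht; rewrite -/dx -/dy in d1 d2.
have dxy : dx = - (dy * kap) by rewrite /dx /dy /a /b /h /=; ring.
have dy0 : dy != 0.
  apply: contraTneq a0 => e; rewrite -d1 dxy e mul0r oppr0 /dbary !mul0r subrr mul0r.
  by rewrite ltxx.
have [s [n [sE nE e]]] : exists s n : R,
    [/\ s = (-1) ^+ (dy < 0)%R, n = `|dy| & dy = s * n].
  by exists ((-1) ^+ (dy < 0)%R), `|dy|; split=> //; exact: realEsign (num_real _).
have scale k l m : dbary k l m dx dy = n * dbary k l m (- (s * kap)) s.
  by rewrite dxy e /dbary mulrA; congr (_ / _); ring.
rewrite sE nE in scale.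
exists (dy < 0); exists i, j; split=> //.
  by rewrite -(pmulr_rgt0 _ (_ : 0 < `|dy|)) ?normr_gt0// -scale d1.
by rewrite -(pmulr_rgt0 _ (_ : 0 < `|dy|)) ?normr_gt0// -scale d2.
Qed.

Lemma ray_near kap v t b : ray_in kap v t b -> exists i j, tri3 t v i j /\
  \forall e \near (0 : R)^'+,
    [/\ 0 < bary v i j (px v + e * - ((-1) ^+ b * kap)) (py v + e * (-1) ^+ b),
      0 < bary i j v (px v + e * - ((-1) ^+ b * kap)) (py v + e * (-1) ^+ b)
    & 0 < bary j v i (px v + e * - ((-1) ^+ b * kap)) (py v + e * (-1) ^+ b)].
Proof.
move=> [i [j [ht d1 d2]]]; exists i, j; split=> //.
have [l1 l2 l3] := bary_vertex ht.
near=> e; have e_gt0 : 0 < e by near: e; exact: near_right0_gt0.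
rewrite !bary_affine l1 l2 l3 !add0r; split; try exact: mulr_gt0.
by near: e; exact: near_right0_affine_gt0.
Unshelve. all: by end_near. Qed.

Lemma ray_unique kap v t s b : ray_in kap v t b -> ray_in kap v s b -> t = s.
Proof.
move=> /ray_near[i [j [ht nt]]] /ray_near[i' [j' [hs ns]]].
have [e _ [[a1 a2 a3] [b1 b2 b3]]] := near_right0_ex (filterI nt ns).
by apply: (in_tri_interior_eq ht _ a1 a2 a3); apply/(in_triP _ _ hs); split; exact: ltW.
Qed.

Lemma ray_in_box kap v t b : ray_in kap v t b -> exists2 e, 0 < e &
  in_box A B (px v + e * - ((-1) ^+ b * kap)) (py v + e * (-1) ^+ b).
Proof.
move=> /ray_near[i [j [ht nt]]]; have [e e_gt0 [a1 a2 a3]] := near_right0_ex nt.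
exists e => //; apply/cover; exists t; apply/(in_triP _ _ ht); split; exact: ltW.
Qed.

(** Each of the two level rays enters at most one triangle. They point to the upper left and to the
    lower right, and a summand vanishes where its ray leaves the rectangle. *)
Lemma mid_count_linear_le (kap : R) v : 0 < kap ->
  (mid_count (fun w => px w + kap * py w)%R v <=
   ((px v != 0)%R && (py v != B)) + ((px v != A) && (py v != 0)%R))%N.
Proof.
move=> kap_gt0; pose S b := [set t | `[< ray_in kap v t b >]]%SET.
have S_le1 b : (#|S b| <= 1)%N.
  apply/card_le1_eqP => t s; rewrite !inE => ht hs.
  exact: ray_unique hs ht.
have S0 b : ~ (exists t, ray_in kap v t b) -> #|S b| = 0%N.
  move=> no; apply/eqP; rewrite cards_eq0; apply/eqP/setP => t; rewrite !inE.
  by apply/asboolP => ht; apply: no; exists t.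
apply: (@leq_trans (#|S false| + #|S true|)%N).
  apply: leq_trans (leq_card_setU _ _); apply: subset_leq_card.
  apply/fintype.subsetP => t; rewrite !inE => /mid_ray[[]] ht.
    by apply/orP; right; apply/asboolP.
  by apply/orP; left; apply/asboolP.
apply: leq_add; (case: (boolP (_ && _)) => [_|]; first exact: S_le1);
  rewrite negb_and !negbK => hv; rewrite leqn0 S0// => -[t /ray_in_box[e e_gt0]].
  rewrite expr0 mul1r mulr1 => /andP[/andP[x0 xA] /andP[y0 yB]].
  have ek := mulr_gt0 e_gt0 kap_gt0.
  by case/orP: hv => /eqP ev; rewrite ev in x0 yB; lra.
rewrite expr1 !mulN1r opprK mulrN1 => /andP[/andP[x0 xA] /andP[y0 yB]].
have ek := mulr_gt0 e_gt0 kap_gt0.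
by case/orP: hv => /eqP ev; rewrite ev in xA y0; lra.
Qed.

(** At the lower left and upper right corners both level rays leave the rectangle, so the count is 0
    while the bound is 1. These two units are the margin in the comparison of the sums. *)
Lemma linear_upper (kap : R) c00 c11 : 0 < kap ->
  px c00 = 0 -> py c00 = 0 -> px c11 = A -> py c11 = B ->
  forall v, (mid_count (fun w => px w + kap * py w)%R v +
    ((v == c00) + (v == c11)) <= mid_bound v)%N.
Proof.
move=> kap_gt0 x0 y0 xA yB v; have := mid_count_linear_le v kap_gt0.
have A0 := gt_eqF A_gt0; have B0 := gt_eqF B_gt0.
have [-> le_sc|v00] := eqVneq v c00.
  have -> : (c00 == c11) = false.
    by apply/eqP => e; move: x0; rewrite e xA => /eqP; rewrite A0.
  by move: le_sc; rewrite x0 y0 !eqxx andbF /= leqn0 => /eqP ->;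
    rewrite /mid_bound; case: ifP.
have [-> le_sc|v11] := eqVneq v c11.
  move: le_sc; rewrite xA yB !eqxx andbF /= leqn0 => /eqP ->.
  by rewrite /mid_bound; case: ifP.
rewrite !addn0 /mid_bound; case: ifP => [_|/negP v_bd] /leq_trans; apply.
  by case: (_ && _); case: (_ && _).
have : [|| px v == 0, px v == A, py v == 0 | py v == B].
  apply: contra_notT v_bd; rewrite !negb_or => /and4P[vx0 vxA vy0 vyB].
  have /andP[/andP[h1 h2] /andP[h3 h4]] := vertex_in_box cover v.
  by rewrite /inner !lt_neqAle h1 h2 h3 h4 vxA vyB ![0 == _]eq_sym vx0 vy0.
by case/or4P => ->; rewrite ?andbF ?andFb ?add0n ?addn0; case: (_ && _).
Qed.

Lemma sum_delta (c : 'I_(nv M)) : (\sum_v (v == c) = 1)%N.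
Proof. by rewrite (bigD1 c)//= eqxx big1 // => v /negPf ->. Qed.

(** [p] is the coordinate that [U] follows and [q] the transverse one; exchanging [px] and [py]
    gives the condition for the second component. *)
Definition bd_mono (p q : 'I_(nv M) -> R) (P Q L : R) (U : 'I_(nv M) -> R) :=
  [/\ forall v, p v = 0 -> U v = 0, forall v, p v = P -> U v = L
    & forall v w, q v = q w -> q v = 0 \/ q v = Q -> p v < p w -> U v < U w].

Lemma horizontal_nbr v (s : R) : (py v == 0) || (py v == B) ->
  ((s == 1) && (px v < A)) || ((s == -1) && (0 < px v)) ->
  exists w, [/\ adj v w, py w = py v & 0 < s * (px w - px v)].
Proof.
move=> hv hs.
have /andP[/andP[x0 xA] /andP[y0 yB]] := vertex_in_box cover v.
have nD : \forall e \near (0 : R)^'+, in_box A B (px v + e * s) (py v + e * 0).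
  case/orP: hs => /andP[/eqP -> px_lt].
    have : 0 < A - px v by rewrite subr_gt0.
    move=> /(near_right0_affine_gt0 (-1)) h.
    apply: filterS (filterI near_right0_gt0 h) => e [e0 he].
    by apply/andP; split; apply/andP; split; lra.
  move: px_lt => /(near_right0_affine_gt0 (-1)) h.
  apply: filterS (filterI near_right0_gt0 h) => e [e0 he].
  by apply/andP; split; apply/andP; split; lra.
have s0 : (s != 0) || ((0 : R) != 0).
  by case/orP: hs => /andP[/eqP -> _]; rewrite ?oppr_eq0 oner_eq0.
pose be : R := if py v == 0 then 1 else -1.
have sup w : 0 * px v + be * py v <= 0 * px w + be * py w.
  rewrite !mul0r !add0r /be; case: ifP hv => [/eqP -> _|_ /= /eqP ->].
    by rewrite mulr0 mul1r; have /andP[_ /andP[]] := vertex_in_box cover w.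
  by rewrite !mulN1r lerN2; have /andP[_ /andP[]] := vertex_in_box cover w.
have ker : 0 * s + be * 0 = 0 by rewrite mul0r mulr0 addr0.
have [w [vw e]] := vertex_side_nbr cover sup ker s0 nD.
rewrite mul0r addr0 => hw; exists w; split=> //.
move: e; rewrite !mul0r !add0r /be; case: ifP => _; first by rewrite !mul1r.
by rewrite !mulN1r => /oppr_inj.
Qed.

Lemma vertical_nbr v (s : R) : (px v == 0) || (px v == A) ->
  ((s == 1) && (py v < B)) || ((s == -1) && (0 < py v)) ->
  exists w, [/\ adj v w, px w = px v & 0 < s * (py w - py v)].
Proof.
move=> hv hs.
have /andP[/andP[x0 xA] /andP[y0 yB]] := vertex_in_box cover v.
have nD : \forall e \near (0 : R)^'+, in_box A B (px v + e * 0) (py v + e * s).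
  case/orP: hs => /andP[/eqP -> px_lt].
    have : 0 < B - py v by rewrite subr_gt0.
    move=> /(near_right0_affine_gt0 (-1)) h.
    apply: filterS (filterI near_right0_gt0 h) => e [e0 he].
    by apply/andP; split; apply/andP; split; lra.
  move: px_lt => /(near_right0_affine_gt0 (-1)) h.
  apply: filterS (filterI near_right0_gt0 h) => e [e0 he].
  by apply/andP; split; apply/andP; split; lra.
have s0 : ((0 : R) != 0) || (s != 0).
  by case/orP: hs => /andP[/eqP -> _]; rewrite ?oppr_eq0 oner_eq0 orbT.
pose al : R := if px v == 0 then 1 else -1.
have sup w : al * px v + 0 * py v <= al * px w + 0 * py w.
  rewrite !mul0r !addr0 /al; case: ifP hv => [/eqP -> _|_ /= /eqP ->].
    by rewrite mulr0 mul1r; have /andP[/andP[]] := vertex_in_box cover w.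
  by rewrite !mulN1r lerN2; have /andP[/andP[]] := vertex_in_box cover w.
have ker : al * 0 + 0 * s = 0 by rewrite mul0r mulr0 addr0.
have [w [vw e]] := vertex_side_nbr cover sup ker s0 nD.
rewrite mul0r add0r => hw; exists w; split=> //.
move: e; rewrite !mul0r !addr0 /al; case: ifP => _; first by rewrite !mul1r.
by rewrite !mulN1r => /oppr_inj.
Qed.

Variables (U W : 'I_(nv M) -> R) (L L' : R).
Hypotheses (monoU : bd_mono px py A B L U) (monoW : bd_mono py px B A L' W).

Lemma mono_horizontal v (s : R) : (py v == 0) || (py v == B) ->
  ((s == 1) && (px v < A)) || ((s == -1) && (0 < px v)) ->
  exists w, [/\ adj v w, W w = W v & 0 < s * (U w - U v)].
Proof.
move=> hv hs; have [w [vw ey hw]] := horizontal_nbr hv hs.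
have [W0 WB _] := monoW; have [_ _ UM] := monoU.
exists w; split=> //.
  by case/orP: hv => /eqP e; [rewrite !W0// ey|rewrite !WB// ey].
have hv' : py v = 0 \/ py v = B by case/orP: hv => /eqP ->; [left|right].
move: hw; case/orP: hs => /andP[/eqP -> _]; rewrite ?mul1r ?mulN1r ?opprB !subr_gt0.
  exact: UM.
by apply: UM; rewrite ey.
Qed.

Lemma mono_vertical v (s : R) : (px v == 0) || (px v == A) ->
  ((s == 1) && (py v < B)) || ((s == -1) && (0 < py v)) ->
  exists w, [/\ adj v w, U w = U v & 0 < s * (W w - W v)].
Proof.
move=> hv hs; have [w [vw ex hw]] := vertical_nbr hv hs.
have [U0 UA _] := monoU; have [_ _ WM] := monoW.
exists w; split=> //.
  by case/orP: hv => /eqP e; [rewrite !U0// ex|rewrite !UA// ex].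
have hv' : px v = 0 \/ px v = A by case/orP: hv => /eqP ->; [left|right].
move: hw; case/orP: hs => /andP[/eqP -> _]; rewrite ?mul1r ?mulN1r ?opprB !subr_gt0.
  exact: WM.
by apply: WM; rewrite ex.
Qed.

Variables (al be : R).
Hypotheses (al0 : al != 0) (be0 : be != 0).
Let h v := al * U v + be * W v.
Hypothesis hf : tie_free h.

Lemma mid_count_gt0_opp v w1 w2 : adj v w1 -> adj v w2 ->
  (h w1 - h v) * (h w2 - h v) < 0 -> (0 < mid_count h v)%N.
Proof.
move=> vw1 vw2; rewrite lt_neqAle mulf_eq0 !subr_eq0 negb_or.
move=> /andP[/andP[n1 n2] le0].
case: (ltgtP (h w1) (h v)) n1 => // h1 _; case: (ltgtP (h w2) (h v)) n2 => // h2 _.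
- by move: le0; rewrite leNgt nmulr_lgt0 ?subr_lt0// h1.
- exact: (mid_count_gt0 cover hf vw1 vw2).
- exact: (mid_count_gt0 cover hf vw2 vw1).
- by move: le0; rewrite leNgt mulr_gt0 ?subr_gt0.
Qed.

Lemma side_opp v w1 w2 (F : 'I_(nv M) -> R) (c : R) : c != 0 ->
  h w1 - h v = c * (F w1 - F v) -> h w2 - h v = c * (F w2 - F v) ->
  0 < 1 * (F w1 - F v) -> 0 < (-1) * (F w2 - F v) ->
  (h w1 - h v) * (h w2 - h v) < 0.
Proof.
move=> c0 -> ->; rewrite mul1r mulN1r oppr_gt0 => h1 h2.
have c20 : 0 < c ^+ 2 by rewrite exprn_even_gt0.
have -> : c * (F w1 - F v) * (c * (F w2 - F v)) =
  c ^+ 2 * ((F w1 - F v) * (F w2 - F v)) by ring.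
by rewrite pmulr_rlt0// pmulr_rlt0.
Qed.

(** Between corners, the two neighbours along the side have heights on opposite sides of that of
    [v]. At a corner the two height changes have the signs of [al] and [be] times the inward
    directions; they agree only at one pair of opposite corners, selected by the sign of
    [al * be]. *)
Lemma boundary_lower v : ~~ inner A B v ->
  [\/ (0 < mid_count h v)%N,
      0 < al * be /\ (px v = 0 /\ py v = 0 \/ px v = A /\ py v = B)
    | al * be < 0 /\ (px v = A /\ py v = 0 \/ px v = 0 /\ py v = B)].
Proof.
move=> v_bd; have /andP[/andP[x0 xA] /andP[y0 yB]] := vertex_in_box cover v.
have dhU w : W w = W v -> h w - h v = al * (U w - U v).
  by move=> e; rewrite /h e; ring.
have dhW w : U w = U v -> h w - h v = be * (W w - W v).
  by move=> e; rewrite /h e; ring.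
have ab0 : al * be != 0 by rewrite mulf_neq0.
have [/andP[px0 pxA]|cx] := boolP ((0 < px v) && (px v < A)).
  have hv : (py v == 0) || (py v == B).
    apply: contraNT v_bd; rewrite negb_or => /andP[vy0 vyB].
    by rewrite /inner px0 pxA !lt_neqAle y0 yB vyB eq_sym vy0.
  have [|w1 [a1 e1 d1]] := mono_horizontal (s := 1) hv.
    by rewrite eqxx pxA.
  have [|w2 [a2 e2 d2]] := mono_horizontal (s := -1) hv.
    by rewrite eqxx px0 orbT.
  constructor 1; apply: (mid_count_gt0_opp a1 a2).
  exact: (side_opp al0 (dhU _ e1) (dhU _ e2) d1 d2).
have hv : (px v == 0) || (px v == A).
  apply: contraNT cx; rewrite negb_or => /andP[vx0 vxA].
  by rewrite !lt_neqAle x0 xA vxA eq_sym vx0.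
have [/andP[py0 pyB]|cy] := boolP ((0 < py v) && (py v < B)).
  have [|w1 [a1 e1 d1]] := mono_vertical (s := 1) hv.
    by rewrite eqxx pyB.
  have [|w2 [a2 e2 d2]] := mono_vertical (s := -1) hv.
    by rewrite eqxx py0 orbT.
  constructor 1; apply: (mid_count_gt0_opp a1 a2).
  exact: (side_opp be0 (dhW _ e1) (dhW _ e2) d1 d2).
have hv' : (py v == 0) || (py v == B).
  apply: contraNT cy; rewrite negb_or => /andP[vy0 vyB].
  by rewrite !lt_neqAle y0 yB vyB eq_sym vy0.
have corner (s1 s2 : R) : s1 * s1 = 1 -> s2 * s2 = 1 ->
    ((s1 == 1) && (px v < A)) || ((s1 == -1) && (0 < px v)) ->
    ((s2 == 1) && (py v < B)) || ((s2 == -1) && (0 < py v)) ->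
    s1 * s2 * (al * be) < 0 -> (0 < mid_count h v)%N.
  move=> q1 q2 hs1 hs2 neg.
  have [w1 [a1 e1 d1]] := mono_horizontal hv' hs1.
  have [w2 [a2 e2 d2]] := mono_vertical hv hs2.
  apply: (mid_count_gt0_opp a1 a2); rewrite (dhU _ e1) (dhW _ e2).
  rewrite (_ : _ * _ = s1 * s2 * (al * be) *
    (s1 * (U w1 - U v) * (s2 * (W w2 - W v)))).
    by rewrite nmulr_rlt0// mulr_gt0.
  rewrite (_ : s1 * s2 * (al * be) * _ = (s1 * s1) * (s2 * s2) *
    (al * (U w1 - U v) * (be * (W w2 - W v)))); last by ring.
  by rewrite q1 q2 !mul1r.
case/orP: hv => /eqP ex; case/orP: hv' => /eqP ey;
  rewrite ex ey ?A_gt0 ?B_gt0 in corner *;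
  case: (ltgtP 0 (al * be)) ab0 => // ab _.
- by constructor 2; split=> //; left.
- constructor 1; apply: (corner 1 1); rewrite ?mulr1 ?eqxx ?mul1r//.
- constructor 1; apply: (corner 1 (-1));
    rewrite ?mulrNN ?mulr1 ?eqxx ?orbT ?mulrN1 ?mul1r//.
  by rewrite mulN1r oppr_lt0.
- by constructor 3; split=> //; right.
- constructor 1; apply: (corner (-1) 1); rewrite ?mulrNN ?mulr1 ?eqxx ?orbT//.
  by rewrite mulN1r oppr_lt0.
- by constructor 3; split=> //; left.
- by constructor 2; split=> //; right.
- constructor 1; apply: (corner (-1) (-1)); rewrite ?mulrNN ?mulr1 ?eqxx ?orbT ?mul1r//.
Qed.

Hypotheses (hdel : delaunay M) (hA5 : no_cocircular_quadrilateral M).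
Hypotheses (harmU : forall v, inner A B v -> lap U v = 0)
  (harmW : forall v, inner A B v -> lap W v = 0).

(** The exceptions are the two opposite corners left over by [boundary_lower]. At an inner vertex
    the count is positive and even, hence at least 2. *)
Lemma exceptional_lower : exists c c', forall v,
  (mid_bound v <= mid_count h v + ((v == c) + (v == c')))%N.
Proof.
have z0 : ((0 : R) == 0) || ((0 : R) == A) by rewrite eqxx.
have z0' : ((0 : R) == 0) || ((0 : R) == B) by rewrite eqxx.
have zA : (A == 0) || (A == A) by rewrite eqxx orbT.
have zB : (B == 0) || (B == B) by rewrite eqxx orbT.
have [c00 [x00 y00]] := corner_vertex cover A_gt0 B_gt0 z0 z0'.
have [c10 [x10 y10]] := corner_vertex cover A_gt0 B_gt0 zA z0'.
have [c01 [x01 y01]] := corner_vertex cover A_gt0 B_gt0 z0 zB.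
have [c11 [x11 y11]] := corner_vertex cover A_gt0 B_gt0 zA zB.
have inner_case v : inner A B v -> (2 <= mid_count h v)%N.
  move=> v_in; have ev := mid_count_even cover hf v_in.
  have lap0 : lap h v = 0 by rewrite lap_linear harmU ?harmW// !mulr0 addr0.
  have [t tv] := vertex_in_triangle v; have [i [j ht]] := tri3_ex1 tv.
  have vi := tri3_adj ht; have hvi := hf vi.
  have ne : exists2 w, adj v w & h w != h v by exists i => //; rewrite eq_sym.
  have [w1 a1 l1] := lap0_ex_lt cover hdel hA5 v_in lap0 ne.
  have [w2 a2 l2] := lap0_ex_gt cover hdel hA5 v_in lap0 ne.
  have := mid_count_gt0 cover hf a1 a2 l1 l2; move: ev.
  by case: (mid_count h v) => [|[|n]].
exists (if 0 < al * be then c00 else c10), (if 0 < al * be then c11 else c01) => v.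
rewrite /mid_bound; case: ifP => [/inner_case|/negbT v_bd].
  by move=> /leq_trans; apply; exact: leq_addr.
have [s0|[ab hv]|[ab hv]] := boundary_lower v_bd.
- by rewrite (leq_trans s0)// leq_addr.
- rewrite ab; case: hv => -[ex ey].
    by rewrite (_ : v = c00) ?eqxx ?addnA ?addnS//; apply: px_py_inj; rewrite ?ex ?ey.
  by rewrite (_ : v = c11) ?eqxx ?addnA ?addnS ?addn1//;
    apply: px_py_inj; rewrite ?ex ?ey.
- rewrite ltNge (ltW ab) /=; case: hv => -[ex ey].
    by rewrite (_ : v = c10) ?eqxx ?addnA ?addnS//; apply: px_py_inj; rewrite ?ex ?ey.
  by rewrite (_ : v = c01) ?eqxx ?addnA ?addnS ?addn1//;
    apply: px_py_inj; rewrite ?ex ?ey.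
Qed.

(** Each of the finitely many edges excludes at most one value of [e]. *)
Lemma tie_free_near (F G : 'I_(nv M) -> R) :
  (forall v w, adj v w -> (F v != F w) || (G v != G w)) ->
  \forall e \near (0 : R)^'+, tie_free (fun v => F v + e * G v).
Proof.
move=> FG.
have : \forall e \near (0 : R)^'+, forall v w, adj v w ->
    F v + e * G v != F w + e * G w.
  apply: filter_forall => v; apply: filter_forall => w.
  have [vw|vw] := boolP (adj v w); last by near=> e.
  have : (F v - F w != 0) || (G v - G w != 0) by rewrite !subr_eq0 FG.
  move=> /near_right0_affine_neq0; apply: filterS => e ne _.
  by rewrite -subr_eq0; apply: contraNneq ne => <-; apply/eqP; ring.
by apply: filterS => e.
Unshelve. all: by end_near. Qed.

(** The linear height shows that the bounds add up to at least [nf M + 2]; the lower estimate for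
    [h] shows that they add up to at most that. No slack remains for a vertex above its bound. *)
Lemma mid_count_le_bound v : (mid_count h v <= mid_bound v)%N.
Proof.
have z0 : ((0 : R) == 0) || ((0 : R) == A) by rewrite eqxx.
have z0' : ((0 : R) == 0) || ((0 : R) == B) by rewrite eqxx.
have zA : (A == 0) || (A == A) by rewrite eqxx orbT.
have zB : (B == 0) || (B == B) by rewrite eqxx orbT.
have [c00 [x00 y00]] := corner_vertex cover A_gt0 B_gt0 z0 z0'.
have [c11 [x11 y11]] := corner_vertex cover A_gt0 B_gt0 zA zB.
have [kap kap_gt0 kf] : exists2 kap, 0 < kap &
    tie_free (fun w : 'I_(nv M) => px w + kap * py w).
  apply: near_right0_ex; apply: tie_free_near => u w /andP[uw _].
  by apply: contraNT uw; rewrite negb_or !negbK => /andP[/eqP ? /eqP ?];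
    apply/eqP; exact: px_py_inj.
have up := linear_upper kap_gt0 x00 y00 x11 y11.
have sum_up : (nf M + 2 <= \sum_v mid_bound v)%N.
  have : (\sum_v (mid_count (fun w => px w + kap * py w)%R v +
    ((v == c00) + (v == c11))) <= \sum_v mid_bound v)%N.
    by apply: leq_sum => w _; exact: up.
  by rewrite !big_split /= (sum_mid_count kf) !sum_delta.
have [c [c' low]] := exceptional_lower.
rewrite leqNgt; apply/negP => lt_v.
have : (\sum_v mid_bound v < \sum_v (mid_count h v + ((v == c) + (v == c'))))%N.
  rewrite (bigD1 v)//= [X in (_ < X)%N](bigD1 v)//= -addSn leq_add//.
    by rewrite (leq_trans lt_v)// leq_addr.
  by apply: leq_sum => w _; exact: low.
by rewrite !big_split /= (sum_mid_count hf) !sum_delta ltnNge sum_up.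
Qed.

End MiddleBounds.

(** * Discrete harmonic maps with monotone boundary values *)

Section Embedding.
Context {R : realType} (M : triangulation R) (A B : R).
Implicit Types (i j k v w : 'I_(nv M)) (t s : 'I_(nf M)).
Implicit Types (U W F G : 'I_(nv M) -> R).
Hypothesis cover : forall x y, in_box A B x y <-> exists t : 'I_(nf M), in_tri t x y.
Hypotheses (A_gt0 : 0 < A) (B_gt0 : 0 < B).
Hypotheses (hdel : delaunay M) (hA5 : no_cocircular_quadrilateral M).
Variables (L L' : R).
Hypotheses (L_gt0 : 0 < L) (L'_gt0 : 0 < L').

(** The conditions concern [U] and [W] separately, so either component can be moved or replaced
    alone. *)
Definition tutte U W :=
  [/\ bd_mono px py A B L U, bd_mono py px B A L' W,
      forall v, inner A B v -> lap U v = 0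
    & forall v, inner A B v -> lap W v = 0].

(** Signed area of the image times signed area of the triangle: it has the sign of the Jacobian and
    ignores the stored vertex order. *)
Definition orient U W t :=
  cross U W (tri M t ord0) (tri M t o1) (tri M t o2) *
  cross px py (tri M t ord0) (tri M t o1) (tri M t o2).

Lemma orientE U W t i j k : tri3 t i j k ->
  orient U W t = cross U W i j k * cross px py i j k.
Proof. by move=> h; exact: cross2_tri3 (tri3_tri t) h. Qed.

(* The two triangles at the edge [v w] are then the only ones with middle vertex
   [w], so that [v] is the only neighbour below [w] in the link of [w]. *)
Lemma nbr_above U W al be t s v w k l : tutte U W -> al != 0 -> be != 0 ->
  let h x := al * U x + be * W x in
  tie_free h -> tri3 t v w k -> tri3 s v w l -> t != s ->
  h v < h w -> h w < h k -> h w < h l ->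
  inner A B w /\ forall x, adj w x -> x != v -> h w < h x.
Proof.
move=> [monoU monoW harmU harmW] al0 be0 h hf ht hs ts vw wk wl.
have le_w := mid_count_le_bound cover A_gt0 B_gt0 monoU monoW al0 be0 hf hdel hA5
  harmU harmW w.
have mt : mid h t w.
  by apply/midP; exists v, k; split=> //; do 2!apply: tri3_rot; exact: tri3_swap.
have ms : mid h s w.
  by apply/midP; exists v, l; split=> //; do 2!apply: tri3_rot; exact: tri3_swap.
have sub : [set t; s]%SET \subset [set r | mid h r w]%SET.
  by apply/fintype.subsetP => r; rewrite !inE => /orP[] /eqP ->.
have w_in : inner A B w.
  have := leq_trans (subset_leq_card sub) le_w.
  by rewrite cards2 ts /mid_bound; case: ifP.
split=> // x wx xv.
have midE r : mid h r w = (r == t) || (r == s).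
  have /eqP/setP/(_ r) : [set t; s]%SET == [set r | mid h r w]%SET.
    rewrite eqEcard sub cards2 ts /=; move: le_w; rewrite /mid_bound w_in; exact.
  by rewrite !inE /mid.
rewrite ltNge; apply/negP => xw.
have {xw} xw : h x < h w by rewrite lt_neqAle xw andbT eq_sym hf.
(* [b] marks a vertex below [w] other than [v]. A marked triangle at [w] that also has a higher
   vertex would have [w] in the middle, hence be [t] or [s], which are unmarked; so the mark agrees
   across edges at [w]. *)
pose b r := [exists i in tverts r, [&& i != w, i != v & h i < h w]].
have no_b r : (r == t) || (r == s) -> ~~ b r.
  move=> /orP[] /eqP ->; apply/existsPn => i; apply/negP => /andP[].
    by rewrite (tri3E ht) !inE => /orP[/orP[]|] /eqP -> /and3P[];
      rewrite ?eqxx // => _ _; rewrite ltNge ltW.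
  by rewrite (tri3E hs) !inE => /orP[/orP[]|] /eqP -> /and3P[];
    rewrite ?eqxx // => _ _; rewrite ltNge ltW.
have [tv tw _] := tri3_mem ht; have [sv sw _] := tri3_mem hs.
have contains_v r : v \in tverts r -> w \in tverts r -> (r == t) || (r == s).
  move=> rv rw; have vw' : adj v w := tri3_adj ht.
  have wv' : adj w v by rewrite adjC.
  have [t1 [t2 [k1 [k2 [_ _ _ _ two]]]]] := inner_edge_triangles cover w_in wv'.
  move: ts; case: (two _ tw tv) => ->; case: (two _ sw sv) => ->;
    rewrite ?eqxx // => _; case: (two _ rw rv) => ->; by rewrite eqxx ?orbT.
have bS r r' y : w \in tverts r -> w \in tverts r' -> y \in tverts r ->
    y \in tverts r' -> y != w -> b r = b r'.
  move=> rw r'w ry r'y yw.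
  have [yv|yv] := eqVneq y v.
    by rewrite yv in ry r'y; rewrite !(negPf (no_b _ _)) ?contains_v.
  case: (ltgtP (h y) (h w)) => [lo|hi|e].
  - have b1 q : y \in tverts q -> b q.
      by move=> qy; apply/existsP; exists y; rewrite qy yw yv lo.
    by rewrite !b1.
  - have b0 q : w \in tverts q -> y \in tverts q -> ~~ b q.
      move=> qw qy; apply/negP => bq; have : mid h q w.
        rewrite /mid qw /=; apply/andP; split; apply/existsP.
          by case/existsP: (bq) => i /andP[qi /and3P[_ _ iw]]; exists i; rewrite qi.
        by exists y; rewrite qy.
      by rewrite midE => /no_b; rewrite bq.
    by rewrite !(negPf (b0 _ _ _)).
  - by have := hf y w; rewrite (mem_adj ry rw yw) e eqxx => /(_ isT).
have [r [m hr]] := adj_tri3 wx; have [rw rx _] := tri3_mem hr.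
have : b r.
  apply/existsP; exists x; rewrite rx xv xw /= andbT eq_sym.
  by case/andP: wx.
rewrite (star_class cover bS rw tw); apply/negP/no_b.
by rewrite eqxx.
Qed.

Lemma fold U W t s v w k l : tutte U W ->
  (forall t, orient U W t != 0) ->
  tri3 t v w k -> tri3 s v w l -> t != s ->
  cross U W v w k * cross U W v w l < 0.
Proof.
move=> TUW nd ht hs ts; have [monoU monoW harmU harmW] := TUW.
have c0 r i j m : tri3 r i j m -> cross U W i j m != 0.
  by move=> h; have := nd r; rewrite (orientE _ _ h) mulf_eq0 negb_or => /andP[].
have ck := c0 _ _ _ _ ht; have cl := c0 _ _ _ _ hs.
rewrite lt_neqAle mulf_neq0//= leNgt; apply/negP => kl_gt0.
set K := cross U W v w k in ck kl_gt0.
pose a := U w - U v; pose b := W w - W v.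
(* [F] is normal to the image of the edge, the factor [K] making it positive towards [k]; [G] is
   tangential and provides the tilt. Jointly they determine [U] and [W], so ties in both would
   collapse a triangle. *)
pose F x := - (K * b) * U x + K * a * W x.
pose G x := a * U x + b * W x.
have ab0 : (a != 0) || (b != 0).
  rewrite -negb_and; apply: contra ck => /andP[/eqP a0 /eqP b0].
  by rewrite /K /cross -/a -/b a0 b0 !mul0r subrr.
have dF x : F x - F v = K * cross U W v w x.
  by rewrite /F /cross /a /b; ring.
have Fw : F w = F v by apply/eqP; rewrite -subr_eq0 dF /cross; apply/eqP; ring.
have Fk : 0 < F k - F w by rewrite Fw dF -expr2 exprn_even_gt0.
have Fl : 0 < F l - F w by rewrite Fw dF.
have Gw : 0 < G w - G v.
  have -> : G w - G v = a ^+ 2 + b ^+ 2 by rewrite /G /a /b; ring.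
  exact: sqr_dist_gt0.
have hE e x : (- (K * b) + e * a) * U x + (K * a + e * b) * W x = F x + e * G x.
  by rewrite /F /G; ring.
have n1 : \forall e \near (0 : R)^'+, - (K * b) + e * a != 0.
  apply: near_right0_affine_neq0; rewrite oppr_eq0 mulf_eq0 (negPf ck) /=.
  by rewrite orbC.
have n2 : \forall e \near (0 : R)^'+, K * a + e * b != 0.
  by apply: near_right0_affine_neq0; rewrite mulf_eq0 (negPf ck).
have n3 : \forall e \near (0 : R)^'+, tie_free (fun x => F x + e * G x).
  apply: tie_free_near => x y /adj_tri3[r [m hr]].
  rewrite -negb_and; apply: contra (c0 _ _ _ _ hr) => /andP[/eqP eF /eqP eG].
  have d2 : 0 < a ^+ 2 + b ^+ 2 by exact: sqr_dist_gt0.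
  have Kd : K * (a ^+ 2 + b ^+ 2) != 0 by rewrite mulf_neq0// gt_eqF.
  have eU : U y - U x = 0.
    apply: (mulfI Kd); rewrite mulr0.
    transitivity (- b * (F y - F x) + K * a * (G y - G x)).
      by rewrite /F /G; ring.
    by rewrite eF eG !subrr !mulr0 addr0.
  have eW : W y - W x = 0.
    apply: (mulfI Kd); rewrite mulr0.
    transitivity (a * (F y - F x) + K * b * (G y - G x)).
      by rewrite /F /G; ring.
    by rewrite eF eG !subrr !mulr0 addr0.
  by rewrite /cross eU eW !mul0r subrr.
have n4 : \forall e \near (0 : R)^'+, 0 < (F k - F w) + e * (G k - G w).
  exact: near_right0_affine_gt0.
have n5 : \forall e \near (0 : R)^'+, 0 < (F l - F w) + e * (G l - G w).
  exact: near_right0_affine_gt0.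
have above : \forall e \near (0 : R)^'+, inner A B w /\
    forall x, adj w x -> x != v -> 0 < (F x - F w) + e * (G x - G w).
  near=> e.
  have e1 : - (K * b) + e * a != 0 by near: e.
  have e2 : K * a + e * b != 0 by near: e.
  have e0 : 0 < e by near: e; exact: near_right0_gt0.
  have e4 : 0 < (F k - F w) + e * (G k - G w) by near: e.
  have e5 : 0 < (F l - F w) + e * (G l - G w) by near: e.
  have e3 : tie_free (fun x => F x + e * G x) by near: e.
  have eG := mulr_gt0 e0 Gw.
  have e3' : tie_free (fun x => (- (K * b) + e * a) * U x + (K * a + e * b) * W x).
    by move=> x y xy; rewrite !hE; exact: e3.
  have [] := nbr_above TUW e1 e2 e3' ht hs ts; rewrite ?hE.
  - by rewrite Fw -subr_gt0; clear -eG; lra.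
  - by clear -e4; lra.
  - by clear -e5; lra.
  move=> w_in hx; split=> // x wx xv.
  by have := hx x wx xv; rewrite !hE -subr_gt0; congr (0 < _); ring.
have [_ _ [w_in _]] := near_right0_ex above.
have harmF : lap F w = 0 by rewrite lap_linear harmU ?harmW// !mulr0 addr0.
(* As the tilt [e] tends to 0 the inequalities survive weakly. A harmonic [F] that is minimal at [w]
   is constant on the neighbours, contrary to its value at [k]. *)
have minF x : adj w x -> F w <= F x.
  move=> wx; have [->|xv] := eqVneq x v; first by rewrite Fw.
  rewrite -subr_ge0; have [] // := @near_right0_affine_ge0 _ (F x - F w) (G x - G w).
  by apply: filterS above => e [_ /(_ x wx xv) /ltW].
have wk : adj w k by exact: tri3_adj (tri3_rot ht).
move: Fk; rewrite (lap0_min cover hdel hA5 w_in harmF minF wk) subrr.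
by rewrite ltxx.
Unshelve. all: by end_near. Qed.

Lemma corner00 : exists v : 'I_(nv M), px v = 0 /\ py v = 0.
Proof. by apply: (corner_vertex cover); rewrite ?eqxx. Qed.

Lemma tutte_W_ge0 U W v : tutte U W -> 0 <= W v.
Proof.
move=> [_ [W0 WB WM] _ harmW].
have bdW u : ~~ inner A B u -> 0 <= W u.
  have /andP[/andP[x0 xA] /andP[y0 yB]] := vertex_in_box cover u.
  have [/eqP ey _|ey0] := boolP (py u == 0); first by rewrite W0.
  have [/eqP ey _|eyB] := boolP (py u == B); first by rewrite WB// ltW.
  move=> u_bd; have hx : (px u == 0) || (px u == A).
    apply: contraNT u_bd; rewrite negb_or => /andP[vx0 vxA].
    by rewrite /inner !lt_neqAle x0 y0 xA yB vxA eyB ![0 == _]eq_sym vx0 ey0.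
  have [c [cx cy]] : exists c : 'I_(nv M), px c = px u /\ py c = 0.
    by apply: (corner_vertex cover); rewrite ?eqxx.
  rewrite -(W0 c cy) ltW// WM ?cx ?cy//; last by rewrite lt_neqAle eq_sym ey0.
  by case/orP: hx => /eqP; [left|right].
have harmN u : inner A B u -> lap (fun x => - W x) u = 0.
  by move=> u_in; rewrite lapN harmW// oppr0.
have [u u_bd umax] := max_principle cover hdel hA5 A_gt0 B_gt0 harmN.
by rewrite (le_trans (bdW u u_bd))// -lerN2 umax.
Qed.

Lemma nondegenerate_orient_gt0 U W : tutte U W ->
  (forall t, orient U W t != 0) -> forall t, 0 < orient U W t.
Proof.
move=> TUW nd.
have bS v t s w : v \in tverts t -> v \in tverts s -> w \in tverts t ->
    w \in tverts s -> w != v -> (0 < orient U W t) = (0 < orient U W s).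
  move=> tv sv tw sw; rewrite eq_sym => vw; have [->//|ts] := eqVneq t s.
  have [k ht] := tri3_ex2 tv tw vw; have [l hs] := tri3_ex2 sv sw vw.
  have neg1 := fold TUW nd ht hs ts.
  have neg2 := edge_opposite_sides ht hs ts.
  (* The apices lie on opposite sides of the shared edge both in the rectangle and, by [fold], in
     the image; the two changes of sign cancel. *)
  have prod : 0 < orient U W t * orient U W s.
    rewrite (orientE _ _ ht) (orientE _ _ hs) mulrACA.
    by rewrite nmulr_rgt0.
  apply/idP/idP => pos; first by rewrite -(pmulr_rgt0 _ pos).
  by rewrite -(pmulr_lgt0 _ pos).
have star v t s : v \in tverts t -> v \in tverts s ->
    (0 < orient U W t) = (0 < orient U W s).
  move=> tv sv.
  exact: (@star_class _ _ _ _ cover v (fun r => 0 < orient U W r) (bS v) t s tv sv).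
have [c [cx cy]] := corner00.
(* A triangle on the lower side at the origin fixes the sign: the image of its side runs to the
   right at height 0, and no vertex has its image below. *)
have [t0 [t0c pos0]] : exists t, c \in tverts t /\ 0 < orient U W t.
  have [[U0 _ UM] _ _ _] := TUW; have [_ [W0 _ _] _ _] := TUW.
  have cy' : (py c == 0) || (py c == B) by rewrite cy eqxx.
  have hs : (((1 : R) == 1) && (px c < A)) || (((1 : R) == -1) && (0 < px c)).
    by rewrite eqxx cx A_gt0.
  have [w [cw wy]] := horizontal_nbr cover cy' hs; rewrite mul1r => wx.
  have [t [k ht]] := adj_tri3 cw; exists t; split; first by case/and5P: ht.
  have := nd t; rewrite lt_neqAle eq_sym => -> /=; rewrite (orientE _ _ ht).
  rewrite /cross wy cy (W0 c cy) (W0 w) ?wy// !subr0 !mul0r !subr0.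
  have /andP[_ /andP[ky _]] := vertex_in_box cover k.
  rewrite !mulr_ge0//.
    by rewrite subr_ge0 ltW// UM ?wy ?cy//; [left|rewrite -subr_gt0].
    exact: tutte_W_ge0 TUW.
  exact: ltW.
have all_v := edge_closed_full cover
  (P := fun v => [exists t, (v \in tverts t) && (0 < orient U W t)]).
move=> t; have [i [j [k hi]]] := tri3_ex t; have [ti _ _] := tri3_mem hi.
have /existsP[s /andP[si pos]] :
    [exists t, (i \in tverts t) && (0 < orient U W t)].
  apply: (all_v c).
    by apply/existsP; exists t0; rewrite t0c.
  move=> v w /andP[_ /existsP[r /andP[rv rw]]] /existsP[s /andP[sv pos]].
  by apply/existsP; exists r; rewrite rw (star v r s).
by rewrite (star i t s).
Qed.

(** Strict monotonicity is a finite set of strict inequalities, and the fixed values survive because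
    the direction vanishes on those two sides. *)
Lemma bd_mono_near p q P Q C U G : bd_mono p q P Q C U ->
  (forall v, p v = 0 -> G v = 0) -> (forall v, p v = P -> G v = 0) ->
  \forall e \near (0 : R)^'+, @bd_mono R M p q P Q C (fun v => U v + e * G v).
Proof.
move=> [U0 UP UM] G0 GP.
have : \forall e \near (0 : R)^'+, forall v w, q v = q w ->
    q v = 0 \/ q v = Q -> p v < p w -> U v + e * G v < U w + e * G w.
  apply: filter_forall => v; apply: filter_forall => w.
  have [[qvw qv pvw]|no] := pselect [/\ q v = q w, q v = 0 \/ q v = Q & p v < p w].
    have : 0 < U w - U v by rewrite subr_gt0 UM.
    move=> /(near_right0_affine_gt0 (G w - G v)); apply: filterS => e pos _ _ _.
    by rewrite -subr_gt0; move: pos; congr (0 < _); ring.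
  by near=> e => q1 q2 q3; case: no.
apply: filterS => e eM; split=> // v pv.
  by rewrite U0// G0// mulr0 addr0.
by rewrite UP// GP// mulr0 addr0.
Unshelve. all: by end_near. Qed.

Lemma lap_perturb U G e v : lap (fun w => U w + e * G w) v = lap U v + e * lap G v.
Proof. by rewrite /lap mulr_sumr -big_split; apply: eq_bigr => w _ /=; ring. Qed.

Lemma tutte_nearU U W G : tutte U W ->
  (forall v, px v = 0 -> G v = 0) -> (forall v, px v = A -> G v = 0) ->
  (forall v, inner A B v -> lap G v = 0) ->
  \forall e \near (0 : R)^'+, tutte (fun v => U v + e * G v) W.
Proof.
move=> [mU mW hU hW] G0 GA hG.
apply: filterS (bd_mono_near mU G0 GA) => e mUe; split=> // v v_in.
by rewrite lap_perturb hU// hG// mulr0 addr0.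
Qed.

Lemma tutte_nearW U W G : tutte U W ->
  (forall v, py v = 0 -> G v = 0) -> (forall v, py v = B -> G v = 0) ->
  (forall v, inner A B v -> lap G v = 0) ->
  \forall e \near (0 : R)^'+, tutte U (fun v => W v + e * G v).
Proof.
move=> [mU mW hU hW] G0 GA hG.
apply: filterS (bd_mono_near mW G0 GA) => e mWe; split=> // v v_in.
by rewrite lap_perturb hW// hG// mulr0 addr0.
Qed.

(** With [W0], the scaling onto the rectangle of sides [L] and [L']: a nondegenerate member of the
    family, towards which any other one is moved. *)
Let U0 v := L / A * px v.
Let W0 v := L' / B * py v.

Lemma tutte_scaling : tutte U0 W0.
Proof.
have nA := gt_eqF A_gt0; have nB := gt_eqF B_gt0.
split.
- split=> [v e|v e|v w _ _ vw]; rewrite /U0 ?e ?mulr0 ?divfK ?nA//.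
  by rewrite ltr_pM2l// divr_gt0.
- split=> [v e|v e|v w _ _ vw]; rewrite /W0 ?e ?mulr0 ?divfK ?nB//.
  by rewrite ltr_pM2l// divr_gt0.
- move=> v v_in; transitivity (L / A * lap px v).
    by rewrite /lap mulr_sumr; apply: eq_bigr => w _; rewrite /U0; ring.
  by rewrite (lap_px cover v_in) mulr0.
- move=> v v_in; transitivity (L' / B * lap py v).
    by rewrite /lap mulr_sumr; apply: eq_bigr => w _; rewrite /W0; ring.
  by rewrite (lap_py cover v_in) mulr0.
Qed.

Lemma orient_scaling_neq0 t : orient U0 W0 t != 0.
Proof.
have c0 := cross_tri3_neq0 (tri3_tri t).
rewrite /orient mulf_neq0//.
rewrite (_ : cross U0 W0 _ _ _ = L / A * (L' / B) *
  cross px py (tri M t ord0) (tri M t o1) (tri M t o2)); last first.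
  by rewrite /U0 /W0 /cross; ring.
by rewrite !mulf_neq0// ?invr_eq0 gt_eqF.
Qed.

Lemma tutte_dir_U U W : tutte U W ->
  let G v := U0 v - U v in
  [/\ forall v, px v = 0 -> G v = 0, forall v, px v = A -> G v = 0
    & forall v, inner A B v -> lap G v = 0].
Proof.
move=> [[u0 uA _] _ hU _]; have [[v0 vA _] _ hU0 _] := tutte_scaling.
move=> G; split=> v hv.
- by rewrite /G v0// u0// subrr.
- by rewrite /G vA// uA// subrr.
rewrite (_ : G = (fun w => 1 * U0 w + -1 * U w)); last first.
  by apply/funext => w; rewrite /G; ring.
by rewrite (lap_linear 1 (-1) U0 U) hU// hU0// !mulr0 addr0.
Qed.

Lemma tutte_dir_W U W : tutte U W ->
  let G v := W0 v - W v in
  [/\ forall v, py v = 0 -> G v = 0, forall v, py v = B -> G v = 0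
    & forall v, inner A B v -> lap G v = 0].
Proof.
move=> [_ [u0 uA _] _ hU]; have [_ [v0 vA _] _ hU0] := tutte_scaling.
move=> G; split=> v hv.
- by rewrite /G v0// u0// subrr.
- by rewrite /G vA// uA// subrr.
rewrite (_ : G = (fun w => 1 * W0 w + -1 * W w)); last first.
  by apply/funext => w; rewrite /G; ring.
by rewrite (lap_linear 1 (-1) W0 W) hU// hU0// !mulr0 addr0.
Qed.

Lemma orient_ge0 U W : tutte U W -> forall t, 0 <= orient U W t.
Proof.
move=> TUW.
(* On the segment from (U, W) to the scaling, the orientations are polynomials
   that are nonzero at its end, hence nonzero near its origin. *)
have [G0 GA hG] := tutte_dir_U TUW; have [H0 HB hH] := tutte_dir_W TUW.
set G := fun v => _ in G0 GA hG; set H := fun v => _ in H0 HB hH.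
pose Ue e v := U v + e * G v; pose We e v := W v + e * H v.
pose c1 t := (orient U H t + orient G W t).
have quad e t : orient (Ue e) (We e) t =
    orient U W t + e * c1 t + e ^+ 2 * orient G H t.
  by rewrite /orient /c1 /orient /Ue /We /cross; ring.
have nd : \forall e \near (0 : R)^'+, forall t, orient (Ue e) (We e) t != 0.
  apply: filter_forall => t.
  have : [|| orient U W t != 0, c1 t != 0 | orient G H t != 0].
    have := orient_scaling_neq0 t; apply: contraNT; rewrite !negb_or !negbK.
    have -> : orient U0 W0 t = orient U W t + c1 t + orient G H t.
      have -> : orient U0 W0 t = orient (Ue 1) (We 1) t.
        by congr (orient _ _ t); apply/funext => v; rewrite /Ue /We /G /H; ring.
      by rewrite quad; ring.
    by move=> /and3P[/eqP -> /eqP -> /eqP ->]; rewrite !addr0.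
  by move=> /near_right0_quadratic_neq0; apply: filterS => e; rewrite quad.
have TT : \forall e \near (0 : R)^'+, tutte (Ue e) (We e).
  have h1 := tutte_nearU TUW G0 GA hG; have h2 := tutte_nearW TUW H0 HB hH.
  apply: filterS (filterI h1 h2) => e [[mU _ hU _] [_ mW _ hW]].
  by split.
move=> t; apply: (@near_right0_quadratic_ge0 _ _ (c1 t) (orient G H t)).
apply: filterS (filterI nd TT) => e [nde Te].
by rewrite -quad ltW// nondegenerate_orient_gt0.
Qed.

(* [orient] is affine in each argument separately and nonnegative on an open
   set of boundary data, so that a zero propagates to the scaling map. *)
Lemma orient_gt0 U W : tutte U W -> forall t, 0 < orient U W t.
Proof.
move=> TUW t; rewrite lt_neqAle orient_ge0// andbT eq_sym.
apply: contraTneq (orient_scaling_neq0 t) => zero; rewrite negbK.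
pose G v := U0 v - U v.
have [G0 GA hG] : [/\ forall v, px v = 0 -> G v = 0,
    forall v, px v = A -> G v = 0 & forall v, inner A B v -> lap G v = 0].
  exact: tutte_dir_U TUW.
(* From a zero, small moves along [G] and along its opposite both keep the orientation nonnegative;
   being affine in the move, it has slope zero. *)
have zeroG : orient G W t = 0.
  have one (s : R) : s * s = 1 -> 0 <= s * orient G W t.
    move=> s1; have TN : \forall e \near (0 : R)^'+,
        tutte (fun v => U v + e * (s * G v)) W.
      apply: tutte_nearU => // v hv.
      - by rewrite G0// mulr0.
      - by rewrite GA// mulr0.
      - transitivity (s * lap G v); last by rewrite hG// mulr0.
        by rewrite /lap mulr_sumr; apply: eq_bigr => w _; ring.
    have [e e_gt0 /orient_ge0 /(_ t)] := near_right0_ex TN.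
    rewrite (_ : orient _ _ _ = orient U W t + e * (s * orient G W t)).
      by rewrite zero add0r pmulr_rge0.
    by rewrite /orient /cross; ring.
  have := one 1; have := one (-1); rewrite mulrNN mulr1 mul1r mulN1r oppr_ge0.
  by move=> /(_ erefl) h1 /(_ erefl) h2; apply/eqP; rewrite eq_le h1.
have zeroU : orient U0 W t = 0.
  have -> : orient U0 W t = orient U W t + orient G W t.
    by rewrite /orient /G /cross; ring.
  by rewrite zero zeroG addr0.
have TU0 : tutte U0 W.
  by have [mU _ hU _] := tutte_scaling; have [_ mW _ hW] := TUW.
pose H v := W0 v - W v.
have [H0 HB hH] : [/\ forall v, py v = 0 -> H v = 0,
    forall v, py v = B -> H v = 0 & forall v, inner A B v -> lap H v = 0].
  exact: tutte_dir_W TU0.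
have zeroH : orient U0 H t = 0.
  have one (s : R) : s * s = 1 -> 0 <= s * orient U0 H t.
    move=> s1; have TN : \forall e \near (0 : R)^'+,
        tutte U0 (fun v => W v + e * (s * H v)).
      apply: tutte_nearW => // v hv.
      - by rewrite H0// mulr0.
      - by rewrite HB// mulr0.
      - transitivity (s * lap H v); last by rewrite hH// mulr0.
        by rewrite /lap mulr_sumr; apply: eq_bigr => w _; ring.
    have [e e_gt0 /orient_ge0 /(_ t)] := near_right0_ex TN.
    rewrite (_ : orient _ _ _ = orient U0 W t + e * (s * orient U0 H t)).
      by rewrite zeroU add0r pmulr_rge0.
    by rewrite /orient /cross; ring.
  have := one 1; have := one (-1); rewrite mulrNN mulr1 mul1r mulN1r oppr_ge0.
  by move=> /(_ erefl) h1 /(_ erefl) h2; apply/eqP; rewrite eq_le h1.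
have -> : orient U0 W0 t = orient U0 W t + orient U0 H t.
  by rewrite /orient /H /cross; ring.
by rewrite zeroU zeroH addr0.
Qed.

End Embedding.

(** * The boundary map *)

Section SidePath.
Context {R : realType}.

Lemma side_path (P Q l : R) (X Y : R -> R) :
  0 < P -> 0 < Q -> 0 < l ->
  {within `[0, l], continuous X} -> {within `[0, l], continuous Y} ->
  (forall s, 0 <= s <= l -> 0 <= X s <= P /\ 0 <= Y s <= Q) ->
  (forall s, 0 <= s <= l -> [\/ X s = 0, X s = P, Y s = 0 | Y s = Q]) ->
  (forall s, 0 <= s <= l -> Y s = Q -> 0 < X s < P) ->
  (forall s r, 0 <= s <= l -> 0 <= r <= l -> X s = X r -> Y s = Y r -> s = r) ->
  X 0 = 0 -> Y 0 = 0 -> X l = P -> Y l = 0 ->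
  (forall s, 0 <= s <= l -> Y s = 0) /\
  (forall s r, 0 <= s -> r <= l -> s < r -> X s < X r).
Proof.
move=> P0 Q0 l0 cX cY rg bd top inj X0 Y0 Xl Yl.
(* On the boundary of the rectangle, [q] is positive on the open upper side and
   negative on the rest, upper corners excepted, so that the path cannot reach the
   upper side; on the other sides, [th] is the signed arc length from the
   origin. *)
pose q s := Y s * (X s * (P - X s)) - (Q - Y s).
pose th s := X s + P^-1 * (Y s * (2%:R * X s - P)).
have cth : {within `[0, l], continuous th}.
  move=> x; apply: cvgD; first exact: cX.
  apply: cvgM; first exact: cvg_cst.
  apply: cvgM; first exact: cY.
  apply: cvgB; last exact: cvg_cst.
  by apply: cvgM; [exact: cvg_cst|exact: cX].
have cq : {within `[0, l], continuous q}.
  move=> x; apply: cvgB.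
    apply: cvgM; first exact: cY.
    apply: cvgM; first exact: cX.
    by apply: cvgB; [exact: cvg_cst|exact: cX].
  by apply: cvgB; [exact: cvg_cst|exact: cY].
have q_neq0 s : 0 <= s <= l -> q s != 0.
  move=> hs; have [/andP[x0 xP] /andP[y0 yQ]] := rg s hs.
  have [e|yQ'] := eqVneq (Y s) Q.
    have /andP[a b] := top s hs e.
    by rewrite /q e subrr subr0 !mulf_neq0// gt_eqF// subr_gt0.
  have ltQ : 0 < Q - Y s by rewrite subr_gt0 lt_neqAle yQ'.
  have -> : q s = - (Q - Y s).
    by rewrite /q; case: (bd s hs) yQ' => -> //; rewrite ?eqxx// => _; ring.
  by rewrite oppr_eq0 gt_eqF.
have q_lt0 s : 0 <= s <= l -> q s < 0.
  move=> hs; have /andP[s0 sl] := hs; rewrite ltNge; apply/negP => qs.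
  have sub : `[0, s]%classic `<=` `[0, l]%classic.
    move=> x; rewrite /= !in_itv /= => /andP[-> xs]; exact: le_trans xs sl.
  have q0 : q 0 <= 0 by rewrite /q Y0 mul0r subr0 sub0r oppr_le0 ltW.
  have [|c cs qc] := @IVT R q 0 s 0 s0 (continuous_subspaceW sub cq).
    by rewrite ge_min le_max q0 qs orbT.
  have : 0 <= c <= l.
    by move: cs; rewrite in_itv /= => /andP[-> cs]; exact: le_trans cs sl.
  by move/q_neq0; rewrite qc eqxx.
have kind s : 0 <= s <= l -> [\/ Y s = 0 /\ th s = X s,
    X s = 0 /\ th s = - Y s | X s = P /\ th s = P + Y s].
  move=> hs; have nP : P != 0 by rewrite gt_eqF.
  have thE x : P^-1 * (x * (2%:R * P - P)) = x by field.
  rewrite /th; case: (bd s hs) => e.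
  - by constructor 2; rewrite e; split=> //; field.
  - by constructor 3; rewrite e thE.
  - by constructor 1; rewrite e mul0r mulr0 addr0.
  - have := q_lt0 s hs; have /andP[a b] := top s hs e.
    rewrite /q e subrr subr0 ltNge mulr_ge0 ?ltW//.
    by rewrite mulr_gt0// subr_gt0.
(* The left, lower and right sides give values of [th] below 0, between 0 and [P], and above [P];
   equal values therefore come from equal points. *)
have th_inj : {in `[0, l] &, injective th}.
  move=> s r; rewrite !in_itv /= => hs hr e; apply: inj => //;
  have [/andP[x0 xP] /andP[y0 yQ]] := rg s hs;
  have [/andP[x0' xP'] /andP[y0' yQ']] := rg r hr;
  case: (kind s hs) => -[a b]; case: (kind r hr) => -[a' b'];
  rewrite b b' in e; clear -a a' e x0 xP x0' xP' y0 y0' P0; lra.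
have th0 : th 0 = 0 by rewrite /th X0 Y0 !mul0r mulr0 addr0.
have thl : th l = P by rewrite /th Xl Yl !mul0r mulr0 addr0.
(* A continuous injective function on an interval is monotone, so [th] stays between its end values
   0 and [P], which leaves only the lower side. *)
have th_mono : {in `[0, l] &, {mono th : x y / x <= y}}.
  by apply: segment_continuous_inj_le => //; rewrite th0 thl ltW.
have i0 : (0 : R) \in `[0, l] by rewrite in_itv /= lexx ltW.
have il : l \in `[0, l] by rewrite in_itv /= lexx ltW.
have thr s : 0 <= s <= l -> 0 <= th s <= P.
  move=> hs; have is' : s \in `[0, l] by rewrite in_itv.
  by rewrite -th0 -thl !th_mono.
have Y00 s : 0 <= s <= l -> Y s = 0.
  move=> hs; have [_ /andP[y0 _]] := rg s hs; have /andP[t0 tP] := thr s hs.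
  by case: (kind s hs) => -[// a b]; rewrite b in t0 tP; lra.
have thX s : 0 <= s <= l -> th s = X s.
  by move=> hs; rewrite /th Y00// mul0r mulr0 addr0.
split=> // s r s0 rl sr.
have hs : 0 <= s <= l by rewrite s0 (le_trans (ltW sr)).
have hr : 0 <= r <= l by rewrite rl (le_trans s0 (ltW sr)).
by rewrite -!thX// (leW_mono_in th_mono)// in_itv.
Qed.

End SidePath.

Section RectangleFrontier.
Context {R : realType} (A B : R).
Hypotheses (A_gt0 : 0 < A) (B_gt0 : 0 < B).

Lemma rect_in_box x y : rect A B (pt x y) <-> in_box A B x y.
Proof.
by rewrite /rect /= !mxE /=; split=> [[h1 h2]|/andP[]//]; apply/andP.
Qed.

Lemma pt_coord (p : plane R) : pt (p ord0 ord0) (p ord_max ord0) = p.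
Proof. by apply: plane_eqP; rewrite !mxE. Qed.

Lemma continuous_coord (i : 'I_2) : continuous (fun p : plane R => p i ord0).
Proof. exact: coord_continuous. Qed.

Lemma closed_rect : closed (rect A B).
Proof.
have cl (i : 'I_2) (a b : R) : closed [set p : plane R | a <= p i ord0 <= b].
  rewrite (_ : [set p | _] = (fun p : plane R => p i ord0) @^-1` [set x | a <= x]
    `&` (fun p : plane R => p i ord0) @^-1` [set x | x <= b]).
    by apply: closedI; apply: preimage_closed; (try exact: closed_ge);
      (try exact: closed_le) => p _; exact: continuous_coord.
  by apply/seteqP; split=> p /=; [move=> /andP[]|move=> [-> ->]].
exact: (closedI (cl ord0 0 A) (cl ord_max 0 B)).
Qed.

Lemma interior_rect_strict (p : plane R) :
  0 < p ord0 ord0 < A -> 0 < p ord_max ord0 < B -> interior (rect A B) p.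
Proof.
move=> /andP[x0 xA] /andP[y0 yB]; rewrite /interior /=.
have near_coord (i : 'I_2) (P : set R) : nbhs (p i ord0) P ->
  nbhs p [set q : plane R | P (q i ord0)] by exact: continuous_coord.
have h1 := near_coord ord0 _ (lt_nbhsr x0).
have h2 := near_coord ord0 _ (lt_nbhsl xA).
have h3 := near_coord ord_max _ (lt_nbhsr y0).
have h4 := near_coord ord_max _ (lt_nbhsl yB).
apply: filterS (filterI (filterI h1 h2) (filterI h3 h4)) => q [[q1 q2] [q3 q4]].
by split; apply/andP; split; exact: ltW.
Qed.

Lemma interior_rect_coord (p : plane R) : interior (rect A B) p ->
  0 < p ord0 ord0 < A /\ 0 < p ord_max ord0 < B.
Proof.
rewrite /interior /= => /nbhs_ballP[e /= e_gt0 sub].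
have he : 0 < e / 2%:R by rewrite divr_gt0.
have lt_e : e / 2%:R < e by rewrite ltr_pdivrMr// mulr_natr mulr2n ltrDl.
have in_ball (dx dy : R) : `|dx| < e -> `|dy| < e ->
    rect A B (pt (p ord0 ord0 + dx) (p ord_max ord0 + dy)).
  move=> hx hy; apply: sub; split=> // i j; rewrite (ord1 j) !mxE.
  case: (ord2P i) => ->; rewrite /ball /= opprD addrA subrr sub0r normrN//.
have e0 : `|0 : R| < e by rewrite normr0.
have ep : `|e / 2%:R| < e by rewrite gtr0_norm.
have en : `|- (e / 2%:R)| < e by rewrite normrN gtr0_norm.
have /rect_in_box/andP[/andP[a1 _] _] := in_ball _ _ en e0.
have /rect_in_box/andP[/andP[_ a2] _] := in_ball _ _ ep e0.
have /rect_in_box/andP[_ /andP[b1 _]] := in_ball _ _ e0 en.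
have /rect_in_box/andP[_ /andP[_ b2]] := in_ball _ _ e0 ep.
by split; apply/andP; split; lra.
Qed.

Lemma frontier_rectP x y : frontier (rect A B) (pt x y) <->
  in_box A B x y /\ [\/ x = 0, x = A, y = 0 | y = B].
Proof.
rewrite /frontier -(closure_id _).1; last exact: closed_rect.
split=> [[/rect_in_box h nint]|[h bd]].
  split=> //; have /andP[/andP[x0 xA] /andP[y0 yB]] := h.
  have [->|x0'] := eqVneq x 0; first by constructor 1.
  have [->|xA'] := eqVneq x A; first by constructor 2.
  have [->|y0'] := eqVneq y 0; first by constructor 3.
  have [->|yB'] := eqVneq y B; first by constructor 4.
  case: nint; apply: interior_rect_strict; rewrite !mxE /= !lt_neqAle.
    by rewrite x0 xA xA' eq_sym x0'.
  by rewrite y0 yB yB' eq_sym y0'.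
split; first exact/rect_in_box.
move=> /interior_rect_coord; rewrite !mxE /= => -[/andP[x0 xA] /andP[y0 yB]].
by case: bd => e; move: x0 xA y0 yB; rewrite e ltxx.
Qed.

End RectangleFrontier.

Section BoundaryMap.
Context {R : realType} (d : mapping_data R).
Hypothesis hd : admissible_data d.
Let A := da d.
Let B := db d.
Let L := dw d * da d.

Lemma data_gt0 : [/\ 0 < A, 0 < B & 0 < L].
Proof. by have [[a b w] _ _ _ _] := hd; split=> //; rewrite mulr_gt0. Qed.

Lemma frontier_dom1 x y : frontier (dom1 d) (pt x y) <->
  in_box A B x y /\ [\/ x = 0, x = A, y = 0 | y = B].
Proof. by have [A0 B0 _] := data_gt0; exact: frontier_rectP. Qed.

Lemma frontier_dom2 x y : frontier (dom2 d) (pt x y) <->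
  in_box L B x y /\ [\/ x = 0, x = L, y = 0 | y = B].
Proof. by have [_ B0 L0] := data_gt0; exact: frontier_rectP. Qed.

Lemma bdmap_frontier x y : in_box A B x y -> [\/ x = 0, x = A, y = 0 | y = B] ->
  let p := bdmap d (pt x y) in
  in_box L B (p ord0 ord0) (p ord_max ord0) /\
  [\/ p ord0 ord0 = 0, p ord0 ord0 = L, p ord_max ord0 = 0 | p ord_max ord0 = B].
Proof.
move=> h bd p.
have [_ _ _ _ [[g_sub _ _] _ _]] := hd.
have : frontier (dom2 d) p by apply: g_sub; exact/frontier_dom1.
by rewrite -{1}(pt_coord p) => /frontier_dom2.
Qed.

Lemma bdmap_inj x y x' y' : in_box A B x y -> [\/ x = 0, x = A, y = 0 | y = B] ->
  in_box A B x' y' -> [\/ x' = 0, x' = A, y' = 0 | y' = B] ->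
  bdmap d (pt x y) ord0 ord0 = bdmap d (pt x' y') ord0 ord0 ->
  bdmap d (pt x y) ord_max ord0 = bdmap d (pt x' y') ord_max ord0 ->
  x = x' /\ y = y'.
Proof.
move=> h bd h' bd' ex ey.
have [_ _ _ _ [[_ g_inj _] _ _]] := hd.
have fr : pt x y \in frontier (dom1 d) by rewrite inE; apply/frontier_dom1.
have fr' : pt x' y' \in frontier (dom1 d) by rewrite inE; apply/frontier_dom1.
have /matrixP e := g_inj _ _ fr fr' (plane_eqP ex ey).
by have := e ord0 ord0; have := e ord_max ord0; rewrite !mxE.
Qed.

(** [bdmap] is continuous on the frontier only, while [gam] may leave it outside [[0, l]]; hence the
    restricted form of continuity. *)
Lemma bdmap_path (gam : R -> plane R) (l : R) (i : 'I_2) :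
  continuous gam -> (forall s, 0 <= s <= l -> frontier (dom1 d) (gam s)) ->
  {within `[0, l], continuous (fun s => bdmap d (gam s) i ord0)}.
Proof.
move=> cg fr; have [_ _ _ _ [_ cont _]] := hd.
move/subspace_continuousP: cont => cont.
apply/subspace_continuousP => s; rewrite /= in_itv /= => hs.
have gs := fr s hs; have {}cont := cont _ gs.
apply: (@cvg_comp _ _ _ (fun s => bdmap d (gam s)) (fun p : plane R => p i ord0) _
  (nbhs (bdmap d (gam s)))); last exact: continuous_coord.
move=> N /cont; rewrite /within /= => nN.
have : \forall r \near s, frontier (dom1 d) (gam r) -> N (bdmap d (gam r)).
  exact: (cg s) nN.
apply: filterS => r h; rewrite in_itv /= => hr; apply: h; exact: fr.
Qed.

Lemma continuous_pt_l (y : R) : continuous (fun x => pt x y).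
Proof.
move=> x; apply/cvg_ballP => e e_gt0; near=> z.
split=> // i j; rewrite !mxE; case: ifP => _; last exact: ballxx.
by near: z; apply: (@nbhsx_ballx _ _ x e).
Unshelve. all: by end_near. Qed.

Lemma continuous_pt_r (x : R) : continuous (fun y => pt x y).
Proof.
move=> y; apply/cvg_ballP => e e_gt0; near=> z.
split=> // i j; rewrite !mxE; case: ifP => _; first exact: ballxx.
by near: z; apply: (@nbhsx_ballx _ _ y e).
Unshelve. all: by end_near. Qed.

End BoundaryMap.

(** * Monotonicity of the boundary map on the four sides *)

Section BoundaryMapSides.
Context {R : realType} (d : mapping_data R).
Hypothesis hd : admissible_data d.
Let A := da d.
Let B := db d.
Let L := dw d * da d.
Let g0 x y := bdmap d (pt x y) ord0 ord0.
Let g1 x y := bdmap d (pt x y) ord_max ord0.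

Lemma bdmap_corners :
  [/\ g0 0 0 = 0 /\ g1 0 0 = 0, g0 A 0 = L /\ g1 A 0 = 0,
      g0 0 B = 0 /\ g1 0 B = B & g0 A B = L /\ g1 A B = B].
Proof.
have [_ _ _ _ [_ _ [e1 e2 e3 e4]]] := hd.
by rewrite /g0 /g1 e1 e2 e3 e4 !mxE.
Qed.

(** The upper corners of the target are already images of the upper corners, so by injectivity the
    image of the lower side avoids them, as [side_path] demands. *)
Lemma bdmap_bottom :
  (forall x, 0 <= x <= A -> g1 x 0 = 0) /\
  (forall x z, 0 <= x -> z <= A -> x < z -> g0 x 0 < g0 z 0).
Proof.
have [A0 B0 L0] : [/\ 0 < A, 0 < B & 0 < L] := data_gt0 hd.
have [[c1 c2] [c3 c4] [c5 c6] [c7 c8]] := bdmap_corners.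
have side x : 0 <= x <= A ->
    in_box A B x 0 /\ [\/ x = 0, x = A, (0 : R) = 0 | (0 : R) = B].
  by move=> hx; split; [rewrite /in_box hx lexx ltW|constructor 3].
have cont i := bdmap_path hd (l := A) (i := i) (@continuous_pt_l R 0)
  (fun s hs => iffRL (frontier_dom1 hd s 0) (side s hs)).
have im x : 0 <= x <= A -> in_box L B (g0 x 0) (g1 x 0) /\
    [\/ g0 x 0 = 0, g0 x 0 = L, g1 x 0 = 0 | g1 x 0 = B].
  by move=> /side[h b]; have := bdmap_frontier hd h b.
have c3D : in_box A B 0 B by rewrite /in_box !lexx !ltW.
have c4D : in_box A B A B by rewrite /in_box !lexx !ltW.
apply: (@side_path R L B A (g0 ^~ 0) (g1 ^~ 0)) => //.
- exact: cont.
- exact: cont.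
- by move=> x /im[/andP].
- by move=> x /im[].
- move=> x hx e; have [h b] := side x hx; have [/andP[/andP[x0 xL] _] _] := im x hx.
  rewrite !lt_neqAle x0 xL !andbT eq_sym; apply/andP; split; apply/eqP => e'.
    have [|_ e2] := bdmap_inj hd h b c3D _ (etrans e' (esym c5)) (etrans e (esym c6)).
      by constructor 1.
    by rewrite e2 ltxx in B0.
  have [|_ e2] := bdmap_inj hd h b c4D _ (etrans e' (esym c7)) (etrans e (esym c8)).
    by constructor 2.
  by rewrite e2 ltxx in B0.
- move=> x z /side[h b] /side[h' b'] e1 e2.
  by have [] := bdmap_inj hd h b h' b' e1 e2.
Qed.

(** The other sides use the same path argument after reflecting a coordinate of the image,
    exchanging the coordinates, or both. *)
Lemma bdmap_top :
  (forall x, 0 <= x <= A -> g1 x B = B) /\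
  (forall x z, 0 <= x -> z <= A -> x < z -> g0 x B < g0 z B).
Proof.
have [A0 B0 L0] : [/\ 0 < A, 0 < B & 0 < L] := data_gt0 hd.
have [[c1 c2] [c3 c4] [c5 c6] [c7 c8]] := bdmap_corners.
have side x : 0 <= x <= A ->
    in_box A B x B /\ [\/ x = 0, x = A, B = 0 | B = B].
  by move=> hx; split; [rewrite /in_box hx lexx ltW|constructor 4].
have cont i := bdmap_path hd (l := A) (i := i) (@continuous_pt_l R B)
  (fun s hs => iffRL (frontier_dom1 hd s B) (side s hs)).
have im x : 0 <= x <= A -> in_box L B (g0 x B) (g1 x B) /\
    [\/ g0 x B = 0, g0 x B = L, g1 x B = 0 | g1 x B = B].
  by move=> /side[h b]; have := bdmap_frontier hd h b.
have c1D : in_box A B 0 0 by rewrite /in_box !lexx !ltW.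
have c2D : in_box A B A 0 by rewrite /in_box !lexx !ltW.
have [||||||||||Y0 Xm] :=
  @side_path R L B A (g0 ^~ B) (fun x => B - g1 x B) L0 B0 A0.
- exact: cont.
- by move=> x; apply: cvgB; [exact: cvg_cst|exact: cont].
- move=> x /im[/andP[h /andP[y0 yB]] _]; split=> //.
  by rewrite subr_ge0 yB lerBlDr lerDl.
- move=> x /im[_ []] e.
  + by constructor 1.
  + by constructor 2.
  + by constructor 4; rewrite e subr0.
  + by constructor 3; rewrite e subrr.
- move=> x hx e0; have e : g1 x B = 0 by lra.
  have [h b] := side x hx; have [/andP[/andP[x0 xL] _] _] := im x hx.
  rewrite !lt_neqAle x0 xL !andbT eq_sym; apply/andP; split; apply/eqP => e'.
    have [|_ e2] := bdmap_inj hd h b c1D _ (etrans e' (esym c1)) (etrans e (esym c2)).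
      by constructor 1.
    by rewrite e2 ltxx in B0.
  have [|_ e2] := bdmap_inj hd h b c2D _ (etrans e' (esym c3)) (etrans e (esym c4)).
    by constructor 2.
  by rewrite e2 ltxx in B0.
- move=> x z /side[h b] /side[h' b'] e1 /(addrI B)/oppr_inj e2.
  by have [] := bdmap_inj hd h b h' b' e1 e2.
- by [].
- by rewrite c6 subrr.
- by [].
- by rewrite c8 subrr.
split=> // x hx; apply/eqP; rewrite eq_sym -subr_eq0; apply/eqP; exact: Y0.
Qed.

Lemma bdmap_left :
  (forall y, 0 <= y <= B -> g0 0 y = 0) /\
  (forall y z, 0 <= y -> z <= B -> y < z -> g1 0 y < g1 0 z).
Proof.
have [A0 B0 L0] : [/\ 0 < A, 0 < B & 0 < L] := data_gt0 hd.
have [[c1 c2] [c3 c4] [c5 c6] [c7 c8]] := bdmap_corners.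
have side y : 0 <= y <= B ->
    in_box A B 0 y /\ [\/ (0 : R) = 0, (0 : R) = A, y = 0 | y = B].
  by move=> hy; split; [rewrite /in_box hy lexx ltW|constructor 1].
have cont i := bdmap_path hd (l := B) (i := i) (@continuous_pt_r R 0)
  (fun s hs => iffRL (frontier_dom1 hd 0 s) (side s hs)).
have im y : 0 <= y <= B -> in_box L B (g0 0 y) (g1 0 y) /\
    [\/ g0 0 y = 0, g0 0 y = L, g1 0 y = 0 | g1 0 y = B].
  by move=> /side[h b]; have := bdmap_frontier hd h b.
have c2D : in_box A B A 0 by rewrite /in_box !lexx !ltW.
have c4D : in_box A B A B by rewrite /in_box !lexx !ltW.
apply: (@side_path R B L B (g1 0) (g0 0)) => //.
- exact: cont.
- exact: cont.
- by move=> y /im[/andP[]].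
- move=> y /im[_ []] e.
  + by constructor 3.
  + by constructor 4.
  + by constructor 1.
  + by constructor 2.
- move=> y hy e; have [h b] := side y hy; have [/andP[_ /andP[y0 yB]] _] := im y hy.
  rewrite !lt_neqAle y0 yB !andbT eq_sym; apply/andP; split; apply/eqP => e'.
    have [|e2 _] := bdmap_inj hd h b c2D _ (etrans e (esym c3)) (etrans e' (esym c4)).
      by constructor 2.
    by rewrite e2 ltxx in A0.
  have [|e2 _] := bdmap_inj hd h b c4D _ (etrans e (esym c7)) (etrans e' (esym c8)).
    by constructor 2.
  by rewrite e2 ltxx in A0.
- move=> y z /side[h b] /side[h' b'] e1 e2.
  by have [] := bdmap_inj hd h b h' b' e2 e1.
Qed.

Lemma bdmap_right :
  (forall y, 0 <= y <= B -> g0 A y = L) /\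
  (forall y z, 0 <= y -> z <= B -> y < z -> g1 A y < g1 A z).
Proof.
have [A0 B0 L0] : [/\ 0 < A, 0 < B & 0 < L] := data_gt0 hd.
have [[c1 c2] [c3 c4] [c5 c6] [c7 c8]] := bdmap_corners.
have side y : 0 <= y <= B ->
    in_box A B A y /\ [\/ A = 0, A = A, y = 0 | y = B].
  by move=> hy; split; [rewrite /in_box hy lexx ltW|constructor 2].
have cont i := bdmap_path hd (l := B) (i := i) (@continuous_pt_r R A)
  (fun s hs => iffRL (frontier_dom1 hd A s) (side s hs)).
have im y : 0 <= y <= B -> in_box L B (g0 A y) (g1 A y) /\
    [\/ g0 A y = 0, g0 A y = L, g1 A y = 0 | g1 A y = B].
  by move=> /side[h b]; have := bdmap_frontier hd h b.
have c1D : in_box A B 0 0 by rewrite /in_box !lexx !ltW.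
have c3D : in_box A B 0 B by rewrite /in_box !lexx !ltW.
have [||||||||||Y0 Xm] :=
  @side_path R B L B (g1 A) (fun y => L - g0 A y) B0 L0 B0.
- exact: cont.
- by move=> y; apply: cvgB; [exact: cvg_cst|exact: cont].
- move=> y /im[/andP[/andP[x0 xL] h] _]; split=> //.
  by rewrite subr_ge0 xL lerBlDr lerDl.
- move=> y /im[_ []] e.
  + by constructor 4; rewrite e subr0.
  + by constructor 3; rewrite e subrr.
  + by constructor 1.
  + by constructor 2.
- move=> y hy e0; have e : g0 A y = 0 by lra.
  have [h b] := side y hy; have [/andP[_ /andP[y0 yB]] _] := im y hy.
  rewrite !lt_neqAle y0 yB !andbT eq_sym; apply/andP; split; apply/eqP => e'.
    have [|e2 _] := bdmap_inj hd h b c1D _ (etrans e (esym c1)) (etrans e' (esym c2)).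
      by constructor 1.
    by rewrite e2 ltxx in A0.
  have [|e2 _] := bdmap_inj hd h b c3D _ (etrans e (esym c5)) (etrans e' (esym c6)).
    by constructor 1.
  by rewrite e2 ltxx in A0.
- move=> y z /side[h b] /side[h' b'] e1 /(addrI L)/oppr_inj e2.
  by have [] := bdmap_inj hd h b h' b' e2 e1.
- by [].
- by rewrite c3 subrr.
- by [].
- by rewrite c7 subrr.
split=> // y hy; apply/eqP; rewrite eq_sym -subr_eq0; apply/eqP; exact: Y0.
Qed.

Variable M : triangulation R.
Hypothesis cover : forall x y, in_box A B x y <-> exists t : 'I_(nf M), in_tri t x y.

Lemma vBE (v : 'I_(nv M)) : vB d M v <-> ~~ inner A B v.
Proof.
have vD := vertex_in_box cover v; have /andP[/andP[x0 xA] /andP[y0 yB]] := vD.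
rewrite /vB /= -(pt_coord (vert M v)); split=> [/(frontier_dom1 hd)[_]|bd].
  by rewrite -/(px v) -/(py v) /inner; case=> ->; rewrite ?ltxx ?andbF.
apply/(frontier_dom1 hd); split; first exact: vD.
rewrite -/(px v) -/(py v).
have [->|x0'] := eqVneq (px v) 0; first by constructor 1.
have [->|xA'] := eqVneq (px v) A; first by constructor 2.
have [->|y0'] := eqVneq (py v) 0; first by constructor 3.
have [->|yB'] := eqVneq (py v) B; first by constructor 4.
case/negP: bd; rewrite /inner !lt_neqAle x0 xA y0 yB xA' yB' ![0 == _]eq_sym.
by rewrite x0' y0'.
Qed.

Lemma bdmap_bd_mono (u : 'I_(nv M) -> plane R) :
  (forall v, vB d M v -> u v = bdmap d (vert M v)) ->
  bd_mono px py A B L (fun v => u v ord0 ord0) /\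
  bd_mono py px B A B (fun v => u v ord_max ord0).
Proof.
move=> ub; have [A0 B0 L0] : [/\ 0 < A, 0 < B & 0 < L] := data_gt0 hd.
have uE v x y : px v = x -> py v = y -> ~~ inner A B v ->
    u v ord0 ord0 = g0 x y /\ u v ord_max ord0 = g1 x y.
  by move=> <- <- /vBE/ub ->; rewrite /g0 /g1 /px /py pt_coord.
have rx (v : 'I_(nv M)) : 0 <= px v <= A by have /andP[] := vertex_in_box cover v.
have ry (v : 'I_(nv M)) : 0 <= py v <= B by have /andP[] := vertex_in_box cover v.
have [b0 bm] := bdmap_bottom; have [t0 tm] := bdmap_top.
have [l0 lm] := bdmap_left; have [r0 rm] := bdmap_right.
have bx0 (v : 'I_(nv M)) : px v = 0 -> ~~ inner A B v.
  by move=> e; rewrite /inner e ltxx.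
have bxA (v : 'I_(nv M)) : px v = A -> ~~ inner A B v.
  by move=> e; rewrite /inner e ltxx andbF.
have by0 (v : 'I_(nv M)) : py v = 0 -> ~~ inner A B v.
  by move=> e; rewrite /inner e ltxx andbF.
have byB (v : 'I_(nv M)) : py v = B -> ~~ inner A B v.
  by move=> e; rewrite /inner e ltxx !andbF.
split; split.
- by move=> v e; have [-> _] := uE v _ _ e erefl (bx0 v e); exact: l0.
- by move=> v e; have [-> _] := uE v _ _ e erefl (bxA v e); exact: r0.
- move=> v w e hv lt; have /andP[v0 _] := rx v; have /andP[_ wA] := rx w.
  case: hv => hv; have hw := hv; rewrite e in hw.
    have [-> _] := uE v _ _ erefl hv (by0 v hv).
    by have [-> _] := uE w _ _ erefl hw (by0 w hw); exact: bm.
  have [-> _] := uE v _ _ erefl hv (byB v hv).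
  by have [-> _] := uE w _ _ erefl hw (byB w hw); exact: tm.
- by move=> v e; have [_ ->] := uE v _ _ erefl e (by0 v e); exact: b0.
- by move=> v e; have [_ ->] := uE v _ _ erefl e (byB v e); exact: t0.
- move=> v w e hv lt; have /andP[v0 _] := ry v; have /andP[_ wA] := ry w.
  case: hv => hv; have hw := hv; rewrite e in hw.
    have [_ ->] := uE v _ _ hv erefl (bx0 v hv).
    by have [_ ->] := uE w _ _ hw erefl (bx0 w hw); exact: lm.
  have [_ ->] := uE v _ _ hv erefl (bxA v hv).
  by have [_ ->] := uE w _ _ hw erefl (bxA w hw); exact: rm.
Qed.

End BoundaryMapSides.

(** * Gradients and the derivative of the energy *)

Section Gradient.
Context {R : realType} (M : triangulation R).
Implicit Types (u : 'I_(nv M) -> plane R) (t : 'I_(nf M)) (v : 'I_(nv M)).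

Lemma grad_edge_mx u t : grad u t *m edge_mx (fun p => vert M (tri M t p)) =
  edge_mx (fun p => u (tri M t p)).
Proof.
by rewrite /grad mulmxKV// unitmxE unitfE det_edge_mx; exact: cross_tri_neq0.
Qed.

Lemma det_grad u t : \det (grad u t) *
    cross px py (tri M t ord0) (tri M t o1) (tri M t o2) =
  cross (fun v => u v ord0 ord0) (fun v => u v ord_max ord0)
    (tri M t ord0) (tri M t o1) (tri M t o2).
Proof.
by have := congr1 determinant (grad_edge_mx u t); rewrite det_mulmx !det_edge_mx.
Qed.

Lemma det_grad_gt0 u t : (0 < \det (grad u t)) =
  (0 < orient (fun v => u v ord0 ord0) (fun v => u v ord_max ord0) t).
Proof.
have c0 := cross_tri_neq0 t.
rewrite /orient -det_grad -mulrA pmulr_lgt0//.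
by rewrite -expr2 exprn_even_gt0.
Qed.

Lemma grad_coord u t (c : 'I_2) :
  let D := cross px py (tri M t ord0) (tri M t o1) (tri M t o2) in
  grad u t c ord0 =
    cross (fun v => u v c ord0) py (tri M t ord0) (tri M t o1) (tri M t o2) / D /\
  grad u t c ord_max =
    cross px (fun v => u v c ord0) (tri M t ord0) (tri M t o1) (tri M t o2) / D.
Proof.
move=> D; have D0 : D != 0 := cross_tri_neq0 t.
move: (grad_edge_mx u t); move: (grad u t) => G /matrixP e.
have := e c ord0; have := e c ord_max; rewrite !mxE !big_ord_recl !big_ord0 !mxE.
rewrite (_ : lift ord0 ord0 = ord_max :> 'I_2); last exact: val_inj.
rewrite !addr0 => e2 e1.
split; apply: (mulIf D0); rewrite divfK//.
  by rewrite /cross -e1 -e2 /D /cross /px /py; ring.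
by rewrite /cross -e1 -e2 /D /cross /px /py; ring.
Qed.

Definition mxdot (F G : 'M[R]_2) : R := \sum_i \sum_j F i j * G i j.

Lemma frob2D (F G : 'M[R]_2) (h : R) :
  frob2 (F + h *: G) = frob2 F + h * (2%:R * mxdot F G) + h ^+ 2 * frob2 G.
Proof.
rewrite /frob2 /mxdot !big_ord_recl !big_ord0 !mxE; ring.
Qed.

(** Vertex values of the hat function at [v], times the vector [e]. *)
Definition point_mass v (e : plane R) : 'I_(nv M) -> plane R :=
  fun w => if w == v then e else 0.

Lemma grad_set_vval u v (h : R) (e : plane R) t :
  grad (set_vval u v (h *: e + u v)) t = grad u t + h *: grad (point_mass v e) t.
Proof.
rewrite /grad scalemxAl -mulmxDl; congr (_ *m _).
apply/matrixP => c k; rewrite !mxE /set_vval /point_mass.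
do 2!case: ifP => [/eqP ->|_]; rewrite ?mxE ?mulr0 ?subrr ?addr0 ?sub0r ?subr0;
  ring.
Qed.

(** The cotangent formula on one triangle: the gradient of the hat function is normal to the side
    facing [v], and pairing with it produces the cotangents at the other two vertices. *)
Lemma mxdot_point_mass u t v (c : 'I_2) :
  mxdot (grad u t) (grad (point_mass v (delta_mx c ord0)) t) * area t =
  - 2%:R^-1 * \sum_w \sum_(k | tri3 t v w k)
    cot_weight k v w * (u w c ord0 - u v c ord0).
Proof.
set dl := delta_mx c ord0.
pose U w := u w c ord0; pose Dl w := (point_mass v dl) w c ord0.
have DlE w : Dl w = (w == v)%:R.
  by rewrite /Dl /point_mass /dl; case: eqP => _; rewrite !mxE ?eqxx.
have other i : i != c -> forall j, grad (point_mass v dl) t i j = 0.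
  move=> ic j; have z w : point_mass v dl w i ord0 = 0.
    by rewrite /point_mass /dl; case: eqP => _; rewrite !mxE // (negPf ic).
  have [e1 e2] := grad_coord (point_mass v dl) t i.
  case: (ord2P j) => ->; [rewrite e1|rewrite e2];
    by rewrite /cross !z !subrr !(mul0r, mulr0) subrr mul0r.
have -> : mxdot (grad u t) (grad (point_mass v dl) t) =
    \sum_j grad u t c j * grad (point_mass v dl) t c j.
  rewrite /mxdot (bigD1 c)//= [X in _ + X]big1 ?addr0// => i ic.
  by apply: big1 => j _; rewrite other ?mulr0.
rewrite big_ord_recl big_ord1.
rewrite (_ : lift ord0 ord0 = ord_max :> 'I_2); last exact: val_inj.
have [-> ->] := grad_coord u t c; have [-> ->] := grad_coord (point_mass v dl) t c.
rewrite -/U -/Dl /area det_edge_mx -/px -/py.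
(* The computation lists the triangle from [v] on; the stored order differs from such a list by a
   rotation. *)
have key i j : tri3 t v i j ->
    (cross U py v i j / cross px py v i j * (cross Dl py v i j / cross px py v i j) +
     cross px U v i j / cross px py v i j * (cross px Dl v i j / cross px py v i j)) *
    (`|cross px py v i j| / 2%:R) =
    - 2%:R^-1 * \sum_w \sum_(k | tri3 t v w k) cot_weight k v w * (U w - U v).
  move=> h; rewrite (sum_star _ h) /cot_weight (cross_swap _ _ v i j) normrN.
  have [vi vj] : v != i /\ v != j.
    by have /and5P[_ _ _ -> /andP[_ ->]] := h.
  have D0 := cross_tri3_neq0 h.
  have n0 : `|cross px py v i j| != 0 by rewrite normr_eq0.
  have e2 : cross px py v i j ^+ 2 = `|cross px py v i j| ^+ 2.
    by rewrite real_normK ?num_real.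
  transitivity ((cross U py v i j * cross Dl py v i j +
      cross px U v i j * cross px Dl v i j) / cross px py v i j ^+ 2 *
      (`|cross px py v i j| / 2%:R)); first by field.
  rewrite e2.
  transitivity ((cross U py v i j * cross Dl py v i j +
      cross px U v i j * cross px Dl v i j) / `|cross px py v i j| / 2%:R).
    by field.
  move: n0; set n := `|_|; move=> n0.
  rewrite /cross !DlE eqxx ![_ == v]eq_sym (negPf vi) (negPf vj) /=.
  rewrite mulr1n mulr0n /apex_dot.
  by field.
have [tv|tv] := boolP (v \in tverts t); last first.
  rewrite sum_star_out// mulr0.
  have z p : Dl (tri M t p) = 0.
    rewrite DlE; case: eqP => // e; case/negP: tv.
    by rewrite -e; exact: imset_f.
  by rewrite /cross !z !subrr !(mul0r, mulr0) !subrr !mul0r !mulr0 addr0 mul0r.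
case/imsetP: tv => p _ ev; have h0 := tri3_tri t.
case: (ord3P p) => e; rewrite e in ev; move: key; rewrite ev => key.
- exact: key h0.
- by rewrite -!(cross_rot _ _ (tri M t ord0) (tri M t o1)); apply: key; exact: tri3_rot.
- rewrite !(cross_rot _ _ (tri M t o2) (tri M t ord0) (tri M t o1)).
  by apply: key; do 2!apply: tri3_rot.
Qed.

End Gradient.

Section Stationary.
Context {R : realType} (d : mapping_data R) (M : triangulation R).
Implicit Types (u : 'I_(nv M) -> plane R) (v : 'I_(nv M)).

Lemma energy_set_vval u v (c : 'I_2) (h : R) :
  energy d (set_vval u v (h *: delta_mx c ord0 + u v)) =
  energy d u + h * (- 2%:R^-1 * lap (fun w => u w c ord0) v) +
  h ^+ 2 * (2%:R^-1 * \sum_t frob2 (grad (point_mass v (delta_mx c ord0)) t) * area t).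
Proof.
rewrite /energy lapE !mulr_sumr.
rewrite -!addrA; congr (_ + _); rewrite -!big_split /=; apply: eq_bigr => t _.
rewrite -mxdot_point_mass grad_set_vval frob2D; by field.
Qed.

(** The energy is quadratic in the displacement of one vertex value, so its difference quotient is
    affine in [h] and tends to the linear coefficient, minus one half of the Laplacian. *)
Lemma stationary_lap u v (c : 'I_2) : energy_stationary d u v ->
  lap (fun w => u w c ord0) v = 0.
Proof.
move=> /(_ c) st.
pose F y := energy d (set_vval u v y).
pose b := - 2%:R^-1 * lap (fun w => u w c ord0) v.
pose a := 2%:R^-1 * \sum_t frob2 (grad (point_mass v (delta_mx c ord0)) t) * area t.
have dF : derivable F (u v) (delta_mx c ord0) by case: st.
have dF0 : 'D_(delta_mx c ord0) F (u v) = 0 by case: st.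
have lim0 : (fun h : R => h^-1 *: ((F \o shift (u v)) (h *: delta_mx c ord0) - F (u v)))
    @ 0^' --> 'D_(delta_mx c ord0) F (u v) by exact: dF.
rewrite dF0 in lim0.
have F0 : F (u v) = energy d u.
  rewrite /F; congr (energy d _); apply/funext => w; rewrite /set_vval.
  by case: eqP => // ->.
have lim1 : (fun h : R => b + h * a) @ 0^' --> (0 : R).
  apply: cvg_trans lim0; apply: near_eq_cvg; near=> h.
  have h0 : h != 0 by near: h; exact: nbhs_dnbhs_neq.
  rewrite /= F0 /F energy_set_vval -/a -/b.
  rewrite (_ : _ - _ = h * (b + h * a)); last by ring.
  by rewrite /GRing.scale /= mulrA mulVf// mul1r.
have lim2 : (fun h : R => b + h * a) @ 0^' --> b + 0 * a.
  apply: cvgD; first exact: cvg_cst.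
  apply: cvgM; last exact: cvg_cst.
  by move=> N N0; exact: nbhs_dnbhs.
rewrite mul0r addr0 in lim2.
have : b = 0 by apply: cvg_unique lim2 lim1.
move/eqP; rewrite mulf_eq0 oppr_eq0 invr_eq0 pnatr_eq0 /=.
by move/eqP.
Unshelve. all: by end_near. Qed.

End Stationary.

(** * The correction algorithm *)

Section Relaxation.
Context {R : realType} (M : triangulation R) (A B : R).
Hypothesis cover : forall x y, in_box A B x y <-> exists t : 'I_(nf M), in_tri t x y.
Variable fstar : plane R -> plane R.
Implicit Types (v w : 'I_(nv M)) (t : 'I_(nf M)).
Local Notation N k := (relaxed (M := M) fstar k).

(** The induction starts because a vertex of a flipped triangle is adjacent to the other two, which
    are also in [N 0]. *)
Lemma relaxedS k : N k `<=` N k.+1.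
Proof.
elim: k => [v [t [tv neg]]|k IH v [w [vw Nw]]]; last first.
  by exists w; split=> //; exact: IH.
have [i [j hi]] := tri3_ex1 tv; have [_ ti _] := tri3_mem hi.
exists i; split; first by apply/adjP; exact: tri3_adj hi.
by exists t.
Qed.

Lemma relaxed_le k l : (k <= l)%N -> N k `<=` N l.
Proof.
move=> /subnK <-; elim: (l - k)%N => [|n IH] //= v /IH; exact: relaxedS.
Qed.

Lemma relaxed_step k : (exists v, ~ N k v) -> (exists v, N 0%N v) ->
  exists2 v, N k.+1 v & ~ N k v.
Proof.
move=> [w wN] [v0 v0N]; apply: contrapT => no.
have v0k : N k v0 by exact: relaxed_le v0N.
apply: wN; apply/asboolP.
apply: (edge_closed_full cover (P := fun v => `[< N k v >]) (v0 := v0)).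
  exact/asboolP.
move=> v u vu /asboolP vN; apply/asboolP; apply: contrapT => uN.
by apply: no; exists u => //; exists v; split=> //; apply/adjP; rewrite adjC.
Qed.

Lemma relaxed_full : (exists v, N 0%N v) -> forall v, N (nv M - 3)%N v.
Proof.
move=> N0; pose S k := [set v | `[< N k v >]]%SET.
have SE k v : (v \in S k) = `[< N k v >] by rewrite inE.
have card_S k : (minn (nv M) (k + 3) <= #|S k|)%N.
  elim: k => [|k IH].
    have [v [t [tv neg]]] := N0; apply: leq_trans (geq_minr _ _) _.
    rewrite add0n -(card_tverts t); apply: subset_leq_card.
    by apply/fintype.subsetP => w tw; rewrite SE; apply/asboolP; exists t.
  have [full|] := pselect (forall v, N k v).
    rewrite (_ : S k.+1 = [set: _]%SET); first by rewrite cardsT card_ord geq_minl.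
    by apply/setP => v; rewrite SE finset.in_setT; apply/asboolP/relaxedS.
  move/existsNP => ex; have [v vN vN'] := relaxed_step ex N0.
  have : (#|S k| < #|S k.+1|)%N.
    apply: proper_card; apply/properP; split.
      by apply/fintype.subsetP => w; rewrite !SE => /asboolP wN;
        apply/asboolP; exact: relaxedS.
    by exists v; rewrite SE; apply/asboolP.
  apply: leq_trans; apply: leq_trans _ (_ : (minn (nv M) (k + 3)).+1 <= _)%N => //.
  by rewrite addSn -minnSS geq_min !leq_min leqnSn leqnn ?orbT //=; lia.
move=> v; apply/asboolP; rewrite -SE.
suff -> : S (nv M - 3)%N = [set: _]%SET by rewrite finset.in_setT.
apply/eqP; rewrite eqEcard finset.subsetT /= cardsT card_ord.
apply: leq_trans (card_S _); rewrite leq_min leqnn /=.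
by rewrite addnC -leq_subLR.
Qed.

Lemma nv_ge3 : (exists v, N 0%N v) -> (3 <= nv M)%N.
Proof.
move=> [v [t _]]; rewrite -(card_tverts t).
by rewrite -[X in (_ <= X)%N](card_ord (nv M)); exact: max_card.
Qed.

End Relaxation.

Theorem corollary1 (R : realType) (d : mapping_data R) (M : triangulation R)
    (fstar : plane R -> plane R) (phi : nat -> plane R -> plane R)
    (hd : admissible_data d)
    (hcover : carrier M = dom1 d)
    (hdisj : pairwise_disjoint (vO d M) (vL d M) (vB d M))
    (hsc : simply_connected R (carrier M))
    (hdel : delaunay M)
    (hA3 : assumption_A3 d M)
    (hA5 : no_cocircular_quadrilateral M)
    (hmin : energy_minimizer d M fstar)
    (hnd : nondegenerate_map M fstar)
    (hstart : ~ orientation_preserving M fstar)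
    (hphi : forall k, correction_step d M fstar k (phi k)) :
  exists nc : nat,
    [/\ is_nc d M fstar nc, (nc < nv M)%N &
        exists2 k, (k <= nc)%N & stops_at M phi k].
Proof.
have [A_gt0 B_gt0 L_gt0] := data_gt0 hd.
have cover x y : in_box (da d) (db d) x y <-> exists t : 'I_(nf M), in_tri t x y.
  have e : dom1 d (pt x y) <-> in_box (da d) (db d) x y := rect_in_box _ _ x y.
  rewrite -e -hcover; split=> [[t _ ht]|[t ht]]; first by exists t.
  by exists t.
have N0 : exists v, relaxed (M := M) fstar 0%N v.
  have /existsNP[t /negP] := hstart; rewrite -leNgt le_eqVlt (negPf (hnd t)) /=.
  by move=> neg; exists (tri M t ord0), t; split=> //; exact: imset_f.
have n3 := nv_ge3 N0.
(* The index [nv M - 3] can be 0, while the union in [freed] starts at step 1; one further step is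
   always enough. *)
have freed_n : freed d M fstar (nv M - 2)%N.
  apply/seteqP; split=> // v [_]; apply; exists (nv M - 2)%N => /=.
    by rewrite leqnn andbT subn_gt0.
  by apply: (relaxed_le (k := (nv M - 3)%N)); [lia|exact: relaxed_full].
have ex_freed : exists n, `[< freed d M fstar n >].
  by exists (nv M - 2)%N; exact/asboolP.
case: (ex_minnP ex_freed) => n /asboolP fn min_n.
have le_n : (n <= nv M - 2)%N by apply: min_n; exact/asboolP.
exists n.+1; split.
- by exists n; split=> // m fm; apply: min_n; exact/asboolP.
- by lia.
have op : orientation_preserving M (phi n.+1).
  have [_ [_ _ bd] stat] := hphi n.+1.
  pose u : 'I_(nv M) -> plane R := vval (phi n.+1).
  have [mU mW] := bdmap_bd_mono hd cover (u := u) bd.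
  (* An inner vertex still constrained at step [n.+1] would belong to a region and, as the sets
     increase, to none of the steps from 1 to [n], against the choice of [n]. *)
  have harm v c : inner (da d) (db d) v -> lap (fun w => u w c ord0) v = 0.
    move=> v_in; apply: stationary_lap; apply: stat => -[[vOL vN]|].
      have : ((@vOU R d M `|` @vLU R d M) `\`
        \bigcup_(k in [set k | (1 <= k <= n)%N]) relaxed fstar k) v.
        split=> // -[k /= /andP[_ kn] kv]; apply: vN.
        by apply: relaxed_le kv; exact: leqW.
      by rewrite fn.
    by move/(vBE hd cover); rewrite v_in.
  move=> t; rewrite det_grad_gt0.
  apply: (orient_gt0 cover A_gt0 B_gt0 hdel hA5 L_gt0 B_gt0); split=> // v.
    exact: harm.
  exact: harm.
have ex_op : exists k, `[< orientation_preserving M (phi k) >].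
  by exists n.+1; exact/asboolP.
(* Success at step [n.+1] bounds the first success, at which the algorithm stops. *)
case: (ex_minnP ex_op) => k /asboolP opk min_k.
exists k; first by apply: min_k; exact/asboolP.
split=> // l lk /asboolP /min_k; by rewrite leqNgt lk.
Qed.
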